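(* Let $\mathcal{H}_1$ be a weighted Hardy space with generating function $G_1(t)=\sum_{n=0}^\infty a_nt^n$ and let $\mathcal{H}_2$ be a weighted Hardy space with generating function $G_2(t)=\sum_{n=0}^\infty b_nt^n$. Assume that $G_1$ is not entire. If $\mathcal{H}_1$ and $\mathcal{H}_2$ are strongly related, then there exist $C,c,\gamma\in(0,\infty)$ such that $c\le\frac{b_n}{a_n}\gamma^n\le C$ for all $n$.
   Context: For $d\in\mathbb{N}$ and $r\in(0,\infty]$ let $r\mathbb{B}_d=\{z\in\mathbb{C}^d:|z|<r\}$ and $\overline{r\mathbb{B}_d}=\{z\in\mathbb{C}^d:|z|\le r\}$ (both equal to $\mathbb{C}^d$ if $r=\infty$); $\langle\cdot,\cdot\rangle_d$ is the standard inner product on $\mathbb{C}^d$. A Hilbert function space (RKHS) on a set $X$ is a Hilbert space of complex functions on $X$ all of whose point evaluations are bounded. Generating function: a power series $G(t)=\sum_{n\ge0}a_nt^n$ with $a_0=1$, $a_n>0$ for all $n$, and radius of convergence in $(0,\infty]$. Weighted Hardy space in $d$ variables ($d\in\mathbb N$; the number of variables may differ for the two spaces): a Hilbert function space of holomorphic functions on a ball $r\mathbb{B}_d$, $r\in(0,\infty]$, in which the monomials $z^\alpha$ form a complete orthogonal set of nonzero vectors with $\|z^\alpha\|^2/\alpha!=\|z^\beta\|^2/\beta!$ whenever $|\alpha|=|\beta|$, and $\|\mathbf{1}\|=1$. Equivalently its reproducing kernel is $K(z,w)=G(\langle z,w\rangle_d)$ for a (unique) generating function $G=\sum a_nt^n$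 (the generating function of the space), and then $\|z^\alpha\|^{-2}=a_{|\alpha|}\frac{|\alpha|!}{\alpha!}$. Convention: every weighted Hardy space is regarded as a space of functions on its natural maximal domain $X$: if $r^2\in(0,\infty]$ is the radius of convergence of $G$, then $X=\mathbb{C}^d$ if $r=\infty$; $X=r\mathbb{B}_d$ if $r<\infty$ and $G(r^2)=\infty$; $X=\overline{r\mathbb{B}_d}$ if $r<\infty$ and $G(r^2)<\infty$ (functions then extend continuously to the closed ball). For Hilbert function spaces $\mathcal{H}_i$ on $X_i$, a weighted composition operator $W_{\lambda,\varphi}:\mathcal{H}_2\to\mathcal{H}_1$ is a bounded operator $f\mapsto\lambda\,(f\circ\varphi)$ with $\varphi:X_1\to X_2$ and $\lambda:X_1\to\mathbb{C}$; it is invertible if it is a bounded bijection (its inverse need not be a weighted composition operator). $\mathcal{H}_1$ is weakly related to $\mathcal{H}_2$ if there is an invertible weighted composition operator $\mathcal{H}_2\to\mathcal{H}_1$. $\mathcal{H}_1$ and $\mathcal{H}_2$ are strongly related if each is weakly related to the other. *)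

(* Defs.v *)
From HB Require Import structures.
From mathcomp Require Import all_boot all_order all_algebra.
From mathcomp Require Import complex.
From mathcomp Require Import all_classical all_reals all_analysis.

Set Implicit Arguments.
Unset Strict Implicit.
Unset Printing Implicit Defensive.

Import Order.TTheory GRing.Theory Num.Theory Num.Def.
Import numFieldNormedType.Exports.

Local Open Scope classical_set_scope.
Local Open Scope ring_scope.
Local Open Scope complex_scope.

(* The elements of the space are represented by an abstract left module
   together with an injective linear evaluation map into the functions X -> C:
   a vector is thus the same thing as the function it evaluates to. *)
Record hilbert_function_space (R : realType) (X : Type) := HilbertFunctionSpace {
  hfs_vect :> lmodType R[i];
  hfs_dot : {dot hfs_vect for conjC};
  hfs_eval : hfs_vect -> X -> R[i];
  hfs_eval_linear : forall (c : R[i]) (f g : hfs_vect) (x : X),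
    hfs_eval (c *: f + g) x = c * hfs_eval f x + hfs_eval g x;
  hfs_eval_inj : forall f g : hfs_vect,
    (forall x, hfs_eval f x = hfs_eval g x) -> f = g;
  hfs_complete : forall u : nat -> hfs_vect,
    (forall e : R, 0 < e -> exists N : nat, forall m n : nat,
       (N <= m)%N -> (N <= n)%N ->
       Num.sqrt (complex.Re (hfs_dot (u m - u n) (u m - u n))) < e) ->
    exists l : hfs_vect, forall e : R, 0 < e -> exists N : nat,
      forall n : nat, (N <= n)%N ->
      Num.sqrt (complex.Re (hfs_dot (u n - l) (u n - l))) < e;
  hfs_eval_bounded : forall x : X, exists M : R, forall f : hfs_vect,
    `|hfs_eval f x| <= (M * Num.sqrt (complex.Re (hfs_dot f f)))%:C
}.

Definition hfs_norm (R : realType) (X : Type)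
    (H : hilbert_function_space R X) (f : H) : R :=
  Num.sqrt (complex.Re (hfs_dot H f f)).

Definition invertible_weighted_composition (R : realType) (X1 X2 : Type)
    (H1 : hilbert_function_space R X1) (H2 : hilbert_function_space R X2)
    (lambda : X1 -> R[i]) (phi : X1 -> X2) (W : H2 -> H1) : Prop :=
  [/\ forall (f : H2) (x : X1),
        hfs_eval (W f) x = lambda x * hfs_eval f (phi x),
      exists M : R, forall f : H2, hfs_norm (W f) <= M * hfs_norm f &
      bijective W].

Definition weakly_related (R : realType) (X1 X2 : Type)
    (H1 : hilbert_function_space R X1) (H2 : hilbert_function_space R X2) :=
  exists (lambda : X1 -> R[i]) (phi : X1 -> X2) (W : H2 -> H1),
    invertible_weighted_composition lambda phi W.

Definition strongly_related (R : realType) (X1 X2 : Type)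
    (H1 : hilbert_function_space R X1) (H2 : hilbert_function_space R X2) :=
  weakly_related H1 H2 /\ weakly_related H2 H1.

Definition convergence_radius (R : realType) (a : nat -> R) : \bar R :=
  ereal_sup [set x%:E | x in [set x : R | 0 <= x /\ cvgn (pseries a x)]].

Definition generating_function (R : realType) (a : nat -> R) : Prop :=
  [/\ a 0%N = 1, forall n, 0 < a n & (0 < convergence_radius a)%E].

Definition entire (R : realType) (a : nat -> R) : Prop :=
  convergence_radius a = +oo%E.

(* [dotmx z w] is the standard inner product, conjugate-linear in [w]. The
   library norm on row vectors is the sup norm, hence this definition. *)
Definition euclid_norm (R : realType) (d : nat) (z : 'rV[R[i]^o]_d) : R :=
  Num.sqrt (complex.Re (dotmx z z)).

(* The radius of convergence of G is r ^+ 2, so the ball has radius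
   r = Num.sqrt (radius of convergence). The -oo case does not occur. *)
Definition open_domain (R : realType) (d : nat) (a : nat -> R) :
    set 'rV[R[i]^o]_d :=
  match convergence_radius a with
  | r2%:E => [set z | euclid_norm z < Num.sqrt r2]
  | +oo%E => setT
  | -oo%E => set0
  end.

(* For positive coefficients, G(r ^+ 2) < oo means convergence at r ^+ 2. *)
Definition natural_domain (R : realType) (d : nat) (a : nat -> R) :
    set 'rV[R[i]^o]_d :=
  match convergence_radius a with
  | r2%:E => if `[< cvgn (pseries a r2) >]
             then [set z | euclid_norm z <= Num.sqrt r2]
             else [set z | euclid_norm z < Num.sqrt r2]
  | +oo%E => setT
  | -oo%E => set0
  end.

Definition multi_index (d : nat) := {ffun 'I_d -> nat}.

Definition mi_degree (d : nat) (alpha : multi_index d) : nat :=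
  (\sum_(i < d) alpha i)%N.

Definition mi_fact (d : nat) (alpha : multi_index d) : nat :=
  (\prod_(i < d) (alpha i)`!)%N.

Definition monomial (R : realType) (d : nat) (alpha : multi_index d)
    (z : 'rV[R[i]^o]_d) : R[i] :=
  \prod_(i < d) (z ord0 i : R[i]) ^+ alpha i.

(* Weighted Hardy space in d variables with generating function
   G(t) = \sum_n a n * t ^+ n, on its natural maximal domain. *)
Record weighted_hardy (R : realType) (d : nat) (a : nat -> R)
    (H : hilbert_function_space R (@natural_domain R d a)) : Prop := {
  wh_generating : generating_function a;
  wh_holomorphic : forall f : H, exists F : 'rV[R[i]^o]_d -> R[i]^o,
    [/\ forall x : @natural_domain R d a, hfs_eval f x = F (\val x),
        {within @natural_domain R d a, continuous F} &
        forall z, open_domain a z -> differentiable F z];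
  wh_monomials : exists m : multi_index d -> H,
    [/\ forall alpha (x : @natural_domain R d a),
          hfs_eval (m alpha) x = monomial alpha (\val x),
        forall alpha, m alpha != 0,
        forall alpha beta, alpha <> beta ->
          hfs_dot H (m alpha) (m beta) = 0,
        forall (f : H) (e : R), 0 < e ->
          exists (s : seq (multi_index d)) (c : multi_index d -> R[i]),
            hfs_norm (f - \sum_(alpha <- s) c alpha *: m alpha) < e &
        (forall alpha beta, mi_degree alpha = mi_degree beta ->
          hfs_norm (m alpha) ^+ 2 / (mi_fact alpha)%:R =
          hfs_norm (m beta) ^+ 2 / (mi_fact beta)%:R) /\
        hfs_norm (m [ffun=> 0%N]) = 1];
  (* the reproducing kernel of H is K(z, w) = G(<z, w>) *)
  wh_kernel : forall w : @natural_domain R d a, exists k : H,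
    (forall f : H, hfs_eval f w = hfs_dot H f k) /\
    (forall z : @natural_domain R d a,
       [series ((a n)%:C * dotmx (\val z) (\val w) ^+ n : R[i]^o)]_n @ \oo
         --> (hfs_eval k z : R[i]^o))
}.

(* Main.v *)
Require Import Defs.
From HB Require Import structures.
From mathcomp Require Import all_boot all_order all_algebra.
From mathcomp Require Import complex.
From mathcomp Require Import zify ring lra.
From mathcomp Require Import all_classical all_reals all_analysis.
Import Order.TTheory GRing.Theory Num.Theory.
Import numFieldNormedType.Exports.

(** The operators of the statement are bounded, invertible and of the form
    [f |-> lam (f o phi)].  Write [W], with symbol [phi], and [W'], with symbol
    [psi], for the given operators, [X1] for the domain of [H1] and [T] for the
    composite of [W] and [W'], a weighted composition operator on [H1] with
    symbol [F := psi o phi] and multiplier [lam].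

    The core of the proof is that [phi] is a bijection.  Symbols of invertible
    operators are injective ([wco_inj]), so it is enough that [F] maps [X1] onto
    [X1] ([selfmap_onto]).  Put [S := T^-1], so that [S g (F z) = g z / lam z].
    If [u1 u2 = u3] in [H1], then [S u1 S u2 = S u3 S 1] at the points of the
    range of [F].  An analytic function vanishing on that range is zero: the
    derivative of [F] at 0 is invertible ([selfmap_derivative]), hence all the
    Taylor coefficients of the function at [F 0] vanish ([selfmap_near]), and
    the identity theorem applies ([analytic_identity]).  The equation therefore
    holds on all of [X1] ([selfmap_mult]): at a point [y] where [S 1] does not
    vanish, [g |-> S g y / S 1 y] is multiplicative and bounded, so it is the
    evaluation at some [x] of [X1], and [F x = y] ([selfmap_range]).

    It remains to see that [S 1] has no zero, and this is where [G1] must not be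
    entire: the domain is then a ball of finite radius.  At [y = F x] one has
    [lam x * S 1 y = 1], so that [lam] blows up at the preimages of points
    tending to a zero of [S 1].  On a closed ball [lam] is bounded.  On an open
    ball, consider the first zero [q] on a segment.  The preimages, whose
    coordinates are the quotients [S z_j / S 1], stay in the ball; their
    singularity at [q] is removable and they tend to a point [x0] of the closed
    ball.  Inside the ball, [lam] is locally bounded at [x0], a contradiction; on
    the sphere, the maximum principle ([tay_max_vec]) makes the preimages
    constant, although they belong to the open ball.

    So [phi] has an inverse [theta], which is again a symbol.  Unitary maps are
    symbols as well ([unitary_comp]), and composing all these one finds mutually
    inverse symbols [tau], [sigma] with [tau 0 = 0] ([wiso_fix0]).  If
    [p := phi 0] is not 0, the maximum principle on the disc
    [{c p : |c| <= 1}] and the intermediate value theorem on its boundary give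
    [c] of modulus 1 with [|theta (c p)| = |theta 0|]; a unitary [V] moves
    [theta (c p)] to [theta 0], and [tau := phi o V o theta o c o phi] fixes the
    origin.

    After a rotation of the target, [tau (t e0) = t s e0 + O(t^2)] with [s > 0],
    and [sigma] behaves in the same way with [s^-1] ([wiso_axis]).  The
    coefficient of [z_0^n] in the image of [z_0^n] is then [lam 0 s^n]
    ([cf_axis_wco]).  As the squared norms of [z_0^n] are [(a n)^-1] and
    [(b n)^-1] ([mon_axis_norm]), boundedness of the operator bounds
    [b n / a n * s^(2 n)] from above, and the inverse bounds it from below, so
    [gamma := s^2] is as required.

    Holomorphy is used throughout in the form of Taylor expansions along complex
    lines with explicit remainders ([tay]), obtained from the expansion along the
    monomials ([ev_tay]). *)

Set Implicit Arguments.
Unset Strict Implicit.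
Unset Printing Implicit Defensive.
Local Open Scope ring_scope.
Local Open Scope complex_scope.

(** * Moduli of complex numbers *)

(** The norm of a complex number is itself a complex number; this is its value in
    the real field. *)
Notation nc := Normc.normc.
Arguments Normc.normc : simpl never.

Section Modulus.
Context {R : realType}.
Implicit Types x y z : R[i].

Lemma rcM (a b : R) : (a * b)%:C = a%:C * b%:C.
Proof. exact: rmorphM. Qed.
Lemma rcD (a b : R) : (a + b)%:C = a%:C + b%:C.
Proof. exact: rmorphD. Qed.
Lemma rcB (a b : R) : (a - b)%:C = a%:C - b%:C.
Proof. exact: rmorphB. Qed.
Lemma rcX (a : R) n : (a ^+ n)%:C = a%:C ^+ n.
Proof. exact: rmorphXn. Qed.
Lemma rc_sum (I : Type) (s : seq I) (P : pred I) (F : I -> R) :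
  (\sum_(i <- s | P i) F i)%:C = \sum_(i <- s | P i) (F i)%:C.
Proof. exact: rmorph_sum. Qed.
Lemma rc_eq0 (a : R) : (a%:C == 0) = (a == 0).
Proof. by rewrite -(inj_eq (@complexI R)). Qed.

Lemma ncE x : `|x| = (nc x)%:C.
Proof. by rewrite normc_def; case: x. Qed.

Lemma nc_ge0 x : 0 <= nc x.
Proof. by rewrite -lecR -ncE normr_ge0. Qed.

Lemma ncD x y : nc (x + y) <= nc x + nc y.
Proof. by rewrite -lecR rcD -!ncE ler_normD. Qed.

Lemma ncN x : nc (- x) = nc x.
Proof. by apply: complexI; rewrite -!ncE normrN. Qed.

Lemma ncB x y : nc (x - y) <= nc x + nc y.
Proof. by rewrite -(ncN y) ncD. Qed.

Lemma nc_dist x y : nc (x - y) = nc (y - x).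
Proof. by rewrite -ncN opprB. Qed.

Lemma ncM x y : nc (x * y) = nc x * nc y.
Proof. exact: Normc.normcM. Qed.

Lemma ncV x : nc x^-1 = (nc x)^-1.
Proof. exact: Normc.normcV. Qed.

Lemma nc0 : nc (0 : R[i]) = 0.
Proof. exact: Normc.normc0. Qed.

Lemma nc1 : nc (1 : R[i]) = 1.
Proof. exact: Normc.normc1. Qed.

Lemma nc_eq0 x : (nc x == 0) = (x == 0).
Proof.
by apply/eqP/eqP => [/Normc.eq0_normc //|->]; rewrite nc0.
Qed.

Lemma nc_gt0 x : (0 < nc x) = (x != 0).
Proof. by rewrite lt_neqAle nc_ge0 eq_sym nc_eq0 andbT. Qed.

Lemma ncX x n : nc (x ^+ n) = nc x ^+ n.
Proof. by elim: n => [|n IH]; rewrite ?expr0 ?nc1 // !exprS ncM IH. Qed.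

Lemma nc_real (r : R) : nc r%:C = `|r|.
Proof. by rewrite /Normc.normc /= expr0n addr0 sqrtr_sqr. Qed.

Lemma rc_nat n : (n%:R : R)%:C = n%:R.
Proof. exact: rmorph_nat. Qed.

Lemma nc_nat n : nc (n%:R : R[i]) = n%:R.
Proof. by rewrite -rc_nat nc_real ger0_norm. Qed.

Lemma nc_sum (I : Type) (s : seq I) (P : pred I) (F : I -> R[i]) :
  nc (\sum_(i <- s | P i) F i) <= \sum_(i <- s | P i) nc (F i).
Proof.
elim/big_rec2: _ => [|i y1 y2 _ IH]; first by rewrite nc0.
by apply: (le_trans (ncD _ _)); rewrite lerD2l.
Qed.

Lemma nc_tri x y z : nc (x - z) <= nc (x - y) + nc (y - z).
Proof. by rewrite (_ : x - z = (x - y) + (y - z)) ?ncD //; ring. Qed.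

Lemma nc_lower x y : nc x - nc y <= nc (x + y).
Proof.
rewrite lerBlDr; have := ncD (x + y) (- y).
by rewrite ncN addrK.
Qed.

Lemma nc_conj x : nc x^*%C = nc x.
Proof. by case: x => a b; rewrite /Normc.normc /=; rewrite sqrrN. Qed.

Lemma nc_sqr x : ((nc x) ^+ 2)%:C = x * x^*%C.
Proof. by rewrite rcX -ncE sqr_normc. Qed.

Lemma nc_Re x : `|complex.Re x| <= nc x.
Proof. by rewrite -lecR -ncE normc_ge_Re. Qed.

Lemma nc_Im x : `|complex.Im x| <= nc x.
Proof.
case: x => a b; rewrite /Normc.normc /=; rewrite -sqrtr_sqr ler_sqrt ?addr_ge0 ?sqr_ge0 //.
by rewrite lerDr sqr_ge0.
Qed.

Lemma nc_le_ReIm x : nc x <= `|complex.Re x| + `|complex.Im x|.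
Proof.
case: x => a b; rewrite /Normc.normc /=.
rewrite -(ler_pXn2r (_ : (0 < 2)%N)) ?nnegrE ?addr_ge0 ?sqrtr_ge0 //.
rewrite sqr_sqrtr ?addr_ge0 ?sqr_ge0 // sqrrD !real_normK ?num_real //.
have : 0 <= `|a| * `|b| by rewrite mulr_ge0.
lra.
Qed.

Lemma nc_small0 x : (forall e : R, 0 < e -> nc x <= e) -> x = 0.
Proof.
move=> h; apply/eqP; rewrite -nc_eq0 eq_le nc_ge0 andbT.
by apply/ler_addgt0Pl => e e0; rewrite addr0; exact: h.
Qed.

Lemma fin_delta (T : Type) (m : T -> R) (k : nat) (P : 'I_k -> T -> Prop) :
  (forall j, exists2 del : R, 0 < del & forall t, m t < del -> P j t) ->
  exists2 del : R, 0 < del & forall t, m t < del -> forall j, P j t.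
Proof.
move=> h; suff [del d0 hd] : exists2 del : R, 0 < del & forall t, m t < del ->
    forall j, j \in enum 'I_k -> P j t.
  by exists del => // t ht j; apply: hd; rewrite ?mem_enum.
elim: (enum 'I_k) => [|i r [del d0 IH]]; first by exists 1.
have [del' d'0 h'] := h i; exists (Num.min del del'); first by rewrite lt_min d0.
move=> t; rewrite lt_min => /andP[h1 h2] j; rewrite inE => /orP[/eqP ->|hj].
  exact: h'.
exact: IH.
Qed.

End Modulus.

(** * Hermitian forms and the Euclidean norm *)

Section DotForm.
Context {R : realType} {U : lmodType R[i]} (f : {dot U for Num.Def.conjC}).
Implicit Types u v w : U.

Definition fnorm u : R := Num.sqrt (complex.Re (f u u)).

Lemma formC u v : f u v = (f v u)^*%C.
Proof. by rewrite hermC expr0 mul1r. Qed.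

Lemma form_ge0 u : 0 <= f u u.
Proof.
have [->|/neq0_dnorm_gt0 /ltW -> //] := eqVneq u 0.
by rewrite linear0l.
Qed.

Lemma formE u : f u u = (fnorm u ^+ 2)%:C.
Proof.
have := form_ge0 u; rewrite lecE => /andP[/eqP im re].
by rewrite /fnorm sqr_sqrtr //; case: (f u u) im => a b /= ->.
Qed.

Lemma fnorm_ge0 u : 0 <= fnorm u.
Proof. exact: sqrtr_ge0. Qed.

Lemma fnorm_eq0 u : fnorm u = 0 -> u = 0.
Proof.
move=> h; apply/eqP; apply/negPn/negP => /(@neq0_dnorm_gt0 _ _ _ f).
by rewrite formE h expr0n ltxx.
Qed.

Lemma formDl u v w : f (u + v) w = f u w + f v w.
Proof. by rewrite linearDl. Qed.
Lemma formDr u v w : f w (u + v) = f w u + f w v.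
Proof. by rewrite linearDr. Qed.
Lemma formZl (c : R[i]) u w : f (c *: u) w = c * f u w.
Proof. by rewrite linearZl_LR. Qed.
Lemma formZr (c : R[i]) u w : f w (c *: u) = c^*%C * f w u.
Proof. by rewrite linearZr_LR. Qed.
Lemma formBl u v w : f (u - v) w = f u w - f v w.
Proof. by rewrite linearBl. Qed.
Lemma formBr u v w : f w (u - v) = f w u - f w v.
Proof. by rewrite linearBr. Qed.

Lemma form_suml (I : Type) (r : seq I) (P : pred I) (F : I -> U) w :
  f (\sum_(i <- r | P i) F i) w = \sum_(i <- r | P i) f (F i) w.
Proof. by rewrite linear_sumlz. Qed.
Lemma form_sumr (I : Type) (r : seq I) (P : pred I) (F : I -> U) w :
  f w (\sum_(i <- r | P i) F i) = \sum_(i <- r | P i) f w (F i).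
Proof. by rewrite linear_sumr. Qed.

Lemma fnormZ (c : R[i]) u : fnorm (c *: u) = nc c * fnorm u.
Proof.
apply/eqP; rewrite -(eqrXn2 (_ : (0 < 2)%N)) ?mulr_ge0 ?nc_ge0 ?fnorm_ge0 //.
apply/eqP; apply: complexI.
rewrite -formE formZl formZr formE exprMn (rcM (nc c ^+ 2)) nc_sqr.
ring.
Qed.

Lemma fnorm0 : fnorm 0 = 0.
Proof. by rewrite -(scale0r (0 : U)) fnormZ nc0 mul0r. Qed.

Lemma fnormN u : fnorm (- u) = fnorm u.
Proof. by rewrite -scaleN1r fnormZ ncN nc1 mul1r. Qed.

Lemma fnorm_dist u v : fnorm (u - v) = fnorm (v - u).
Proof. by rewrite -fnormN opprB. Qed.

Lemma fnormD_sqr u v :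
  fnorm (u + v) ^+ 2 = fnorm u ^+ 2 + fnorm v ^+ 2 + 2 * complex.Re (f u v).
Proof.
have : (fnorm (u + v) ^+ 2)%:C =
    (fnorm u ^+ 2 + fnorm v ^+ 2 + 2 * complex.Re (f u v))%:C.
  rewrite -formE formDl !formDr (formC v u) !formE !rcD rcM.
  case: (f u v) => a b /=; apply/eqP; rewrite eq_complex /=.
  by apply/andP; split; apply/eqP; ring.
by move=> /complexI.
Qed.

Lemma fnormB_sqr u v :
  fnorm (u - v) ^+ 2 = fnorm u ^+ 2 + fnorm v ^+ 2 - 2 * complex.Re (f u v).
Proof.
rewrite fnormD_sqr fnormN -scaleN1r formZr rmorphN1 mulN1r.
by case: (f u v) => a b /=; ring.
Qed.

Lemma parallelogram u v :
  fnorm (u + v) ^+ 2 + fnorm (u - v) ^+ 2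
  = 2 * fnorm u ^+ 2 + 2 * fnorm v ^+ 2.
Proof. rewrite fnormD_sqr fnormB_sqr; ring. Qed.

Lemma fnormD_orth u v : f u v = 0 ->
  fnorm (u + v) ^+ 2 = fnorm u ^+ 2 + fnorm v ^+ 2.
Proof. by move=> h; rewrite fnormD_sqr h mulr0 addr0. Qed.

Lemma cauchy_schwarz u v : nc (f u v) <= fnorm u * fnorm v.
Proof.
have [->|v0] := eqVneq v 0; first by rewrite linear0r nc0 fnorm0 mulr0.
have nv : 0 < fnorm v.
  rewrite lt_neqAle fnorm_ge0 andbT eq_sym; apply: contra v0 => /eqP h.
  by rewrite (fnorm_eq0 h).
have fv0 : f v v != 0.
  by rewrite formE rc_eq0 sqrf_eq0 gt_eqF.
pose c := f u v / f v v.
have o : f (u - c *: v) (c *: v) = 0.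
  by rewrite formZr formBl formZl /c divfK // subrr mulr0.
have := fnormD_orth o; rewrite subrK => e.
have le : fnorm (c *: v) ^+ 2 <= fnorm u ^+ 2 by rewrite e lerDr sqr_ge0.
have le1 : fnorm (c *: v) <= fnorm u.
  by rewrite -(ler_pXn2r (_ : (0 < 2)%N)) ?nnegrE ?fnorm_ge0.
have ev : nc (f u v) = nc c * fnorm v ^+ 2.
  by rewrite -[f u v](divfK fv0) ncM {2}formE nc_real ger0_norm ?sqr_ge0.
by rewrite ev expr2 mulrA -fnormZ ler_pM2r.
Qed.

Lemma fnormD u v : fnorm (u + v) <= fnorm u + fnorm v.
Proof.
rewrite -(ler_pXn2r (_ : (0 < 2)%N)) ?nnegrE ?addr_ge0 ?fnorm_ge0 //.
rewrite fnormD_sqr sqrrD.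
have := cauchy_schwarz u v; have := nc_Re (f u v).
have := ler_norm (complex.Re (f u v)).
lra.
Qed.

Lemma fnormB u v : fnorm (u - v) <= fnorm u + fnorm v.
Proof. by rewrite -(fnormN v) fnormD. Qed.

Lemma fnorm_tri u v w : fnorm (u - w) <= fnorm (u - v) + fnorm (v - w).
Proof. by have := fnormD (u - v) (v - w); rewrite subrKA. Qed.

End DotForm.

(** Locked, for otherwise unification unfolds it to the underlying form. *)
HB.lock Definition en (R : realType) (d : nat) (z : 'rV[R[i]^o]_d) : R :=
  euclid_norm z.

Section Euclid.
Context {R : realType} {d : nat}.
Local Notation V := 'rV[R[i]^o]_d.
Implicit Types z w : V.

Definition cdot z w : R[i] := dotmx (z : 'rV[R[i]]_d) (w : 'rV[R[i]]_d).
Local Notation en := (@en R d).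

Lemma enE z : en z = fnorm (@dotmx R[i] d) (z : 'rV[R[i]]_d).
Proof. by rewrite en.unlock. Qed.

Lemma cdotE z w : cdot z w = \sum_(j < d) z 0 j * (w 0 j)^*%C.
Proof.
by rewrite /cdot dotmxE mxE; apply: eq_bigr => j _; rewrite !mxE.
Qed.

Lemma cdotzz z : cdot z z = (en z ^+ 2)%:C.
Proof. by rewrite en.unlock /cdot formE. Qed.

Lemma en_sqr z : en z ^+ 2 = \sum_(j < d) nc (z 0 j) ^+ 2.
Proof.
apply: complexI; rewrite -cdotzz cdotE rc_sum.
by apply: eq_bigr => j _; rewrite nc_sqr.
Qed.

Lemma en_ge0 z : 0 <= en z. Proof. by rewrite en.unlock; exact: fnorm_ge0. Qed.
Lemma en0 : en 0 = 0. Proof. by rewrite en.unlock; exact: fnorm0. Qed.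
Lemma enD z w : en (z + w) <= en z + en w. Proof. by rewrite en.unlock; exact: fnormD. Qed.
Lemma enZ (c : R[i]) z : en (c *: z) = nc c * en z. Proof. by rewrite en.unlock; exact: fnormZ. Qed.
Lemma en_eq0 z : en z = 0 -> z = 0. Proof. by rewrite en.unlock; exact: fnorm_eq0. Qed.
Lemma en_dist u v : en (u - v) = en (v - u).
Proof. by rewrite en.unlock; exact: fnorm_dist. Qed.
Lemma en_lip z w : `|en z - en w| <= en (z - w).
Proof.
have h u v : en u <= en v + en (u - v) by rewrite -{1}(subrK v u) addrC enD.
by rewrite ler_distl lerBlDr; apply/andP; split; [rewrite en_dist|]; exact: h.
Qed.
Lemma en_CS z w : nc (cdot z w) <= en z * en w.
Proof. by rewrite en.unlock; exact: cauchy_schwarz. Qed.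

Lemma en_sqrB z w :
  en (z - w) ^+ 2 = en z ^+ 2 + en w ^+ 2 - 2 * complex.Re (cdot z w).
Proof. by rewrite en.unlock; exact: fnormB_sqr. Qed.
Lemma cdotZl (c : R[i]) z w : cdot (c *: z) w = c * cdot z w.
Proof. exact: formZl. Qed.
Lemma cdotZr (c : R[i]) z w : cdot z (c *: w) = c^*%C * cdot z w.
Proof. exact: formZr. Qed.
Lemma en_gt0 z : z != 0 -> 0 < en z.
Proof.
move=> z0; rewrite lt_neqAle en_ge0 andbT eq_sym; apply: contra z0.
by move=> /eqP /en_eq0 ->.
Qed.

Lemma nc_le_en z j : nc (z 0 j) <= en z.
Proof.
rewrite -(ler_pXn2r (_ : (0 < 2)%N)) ?nnegrE ?en_ge0 ?nc_ge0 // en_sqr.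
by rewrite (bigD1 j) //= lerDl sumr_ge0 // => i _; rewrite sqr_ge0.
Qed.

Lemma en_le_sum z : en z <= \sum_(j < d) nc (z 0 j).
Proof.
have s0 : 0 <= \sum_(j < d) nc (z 0 j) by apply: sumr_ge0 => j _; rewrite nc_ge0.
rewrite -(ler_pXn2r (_ : (0 < 2)%N)) ?nnegrE ?en_ge0 // en_sqr expr2.
rewrite mulr_suml; apply: ler_sum => j _.
rewrite expr2 ler_wpM2l ?nc_ge0 // (bigD1 j) //= lerDl sumr_ge0 // => i _.
exact: nc_ge0.
Qed.

Lemma en_unitary (M : 'M[R[i]]_d) z w : M \is unitarymx ->
  cdot (z *m M) (w *m M) = cdot z w.
Proof.
move=> /unitarymxP h; rewrite /cdot !dotmxE trmx_mul map_mxM /=.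
by rewrite mulmxA -(mulmxA _ M) h mulmx1.
Qed.

End Euclid.

Lemma en_unitaryE (R : realType) d (M : 'M[R[i]]_d) (z : 'rV[R[i]^o]_d) :
  M \is unitarymx -> en (z *m M : 'rV[R[i]^o]_d) = en z.
Proof. by move=> h; rewrite en.unlock /euclid_norm -/(cdot _ _) en_unitary. Qed.

(** Gram-Schmidt applied to the matrix whose rows are all equal to [u] gives a
    unitary matrix with [u] on the line of its first row; take its adjoint. *)
Lemma unitary_to_axis (R : realType) d (u : 'rV[R[i]^o]_d.+1) :
  exists2 M : 'M[R[i]]_d.+1, M \is unitarymx &
    (u *m M : 'rV[R[i]^o]_d.+1) = (en u)%:C *: (delta_mx 0 0).
Proof.
pose A : 'M[R[i]]_d.+1 := \matrix_(i, j) u 0 j.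
pose B := schmidt A.
have uB : B \is unitarymx by apply: schmidt_unitarymx.
have rA : row 0 A = u by apply/rowP => j; rewrite !mxE.
have := row_schmidt_sub A 0; rewrite (eq_bigl (pred1 0)); last first.
  by move=> k /=; rewrite leqn0.
rewrite big_pred1_eq genmxE rA => /sub_rVP [c uc].
have rB : dotmx (row 0 B) (row 0 B) = 1.
  by have /row_unitarymxP -> := uB; rewrite eqxx.
have c0 : 0 <= c.
  have := form1_row_schmidt A 0; rewrite rA uc -/B.
  have -> // : dotmx (c *: row 0 B) (row 0 B) = c.
  by rewrite -[RHS]mulr1 -rB; exact: formZl.
have cE : c = (en u)%:C.
  have : en u = nc c.
    rewrite uc enE fnormZ (_ : fnorm _ (row 0 B) = 1) ?mulr1 //.
    by rewrite /fnorm -[RHS]sqrtr1; congr Num.sqrt; have := congr1 (@complex.Re R) rB.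
  by move=> ->; rewrite -ncE ger0_norm.
exists (B^t*)%sesqui; first by rewrite trmxC_unitary.
have BB : B *m (B^t*)%sesqui = 1%:M by apply/unitarymxP.
have rBM : row 0 B *m (B^t*)%sesqui = delta_mx 0 0.
  by rewrite -row_mul BB row1.
by rewrite -cE {1}uc -scalemxAl rBM.
Qed.

(** * Taylor expansions in one variable *)

Section Taylor.
Context {R : realType}.
Local Notation C := R[i].
Implicit Types (u v : C -> C) (d e : nat -> C).

Lemma geom_small (M q : R) : 0 <= q -> q < 1 ->
  forall e : R, 0 < e -> exists K, M * q ^+ K <= e.
Proof.
move=> q0 q1 e e0.
have : (M * q ^+ K @[K --> \oo] --> (M * 0 : R))%classic.
  by apply: cvgMr; apply: cvg_expr; rewrite ger0_norm.
rewrite mulr0 => /cvgr0Pnorm_lt /(_ e e0) [K _ /(_ K (leqnn K))] h.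
by exists K; exact: (le_trans (ler_norm _) (ltW h)).
Qed.

(** Holomorphy of [u] on the disc of radius [s] without integrals: [d] lists the
    Taylor coefficients and every remainder is bounded geometrically.  Sums,
    products, limits and division by powers of the variable preserve this, with
    explicit constants. *)
Definition tay u (M s : R) d :=
  0 < s /\ forall K (eta : C), nc eta <= s ->
    nc (u eta - \sum_(k < K) d k * eta ^+ k) <= M * (nc eta / s) ^+ K.

Lemma tay_s_gt0 u M s d : tay u M s d -> 0 < s.
Proof. by case. Qed.

Lemma tay_bound u M s d : tay u M s d ->
  forall eta, nc eta <= s -> nc (u eta) <= M.
Proof.
by move=> [_ h] eta /(h 0%N); rewrite big_ord0 subr0 expr0 mulr1.
Qed.

Lemma tay_M_ge0 u M s d : tay u M s d -> 0 <= M.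
Proof.
move=> h; have := tay_bound h (eta := 0); rewrite nc0 => /(_ (ltW (tay_s_gt0 h))).
exact: le_trans (nc_ge0 _).
Qed.

Lemma tay_at0 u M s d : tay u M s d -> u 0 = d 0%N.
Proof.
move=> [s0 h]; have := h 1%N 0; rewrite nc0 => /(_ (ltW s0)).
rewrite mul0r expr1 mulr0 big_ord1 expr0 mulr1 => le.
by apply/eqP; rewrite -subr_eq0 -nc_eq0 eq_le le nc_ge0.
Qed.

(** Cauchy's estimate, read off two consecutive remainders at [eta = s]. *)
Lemma tay_coef u M s d : tay u M s d -> forall k, nc (d k) * s ^+ k <= 2 * M.
Proof.
move=> [s0 h] k; have ncs : nc s%:C = s by rewrite nc_real ger0_norm // ltW.
have hs K : nc (u s%:C - \sum_(k < K) d k * s%:C ^+ k) <= M.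
  by have := h K s%:C; rewrite ncs divff ?gt_eqF // expr1n mulr1; apply.
have := hs k.+1; have := hs k; rewrite big_ord_recr /=.
set S := \sum_(_ < k) _ => h1 h2.
have -> : nc (d k) * s ^+ k = nc (d k * s%:C ^+ k) by rewrite ncM ncX ncs.
have -> : d k * s%:C ^+ k = (u s%:C - S) - (u s%:C - (S + d k * s%:C ^+ k)).
  by ring.
by apply: (le_trans (ncB _ _)); lra.
Qed.

Lemma tay_shrink u M s d s' : tay u M s d -> 0 < s' -> s' <= s ->
  tay u M s' d.
Proof.
move=> h s'0 le; split=> // K eta he.
have [s0 h'] := h; apply: (le_trans (h' K eta (le_trans he le))).
apply: ler_wpM2l; first exact: tay_M_ge0 h.
apply: lerXn2r.
- by rewrite nnegrE divr_ge0 ?nc_ge0 // ltW.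
- by rewrite nnegrE divr_ge0 ?nc_ge0 // ltW.
- by apply: ler_wpM2l; rewrite ?nc_ge0 // lef_pV2.
Qed.

Lemma tay_M_le u M s d M' : tay u M s d -> M <= M' -> tay u M' s d.
Proof.
move=> [s0 h] le; split=> // K eta he; apply: (le_trans (h K eta he)).
by rewrite ler_wpM2r // exprn_ge0 // divr_ge0 ?nc_ge0 ?ltW.
Qed.

Lemma tay_ext u v M s d : tay u M s d -> (forall eta, nc eta <= s -> u eta = v eta) ->
  tay v M s d.
Proof. by move=> [s0 h] e; split=> // K eta he; rewrite -e //; exact: h. Qed.

Lemma tay_add u v M N s d e : tay u M s d -> tay v N s e ->
  tay (fun x => u x + v x) (M + N) s (fun k => d k + e k).
Proof.
move=> [s0 h] [_ h']; split=> // K eta he.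
rewrite (eq_bigr (fun k : 'I_K => d k * eta ^+ k + e k * eta ^+ k)); last first.
  by move=> k _; rewrite mulrDl.
rewrite big_split /= opprD addrACA mulrDl.
by apply: (le_trans (ncD _ _)); apply: lerD; [exact: h|exact: h'].
Qed.

Lemma tay_scale u M s d (c : C) : tay u M s d ->
  tay (fun x => c * u x) (nc c * M) s (fun k => c * d k).
Proof.
move=> [s0 h]; split=> // K eta he.
rewrite (eq_bigr (fun k : 'I_K => c * (d k * eta ^+ k))); last first.
  by move=> k _; rewrite mulrA.
by rewrite -mulr_sumr -mulrBr ncM -mulrA ler_wpM2l ?nc_ge0 // h.
Qed.

Lemma tay_sub u v M N s d e : tay u M s d -> tay v N s e ->
  tay (fun x => u x - v x) (M + N) s (fun k => d k - e k).
Proof.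
move=> h h'; have h'' := tay_add h (tay_scale (-1) h').
rewrite ncN nc1 mul1r in h''; case: h'' => s0 h''; split=> // K eta he.
have := h'' K eta he; rewrite mulN1r.
by under eq_bigr do rewrite mulN1r.
Qed.

Lemma tay0 s : 0 < s -> tay (fun=> 0) 0 s (fun=> 0).
Proof.
move=> s0; split=> // K eta _; rewrite big1 ?subr0 ?nc0 ?mul0r // => i _.
by rewrite mul0r.
Qed.

Lemma tay_sum (I : eqType) (r : seq I) (u : I -> C -> C) (M : I -> R) s
    (d : I -> nat -> C) : 0 < s -> (forall i, i \in r -> tay (u i) (M i) s (d i)) ->
  tay (fun x => \sum_(i <- r) u i x) (\sum_(i <- r) M i) s
      (fun k => \sum_(i <- r) d i k).
Proof.
move=> s0; elim: r => [|i r IH] h.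
  rewrite big_nil (_ : (fun x => _) = fun=> 0); last first.
    by apply/funext => x; rewrite big_nil.
  rewrite (_ : (fun k => _) = fun=> 0); last by apply/funext => x; rewrite big_nil.
  exact: tay0.
have hi := h i (mem_head _ _).
have {}IH := IH (fun j hj => h j (mem_behead (hj : j \in behead (i :: r)))).
have := tay_add hi IH; rewrite big_cons.
rewrite (_ : (fun x => _) = (fun x => \sum_(j <- i :: r) u j x)); last first.
  by apply/funext => x; rewrite big_cons.
by rewrite (_ : (fun k => _) = (fun k => \sum_(j <- i :: r) d j k)) //;
  apply/funext => x; rewrite big_cons.
Qed.

(** The remainder of order [K] of the product splits into [K + 1] products of
    remainders and values; halving the radius gains the factor [2 ^ K], which
    absorbs their number. *)
Lemma tay_mul u v M N s d e : tay u M s d -> tay v N s e ->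
  exists g, tay (fun x => u x * v x) (2 * M * N) (s / 2) g.
Proof.
move=> hu hv; have M0 := tay_M_ge0 hu; have N0 := tay_M_ge0 hv.
have s0 := tay_s_gt0 hu.
exists (fun k => \sum_(i < k.+1) d i * e (k - i)%N).
split; first by rewrite divr_gt0.
move=> K eta he.
have hes : nc eta <= s by apply: (le_trans he); lra.
set q := nc eta / s.
have q0 : 0 <= q by rewrite divr_ge0 ?nc_ge0 ?ltW.
have -> : nc eta / (s / 2) = 2 * q by rewrite /q; field; rewrite gt_eqF.
have split_sum : \sum_(k < K) (\sum_(i < k.+1) d i * e (k - i)%N) * eta ^+ k =
    \sum_(i < K) (d i * eta ^+ i) * (\sum_(j < K - i) e j * eta ^+ j).
  elim: {he} K => [|K IH]; first by rewrite !big_ord0.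
  rewrite [LHS]big_ord_recr IH [RHS]big_ord_recr /= subSn // subnn big_ord1.
  rewrite [\sum_(i < K.+1) d i * _]big_ord_recr /= subnn mulrDl.
  rewrite addrA; congr (_ + _); last by rewrite !expr0; ring.
  rewrite mulr_suml -big_split /=; apply: eq_bigr => i _.
  rewrite subSn ?(ltnW (ltn_ord i)) // big_ord_recr /= mulrDr; congr (_ + _).
  have -> : eta ^+ K = eta ^+ i * eta ^+ (K - i).
    by rewrite -exprD subnKC // ltnW.
  ring.
have -> : u eta * v eta -
    \sum_(k < K) (\sum_(i < k.+1) d i * e (k - i)%N) * eta ^+ k =
  (u eta - \sum_(i < K) d i * eta ^+ i) * v eta +
  \sum_(i < K) (d i * eta ^+ i) * (v eta - \sum_(j < K - i) e j * eta ^+ j).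
  rewrite split_sum (eq_bigr _ (fun (i : 'I_K) _ => mulrBr _ _ _)) sumrB -mulr_suml.
  by ring.
apply: (le_trans (ncD _ _)).
have h1 : nc ((u eta - \sum_(i < K) d i * eta ^+ i) * v eta) <= M * N * q ^+ K.
  rewrite ncM mulrAC; apply: ler_pM; rewrite ?nc_ge0 //.
    by case: hu => _; exact.
  exact: (tay_bound hv).
have h2 : nc (\sum_(i < K) (d i * eta ^+ i) * (v eta - \sum_(j < K - i) e j * eta ^+ j))
    <= \sum_(i < K) 2 * M * N * q ^+ K.
  apply: (le_trans (nc_sum _ _ _)); apply: ler_sum => i _.
  rewrite ncM.
  have -> : 2 * M * N * q ^+ K = (2 * M * q ^+ i) * (N * q ^+ (K - i)).
    have -> : q ^+ K = q ^+ i * q ^+ (K - i) by rewrite -exprD subnKC // ltnW.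
    ring.
  apply: ler_pM; rewrite ?nc_ge0 //; last by case: hv => _; exact.
  rewrite ncM ncX /q expr_div_n mulrA ler_pdivlMr ?exprn_gt0 //.
  rewrite mulrAC ler_wpM2r ?exprn_ge0 ?nc_ge0 //; exact: (tay_coef hu).
apply: (le_trans (lerD h1 h2)).
rewrite sumr_const card_ord -[X in _ + X]mulr_natl [(2 * q) ^+ K]exprMn.
have -> : M * N * q ^+ K + K%:R * (2 * M * N * q ^+ K) =
  (1 + 2 * K%:R) * (M * N * q ^+ K) by ring.
have -> : 2 * M * N * (2 ^+ K * q ^+ K) = (2 * 2 ^+ K) * (M * N * q ^+ K) by ring.
apply: ler_wpM2r; first by rewrite !mulr_ge0 // exprn_ge0.
have : (1 + 2 * K%:R : R) = (1 + 2 * K)%:R by rewrite natrD natrM.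
rewrite -exprS -natrX => ->; rewrite ler_nat.
elim: {he split_sum h1 h2} K => [//|K IH].
by rewrite expnS mulnS; move: IH; rewrite expnS; have := expn_gt0 2 K; lia.
Qed.

(** By induction: the lowest surviving term dominates the rest of the expansion,
    so an [O(eta ^ m)] estimate along a single sequence tending to 0 kills it when
    its order is below [m]. *)
Lemma tay_order u M s d (A : R) m : tay u M s d ->
  (forall delta : R, 0 < delta -> exists eta, [/\ eta != 0, nc eta < delta &
     nc (u eta) <= A * nc eta ^+ m]) ->
  forall k, (k < m)%N -> d k = 0.
Proof.
move=> h small k; elim/ltn_ind: k => k IH km.
have [s0 h'] := h; have M0 := tay_M_ge0 h.
apply: nc_small0 => e e0.
pose B := `|A| + M / s ^+ k.+1.
have B0 : 0 <= B by rewrite addr_ge0 // divr_ge0 // exprn_ge0 // ltW.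
pose delta := Num.min (Num.min 1 s) (e / (B + 1)).
have delta0 : 0 < delta.
  by rewrite !lt_min ltr01 s0 /= divr_gt0 // ltr_wpDl.
have [eta [eta0 etad uA]] := small delta delta0.
move: etad; rewrite !lt_min => /andP[/andP[eta1 etas] etae].
have ne0 : 0 < nc eta by rewrite nc_gt0.
have := h' k.+1 eta (ltW etas); rewrite big_ord_recr /= big1; last first.
  by move=> i _; rewrite IH ?mul0r //; exact: ltn_trans km.
rewrite add0r => hk.
have hd : nc (d k) * nc eta ^+ k <= B * nc eta * nc eta ^+ k.
  rewrite -ncX -ncM.
  have -> : d k * eta ^+ k = u eta - (u eta - d k * eta ^+ k) by ring.
  apply: (le_trans (ncB _ _)); rewrite /B 2!mulrDl; apply: lerD.
    apply: (le_trans uA); rewrite ncX -mulrA -exprS.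
    apply: (@le_trans _ _ (`|A| * nc eta ^+ m)).
      by rewrite ler_wpM2r ?ler_norm // exprn_ge0 // nc_ge0.
    apply: ler_wpM2l => //; apply: ler_wiXn2l => //; rewrite ?nc_ge0 //; exact: ltW.
  by apply: (le_trans hk); rewrite expr_div_n exprS ncX; lra.
have := hd; rewrite (ler_pM2r (exprn_gt0 k ne0)) => le.
apply: (le_trans le); move: etae; rewrite ltr_pdivlMr ?ltr_wpDl // => etae.
by have := nc_ge0 eta; lra.
Qed.

Lemma tay_all0 u M s d : tay u M s d -> (forall k, d k = 0) ->
  forall eta, nc eta < s -> u eta = 0.
Proof.
move=> [s0 h] d0 eta he; apply: nc_small0 => e e0.
have q1 : nc eta / s < 1 by rewrite ltr_pdivrMr ?mul1r.
have [K hK] := geom_small M (divr_ge0 (nc_ge0 eta) (ltW s0)) q1 e0.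
have := h K eta (ltW he); rewrite big1 ?subr0 => [le|i _]; last by rewrite d0 mul0r.
exact: (le_trans le).
Qed.

(** The identity theorem in one variable. *)
Lemma tay_zero u M s d : tay u M s d ->
  (forall delta : R, 0 < delta -> exists eta, [/\ eta != 0, nc eta < delta & u eta = 0]) ->
  forall k, d k = 0.
Proof.
move=> h small k; apply: (@tay_order _ _ _ _ 0 k.+1 h _ k (ltnSn k)).
move=> delta d0; have [eta [h1 h2 h3]] := small delta d0.
by exists eta; split=> //; rewrite h3 nc0 mul0r.
Qed.

Lemma tay_uniq u M s d N t e : tay u M s d -> tay u N t e -> forall k, d k = e k.
Proof.
move=> h1 h2 k; have s0 := tay_s_gt0 h1; have t0 := tay_s_gt0 h2.
have m0 : 0 < Num.min s t by rewrite lt_min s0 t0.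
have h1' : tay u M (Num.min s t) d by apply: (tay_shrink h1) => //; rewrite ge_min lexx.
have h2' : tay u N (Num.min s t) e.
  by apply: (tay_shrink h2) => //; rewrite ge_min lexx orbT.
have h := tay_sub h1' h2'.
apply/eqP; rewrite -subr_eq0; apply/eqP.
apply: (tay_zero h) => delta d0; exists (delta / 2)%:C; split.
- by rewrite rc_eq0 gt_eqF // divr_gt0.
- by rewrite nc_real ger0_norm; lra.
- by rewrite subrr.
Qed.

Lemma tay_cont u M s d : tay u M s d -> forall e : R, 0 < e ->
  exists2 delta : R, 0 < delta & forall eta, nc eta < delta -> nc (u eta - u 0) < e.
Proof.
move=> h e e0; have s0 := tay_s_gt0 h; have M0 := tay_M_ge0 h.
exists (Num.min s (e * s / (M + 1))).
  by rewrite lt_min s0 divr_gt0 ?mulr_gt0 // ltr_wpDl.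
move=> eta; rewrite lt_min => /andP[h1 h2].
have [_ /(_ 1%N eta (ltW h1))] := h.
rewrite big_ord1 expr0 mulr1 expr1 -(tay_at0 h) => le; apply: (le_lt_trans le).
rewrite mulrA ltr_pdivrMr //; move: h2; rewrite ltr_pdivlMr ?ltr_wpDl // => h2.
by apply: le_lt_trans h2; rewrite mulrC ler_wpM2l ?nc_ge0 // lerDl.
Qed.

(** The quotient of [u] by [eta ^ m], with the singularity at 0 removed. *)
Definition shift_fun u d m (eta : C) : C :=
  if eta == 0 then d m else u eta / eta ^+ m.

Lemma tay_shift u M s d m : tay u M s d -> (forall k, (k < m)%N -> d k = 0) ->
  tay (shift_fun u d m) (2 * M / s ^+ m) s (fun k => d (k + m)%N).
Proof.
move=> [s0 h] d0; have M0 : 0 <= M by exact: (tay_M_ge0 (conj s0 h)).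
split=> // K eta he; rewrite /shift_fun; have [->|eta0] := eqVneq eta 0.
  case: K => [|K].
    rewrite big_ord0 subr0 expr0 mulr1 ler_pdivlMr ?exprn_gt0 //.
    exact: (tay_coef (conj s0 h)).
  rewrite big_ord_recl expr0 mulr1 add0n big1; last first.
    by move=> i _; rewrite expr0n mulr0.
  by rewrite addr0 subrr nc0 mul0r expr0n mulr0.
have ne0 : 0 < nc eta by rewrite nc_gt0.
have em : eta ^+ m != 0 by rewrite expf_neq0.
have -> : u eta / eta ^+ m - \sum_(k < K) d (k + m)%N * eta ^+ k =
  (u eta - \sum_(k < m + K) d k * eta ^+ k) / eta ^+ m.
  have z : \sum_(i < m) d i * eta ^+ i = 0.
    by rewrite big1 // => i _; rewrite d0 ?mul0r.
  rewrite big_split_ord /= z add0r mulrBl; congr (_ - _); rewrite mulr_suml; apply: eq_bigr => i _.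
  by rewrite addnC exprD; field.
rewrite ncM ncV ncX ler_pdivrMr ?exprn_gt0 //.
apply: (le_trans (h _ _ he)); rewrite exprD expr_div_n.
set q := (nc eta / s) ^+ K; have q0 : 0 <= q.
  by rewrite exprn_ge0 // divr_ge0 ?nc_ge0 // ltW.
have -> : 2 * M / s ^+ m * q * nc eta ^+ m = 2 * (M * (nc eta ^+ m / s ^+ m * q)).
  by ring.
have : 0 <= M * (nc eta ^+ m / s ^+ m * q).
  by rewrite !mulr_ge0 // ?invr_ge0 exprn_ge0 ?nc_ge0 // ltW.
lra.
Qed.

End Taylor.

(** * The local maximum principle *)

Section LocalMax.
Context {R : realType}.
Local Notation C := R[i].
Implicit Types (n D : C -> C) (d e : nat -> C).

Lemma unit_root (z : C) m : (0 < m)%N -> nc z = 1 ->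
  exists2 w : C, nc w = 1 & w ^+ m = z.
Proof.
move=> m0 z1; exists (m.-root z); last by rewrite rootCK.
have /eqP := z1; rewrite -{1}(rootCK m0 z) ncX.
by rewrite pexpr_eq1 ?nc_ge0 // => /eqP.
Qed.

(** The maximum principle for the quotient [n / D].  Otherwise let [g m] be the
    first nonzero coefficient of [n - r D], so [0 < m]; along an [m]-th root
    direction [w] for which [g m * w ^+ m] is a positive multiple of [D 0], the
    modulus of [n] exceeds that of [r D] by a term of order [m]. *)
Lemma tay_max n D M N s d e (r delta : R) :
  tay n M s d -> tay D N s e -> e 0%N != 0 -> 0 <= r -> d 0%N = r%:C * e 0%N ->
  0 < delta -> (forall eta, nc eta < delta -> nc (n eta) <= r * nc (D eta)) ->
  exists2 delta' : R, 0 < delta' &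
    forall eta, nc eta < delta' -> n eta = r%:C * D eta.
Proof.
move=> hn hD e0 r0 d0 del0 hle; have s0 := tay_s_gt0 hn.
pose g k := d k - r%:C * e k; pose P := M + nc r%:C * N.
have hE : tay (fun x => n x - r%:C * D x) P s g.
  exact: tay_sub hn (tay_scale r%:C hD).
have [allz|] := pselect (forall k, g k = 0).
  exists s => // eta he; apply/eqP; rewrite -subr_eq0; apply/eqP.
  exact: (tay_all0 hE allz he).
move=> /existsNP [k0 /eqP gk0]; exfalso.
have exg : exists k, g k != 0 by exists k0.
case: (ex_minnP exg) => m gm mmin.
have m0 : (0 < m)%N.
  case: m gm {mmin} => // /negP[]; apply/eqP; by rewrite /g d0 subrr.
have gz k : (k < m)%N -> g k = 0.
  by move=> km; apply/eqP/negPn/negP => /mmin; rewrite leqNgt km.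
have ng : 0 < nc (g m) by rewrite nc_gt0.
have ne : 0 < nc (e 0%N) by rewrite nc_gt0.
pose kap := nc (g m) / nc (e 0%N).
have kap0 : 0 < kap by rewrite divr_gt0.
(* this direction aligns the leading term of [n - r D] with [D 0] *)
have [w w1 wm] : exists2 w : C, nc w = 1 & w ^+ m = kap%:C * e 0%N / g m.
  apply: unit_root => //.
  rewrite !ncM ncV nc_real ger0_norm ?ltW // /kap; field.
  by rewrite !gt_eqF.
clearbody kap; have s_ge0 := ltW s0; have k_ge0 := ltW kap0.
have N0 := tay_M_ge0 hD; have P0 := tay_M_ge0 hE.
pose Q := kap * N / s + P / s ^+ m.+1.
have Q0 : 0 <= Q.
  apply: addr_ge0; apply: divr_ge0; rewrite ?mulr_ge0 ?exprn_ge0 //.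
pose t := Num.min (Num.min (delta / 2) s)
  (Num.min (s * nc (e 0%N) / (4 * (N + 1))) (kap * nc (e 0%N) / (4 * (Q + 1)))).
have t0 : 0 < t.
  have N4 : 0 < 4 * (N + 1) by lra.
  have Q4 : 0 < 4 * (Q + 1) by lra.
  by rewrite !lt_min s0 !divr_gt0 // mulr_gt0.
have [td ts tN tQ] : [/\ t <= delta / 2, t <= s,
    t <= s * nc (e 0%N) / (4 * (N + 1)) & t <= kap * nc (e 0%N) / (4 * (Q + 1))].
  by split; rewrite !ge_min lexx ?orbT.
pose eta := t%:C * w.
have neta : nc eta = t by rewrite ncM w1 mulr1 nc_real ger0_norm // ltW.
have he : nc eta <= s by rewrite neta.
have hle' : nc (n eta) <= r * nc (D eta) by apply: hle; rewrite neta; lra.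
have hDe : nc (D eta - e 0%N) <= N * t / s.
  have [_ /(_ 1%N eta he)] := hD.
  by rewrite big_ord1 expr0 mulr1 expr1 neta mulrA.
have hEe : nc (n eta - r%:C * D eta - g m * eta ^+ m) <= P * t ^+ m.+1 / s ^+ m.+1.
  have [_ /(_ m.+1 eta he)] := hE.
  rewrite big_ord_recr /= big1 ?add0r ?neta ?expr_div_n ?mulrA // => i _.
  by rewrite gz ?mul0r.
have gme : g m * eta ^+ m = (kap * t ^+ m)%:C * e 0%N.
  rewrite exprMn wm rcM rcX; field; exact: gm.
have nE : n eta = (r + kap * t ^+ m)%:C * D eta
    + ((n eta - r%:C * D eta - g m * eta ^+ m)
       - (kap * t ^+ m)%:C * (D eta - e 0%N)).
  rewrite gme rcD; ring.
have tm0 : 0 < t ^+ m by rewrite exprn_gt0.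
have low : (r + kap * t ^+ m) * nc (D eta)
    - (P * t ^+ m.+1 / s ^+ m.+1 + kap * t ^+ m * (N * t / s)) <= nc (n eta).
  have Y := nc_lower ((r + kap * t ^+ m)%:C * D eta)
    ((n eta - r%:C * D eta - g m * eta ^+ m) - (kap * t ^+ m)%:C * (D eta - e 0%N)).
  rewrite -nE ncM nc_real ger0_norm in Y; last first.
    by rewrite addr_ge0 // mulr_ge0 // ltW.
  apply: le_trans Y; apply: lerB => //.
  apply: (le_trans (ncB _ _)); apply: lerD => //.
  rewrite ncM nc_real ger0_norm; last by rewrite mulr_ge0 // ltW.
  by rewrite ler_pM2l ?mulr_gt0.
have dn : nc (e 0%N) / 2 <= nc (D eta).
  have : nc (e 0%N) <= nc (D eta) + nc (D eta - e 0%N).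
    have -> : nc (e 0%N) = nc (D eta - (D eta - e 0%N)) by congr nc; ring.
    exact: ncB.
  have : N * t / s <= nc (e 0%N) / 4.
    rewrite ler_pdivrMr //.
    have : N * t <= (N + 1) * (s * nc (e 0%N) / (4 * (N + 1))).
      by apply: ler_pM => //; [exact: ltW|lra].
    have -> : (N + 1) * (s * nc (e 0%N) / (4 * (N + 1))) = nc (e 0%N) / 4 * s.
      by field; rewrite gt_eqF //; lra.
    by [].
  lra.
have key : kap * nc (D eta) <= t * Q.
  rewrite -(ler_pM2l tm0).
  have -> : t ^+ m * (t * Q) = P * t ^+ m.+1 / s ^+ m.+1 + kap * t ^+ m * (N * t / s).
    by rewrite /Q [t ^+ m.+1]exprS; ring.
  have -> : t ^+ m * (kap * nc (D eta)) =
    (r + kap * t ^+ m) * nc (D eta) - r * nc (D eta) by ring.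
  lra.
have k2 : kap * (nc (e 0%N) / 2) <= kap * nc (D eta) by rewrite ler_pM2l.
have : t * Q <= kap * nc (e 0%N) / 4.
  apply: (@le_trans _ _ (kap * nc (e 0%N) / (4 * (Q + 1)) * (Q + 1))).
    by apply: ler_pM => //; [exact: ltW|lra].
  by rewrite le_eqVlt; apply/orP; left; apply/eqP; field; rewrite gt_eqF //; lra.
have : 0 < kap * nc (e 0%N) by rewrite mulr_gt0.
lra.
Qed.

(** Vector form, by pairing [u] with [a := u 0 / D 0]: the scalar case determines
    this inner product near 0, and equality in Cauchy-Schwarz makes [u] equal to
    [D a].  A denominator [D] is allowed because only [lam] and [lam * phi] are
    elements of the space, not the symbol [phi] itself. *)
Lemma tay_max_vec k (u : 'I_k -> C -> C) D (M : 'I_k -> R) N s c e (r delta : R) :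
  (forall j, tay (u j) (M j) s (c j)) -> tay D N s e -> D 0 != 0 -> 0 <= r ->
  0 < delta ->
  (forall eta, nc eta < delta ->
    \sum_j nc (u j eta) ^+ 2 <= r ^+ 2 * nc (D eta) ^+ 2) ->
  \sum_j nc (u j 0) ^+ 2 = r ^+ 2 * nc (D 0) ^+ 2 ->
  exists2 delta' : R, 0 < delta' &
    forall eta, nc eta < delta' -> forall j, u j eta * D 0 = u j 0 * D eta.
Proof.
move=> hu hD D0 r0 del0 hle h0.
have s0 := tay_s_gt0 hD.
pose z eta : 'rV[C^o]_k := \row_j u j eta.
have zE eta j : z eta 0 j = u j eta by rewrite mxE.
have enz eta : en (z eta) ^+ 2 = \sum_j nc (u j eta) ^+ 2.
  by rewrite en_sqr; apply: eq_bigr => j _; rewrite zE.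
pose a : 'rV[C^o]_k := (D 0)^-1 *: z 0.
have ena : en a = r.
  apply/eqP; rewrite -(eqrXn2 (_ : (0 < 2)%N)) ?en_ge0 //.
  rewrite enZ exprMn enz h0 ncV; apply/eqP; field.
  by rewrite nc_eq0.
have za : z 0 = D 0 *: a by rewrite scalerA divff // scale1r.
clearbody z a.
pose n eta := \sum_(j <- enum 'I_k) (a 0 j)^*%C * u j eta.
have hn : tay n _ s _ := tay_sum s0
  (fun j (_ : j \in enum 'I_k) => tay_scale (a 0 j)^*%C (hu j)).
have nE eta : n eta = cdot (z eta) a.
  rewrite cdotE /n big_enum /=; apply: eq_bigr => j _.
  by rewrite [RHS]mulrC; congr (_ * _); rewrite zE.
have nn0 : n 0 = (r ^+ 2)%:C * D 0.
  by rewrite nE za cdotZl cdotzz ena mulrC.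
have [delta' d'0 h'] : exists2 delta' : R, 0 < delta' &
    forall eta, nc eta < delta' -> n eta = (r ^+ 2)%:C * D eta.
  apply: (tay_max hn hD) del0 _; rewrite ?sqr_ge0 //.
  - by rewrite -(tay_at0 hD).
  - by rewrite -(tay_at0 hD) -nn0; symmetry; exact: (tay_at0 hn).
  - move=> eta he; rewrite nE; apply: (le_trans (en_CS _ _)); rewrite ena.
    rewrite expr2 -mulrA mulrC; apply: ler_wpM2l => //.
    rewrite -(ler_pXn2r (_ : (0 < 2)%N)) ?nnegrE ?en_ge0 ?mulr_ge0 ?nc_ge0 //.
    by rewrite enz exprMn hle.
exists (Num.min delta delta'); first by rewrite lt_min del0.
move=> eta; rewrite lt_min => /andP[e1 e2] j.
suff : en (z eta - D eta *: a) = 0.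
  move=> /en_eq0 /eqP; rewrite subr_eq0 => /eqP /rowP /(_ j).
  by rewrite -!zE za !mxE => ->; ring.
apply/eqP; rewrite -sqrf_eq0 eq_le sqr_ge0 andbT.
have E1 : en (D eta *: a) = nc (D eta) * r by rewrite -ena; exact: enZ.
have E2 : cdot (z eta) (D eta *: a) = (D eta)^*%C * ((r ^+ 2)%:C * D eta).
  by rewrite -(h' _ e2) nE; exact: cdotZr.
rewrite en_sqrB E1 E2 (enz eta).
have -> : complex.Re ((D eta)^*%C * ((r ^+ 2)%:C * D eta)) = r ^+ 2 * nc (D eta) ^+ 2.
  by rewrite mulrCA (mulrC _ (D eta)) -nc_sqr -rcM.
have := hle eta e1; rewrite exprMn; set T := r ^+ 2 * _.
have -> : nc (D eta) ^+ 2 * r ^+ 2 = T by rewrite mulrC.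
by rewrite mulr_natl mulr2n opprD addrA addrK subr_le0.
Qed.

End LocalMax.

(** * Density in Hilbert function spaces *)

(** Locked for the same reason as [en]. *)
HB.lock Definition hn (R : realType) (X : Type) (H : hilbert_function_space R X)
  (f : H) : R := hfs_norm f.

Section HilbertFunctions.
Context {R : realType} {X : Type} (H : hilbert_function_space R X).
Local Notation C := R[i].
Local Notation dot := (hfs_dot H).
Local Notation hn := (@hn R X H).
Implicit Types f g h : H.

Lemma hnE f : hn f = fnorm dot f. Proof. by rewrite hn.unlock. Qed.
Lemma hn_ge0 f : 0 <= hn f. Proof. by rewrite hn.unlock; exact: fnorm_ge0. Qed.
Lemma hn0 : hn 0 = 0. Proof. by rewrite hn.unlock; exact: fnorm0. Qed.
Lemma hn_eq0 f : hn f = 0 -> f = 0. Proof. by rewrite hn.unlock; exact: fnorm_eq0. Qed.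
Lemma hnD f g : hn (f + g) <= hn f + hn g. Proof. by rewrite hn.unlock; exact: fnormD. Qed.
Lemma hnB f g : hn (f - g) <= hn f + hn g. Proof. by rewrite hn.unlock; exact: fnormB. Qed.
Lemma hnZ (c : C) f : hn (c *: f) = nc c * hn f. Proof. by rewrite hn.unlock; exact: fnormZ. Qed.
Lemma hn_tri f g h : hn (f - h) <= hn (f - g) + hn (g - h).
Proof. by rewrite hn.unlock; exact: fnorm_tri. Qed.
Lemma hn_dist f g : hn (f - g) = hn (g - f). Proof. by rewrite hn.unlock; exact: fnorm_dist. Qed.
Lemma hn_CS f g : nc (dot f g) <= hn f * hn g. Proof. by rewrite hn.unlock; exact: cauchy_schwarz. Qed.
Lemma hn_dot f : dot f f = (hn f ^+ 2)%:C. Proof. by rewrite hn.unlock; exact: formE. Qed.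

Lemma heD f g x : hfs_eval (f + g) x = hfs_eval f x + hfs_eval g x.
Proof. by rewrite -{1}(scale1r f) hfs_eval_linear mul1r. Qed.
Lemma he0 x : hfs_eval (0 : H) x = 0.
Proof. by apply: (addrI (hfs_eval (0 : H) x)); rewrite -heD !addr0. Qed.
Lemma heZ (c : C) f x : hfs_eval (c *: f) x = c * hfs_eval f x.
Proof. by rewrite -[c *: f]addr0 hfs_eval_linear he0 addr0. Qed.
Lemma heB f g x : hfs_eval (f - g) x = hfs_eval f x - hfs_eval g x.
Proof. by rewrite heD -scaleN1r heZ mulN1r. Qed.
Lemma he_bounded x : exists2 M : R, 0 <= M &
  forall f, nc (hfs_eval f x) <= M * hn f.
Proof.
have [M hM] := hfs_eval_bounded H x; exists `|M| => // f.
have := hM f; rewrite ncE lecR -/(hfs_norm f) => h.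
rewrite hn.unlock; apply: (le_trans h).
by rewrite ler_wpM2r ?sqrtr_ge0 // ler_norm.
Qed.

Lemma hn_complete (u : nat -> H) :
  (forall e : R, 0 < e -> exists N : nat, forall m n : nat,
     (N <= m)%N -> (N <= n)%N -> hn (u m - u n) < e) ->
  exists l : H, forall e : R, 0 < e -> exists N : nat,
    forall n : nat, (N <= n)%N -> hn (u n - l) < e.
Proof. rewrite hn.unlock; exact: hfs_complete. Qed.

(** Test the inequality with the orthogonal projection of [f] on the line of [g]. *)
Lemma closest_orth f g : (forall c : C, hn f <= hn (f - c *: g)) -> dot f g = 0.
Proof.
move=> h; have [->|g0] := eqVneq g 0; first by rewrite linear0r.
pose c := dot f g / dot g g.
have gg : dot g g != 0 by rewrite gt_eqF // neq0_dnorm_gt0.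
have o : dot (f - c *: g) (c *: g) = 0.
  by rewrite formZr formBl formZl /c divfK // subrr mulr0.
have := fnormD_orth o; rewrite subrK => e.
have hc := h c.
have {}hc : hn f ^+ 2 <= hn (f - c *: g) ^+ 2.
  by apply: lerXn2r; rewrite ?nnegrE ?hn_ge0.
have : hn (c *: g) ^+ 2 = 0.
  by apply/eqP; rewrite eq_le sqr_ge0 andbT; move: hc; rewrite !hnE e gerDl.
move=> /eqP; rewrite sqrf_eq0 => /eqP /hn_eq0 /eqP; rewrite scaler_eq0 (negPf g0) orbF.
by rewrite mulf_eq0 invr_eq0 (negPf gg) orbF => /eqP.
Qed.

(** A sequence of [D] minimizing the distance to [f] is Cauchy by the
    parallelogram identity, and [f - l] is orthogonal to [D] at its limit [l]. *)
Lemma hfs_dense (D : H -> Prop) : D 0 ->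
  (forall (c : C) f g, D f -> D g -> D (c *: f + g)) ->
  (forall f, (forall g, D g -> dot f g = 0) -> f = 0) ->
  forall f (e : R), 0 < e -> exists2 g, D g & hn (f - g) < e.
Proof.
move=> D0 Dlin Dorth f e e0.
pose A : set R := ((fun g : H => hn (f - g)) @` D)%classic.
have Ane : (A !=set0)%classic by exists (hn (f - 0)); exists 0.
have Alb : lbound A 0 by move=> _ [g _ <-]; exact: hn_ge0.
have Ahi : has_inf A by split=> //; exists 0.
pose rho := inf A.
have rho0 : 0 <= rho by apply: lb_le_inf.
have rholb g : D g -> rho <= hn (f - g).
  by move=> Dg; apply: ge_inf; [exists 0|exists g].
have /choice [u hu] : forall n : nat, exists g, D g /\ hn (f - g) < rho + n.+1%:R^-1.
  move=> n; have n0 : 0 < n.+1%:R^-1 :> R by rewrite invr_gt0.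
  by have [_ [g Dg <-] lt] := inf_adherent n0 Ahi; exists g.
have Dmid m n : D (2^-1 *: (u m + u n)).
  rewrite scalerDr; apply: (Dlin _ _ _ (hu m).1).
  by rewrite -[_ *: _]addr0; apply: Dlin D0; exact: (hu n).1.
have gap m n (t : R) : m.+1%:R^-1 <= t -> n.+1%:R^-1 <= t ->
    hn (u m - u n) ^+ 2 <= 8 * rho * t + 4 * t ^+ 2.
  move=> hm hn'; have t0 : 0 <= t by apply: le_trans hm; rewrite invr_ge0.
  have := parallelogram dot (f - u m) (f - u n).
  have -> : f - u m - (f - u n) = u n - u m.
    by rewrite opprB addrC addrA addrNK.
  have -> : f - u m + (f - u n) = 2 *: (f - 2^-1 *: (u m + u n)).
    rewrite scalerBr scalerA divff ?pnatr_eq0 // scale1r.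
    by rewrite scaler_nat mulr2n opprD addrACA.
  rewrite fnormZ -!hnE nc_nat.
  rewrite exprMn (hn_dist (u n)).
  have rm : rho ^+ 2 <= hn (f - 2^-1 *: (u m + u n)) ^+ 2.
    by apply: lerXn2r; rewrite ?nnegrE ?hn_ge0 //; exact: rholb.
  have bnd k : k.+1%:R^-1 <= t -> hn (f - u k) ^+ 2 <= (rho + t) ^+ 2.
    move=> hk; apply: lerXn2r; rewrite ?nnegrE ?hn_ge0 ?addr_ge0 //.
    by apply: (le_trans (ltW (hu k).2)); rewrite lerD2l.
  have := bnd m hm; have := bnd n hn'; rewrite sqrrD.
  move: rm; clear; move: (hn _ ^+ 2) (hn _ ^+ 2) (hn _ ^+ 2) (hn _ ^+ 2) => a b c' d.
  by move=> *; lra.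
have inv_small (t : R) : 0 < t -> exists N : nat, forall n, (N <= n)%N -> n.+1%:R^-1 <= t.
  move=> t0; exists (Num.truncn t^-1) => n hn'.
  rewrite invf_ple ?posrE //; apply: (le_trans (ltW (truncnS_gt _))).
  by rewrite ler_nat ltnS.
have cau : forall e : R, 0 < e -> exists N : nat, forall m n : nat,
    (N <= m)%N -> (N <= n)%N -> hn (u m - u n) < e.
  move=> e' e'0.
  pose t := Num.min 1 (e' ^+ 2 / (8 * rho + 5)).
  have p0 : 0 < 8 * rho + 5 by lra.
  have t0 : 0 < t by rewrite lt_min ltr01 divr_gt0 ?exprn_gt0.
  have [N hN] := inv_small t t0; exists N => m n hm hn'.
  have := gap m n t (hN m hm) (hN n hn') => g1.
  rewrite -(ltr_pXn2r (_ : (0 < 2)%N)) ?nnegrE ?hn_ge0 ?ltW //.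
  apply: (le_lt_trans g1).
  have t1 : t <= 1 by rewrite ge_min lexx.
  have te : t * (8 * rho + 5) <= e' ^+ 2.
    by rewrite -ler_pdivlMr // ge_min lexx orbT.
  apply: lt_le_trans te; rewrite mulrDr.
  have : t ^+ 2 <= t by rewrite expr2 ger_pMr.
  move: t0; clear; move: (t ^+ 2) => t2 *; nra.
have [l hl] := hn_complete cau.
have fl : hn (f - l) <= rho.
  apply/ler_addgt0Pl => t t0.
  have t20 : 0 < t / 2 by rewrite divr_gt0.
  have [N1 h1] := hl (t / 2) t20.
  have [N2 h2] := inv_small (t / 2) t20.
  pose n := maxn N1 N2.
  have := h1 n (leq_maxl _ _); have := h2 n (leq_maxr _ _).
  have := (hu n).2; have := hn_tri f (u n) l.
  move: (hn (f - l)) (hn (f - u n)) (hn (u n - l)) (n.+1%:R^-1) => a b c' d; clear.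
  lra.
have far (c : C) g : D g -> rho <= hn (f - l - c *: g).
  move=> Dg; apply/ler_addgt0Pl => t t0.
  have [N h1] := hl t t0; have := h1 N (leqnn _) => h2.
  have h3 : rho <= hn (f - (c *: g + u N)) by apply/rholb/Dlin; [|exact: (hu N).1].
  apply: (le_trans h3).
  have -> : f - (c *: g + u N) = (l - u N) + (f - l - c *: g).
    rewrite [f - l]addrC [RHS]addrA [l - u N]addrC addrACA.
    by rewrite addrA subrK opprD addrA [- u N + f]addrC addrAC.
  apply: (le_trans (hnD _ _)); rewrite lerD2r hn_dist; exact: ltW.
have fl0 : f - l = 0.
  apply: Dorth => g Dg; apply: closest_orth => c.
  exact: le_trans fl (far c g Dg).
have [N h1] := hl e e0; exists (u N); first exact: (hu N).1.
have := h1 N (leqnn _) => h2.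
by rewrite -(subrK l f) fl0 add0r hn_dist.
Qed.

End HilbertFunctions.

(** * The bounded inverse theorem *)

Section UniformBoundedness.
Context {R : realType} {X1 X2 : Type}
  (H1 : hilbert_function_space R X1) (H2 : hilbert_function_space R X2).
Local Notation C := R[i].

(** If [S] were unbounded, one could build points [x n], bounds [B n] and unit
    vectors [k n] such that the [n]-th step moves the point by at most
    [2 ^ - n / B n] and makes [<S x, k n>] at least [n]; the functionals of the
    previous steps being bounded by [B n], later steps change these values by at
    most 2, and the image of the limit would have infinite norm.  The density
    hypothesis is what provides [k n] with a bounded functional. *)
Lemma gliding_hump (S : H1 -> H2) :
  (forall (c : C) f g, S (c *: f + g) = c *: S f + S g) ->
  (forall f (e : R), 0 < e -> exists2 k : H2, hn (f - k) < e &
     exists N : R, forall g, nc (hfs_dot H2 (S g) k) <= N * hn g) ->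
  exists M : R, forall f, hn (S f) <= M * hn f.
Proof.
move=> Slin Sdense; apply: contrapT => /forallNP unb.
have S0 : S 0 = 0.
  by have := Slin (-1) 0 0; rewrite scaler0 add0r scaleN1r addNr.
have SD f g : S (f + g) = S f + S g by rewrite -{1}(scale1r f) Slin scale1r.
have SZ c f : S (c *: f) = c *: S f by rewrite -[c *: f]addr0 Slin S0 addr0.
pose bnd (k : H2) (N : R) := forall g, nc (hfs_dot H2 (S g) k) <= N * hn g.
have step (n : nat) (x : H1) (B : R) : 0 < B -> exists (x' : H1) (B' : R),
   [/\ hn (x' - x) <= 2^-1 ^+ n / B, B <= B' &
    exists2 k, hn k <= 1 & bnd k B' /\ n%:R <= nc (hfs_dot H2 (S x') k)].
  move=> B0; pose eps : R := 2^-1 ^+ n / B.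
  have eps0 : 0 < eps by rewrite divr_gt0 // exprn_gt0.
  pose M := (n%:R + hn (S x) + 3) / eps.
  have /existsNP [f /negP] := unb M; rewrite -ltNge => hf.
  have f0 : 0 < hn f.
    rewrite lt_neqAle hn_ge0 andbT eq_sym; apply/eqP => /hn_eq0 f0.
    by move: hf; rewrite f0 S0 !hn0 mulr0 ltxx.
  pose f1 := (eps / hn f)%:C *: f.
  have nf1 : hn f1 = eps.
    rewrite hnZ nc_real ger0_norm ?divfK ?gt_eqF //.
    by rewrite divr_ge0 // ltW.
  have nSf1 : n%:R + hn (S x) + 3 < hn (S f1).
    rewrite SZ hnZ nc_real ger0_norm; last by rewrite divr_ge0 // ltW.
    have -> : n%:R + hn (S x) + 3 = eps / hn f * (M * hn f).
      by rewrite /M; field; rewrite !gt_eqF.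
    by rewrite ltr_pM2l // divr_gt0.
  have [k0 k0d [N hN]] := Sdense (S f1) 1 ltr01.
  have sx0 := hn_ge0 (S x); have n0 : 0 <= n%:R :> R by [].
  have nk0 : hn (S f1) - 1 < hn k0.
    have := hnD (S f1 - k0) k0; rewrite subrK; move: k0d; clear; lra.
  have k00 : 0 < hn k0 by move: nk0 nSf1 sx0 n0; clear; lra.
  pose k := ((hn k0)^-1)%:C *: k0.
  have ck : nc ((hn k0)^-1)%:C = (hn k0)^-1.
    by rewrite nc_real ger0_norm // invr_ge0 ltW.
  have dk g : nc (hfs_dot H2 g k) = nc (hfs_dot H2 g k0) / hn k0.
    by rewrite formZr ncM nc_conj ck mulrC.
  exists (x + f1), (Num.max B (N / hn k0)); split.
  - by rewrite addrC addKr nf1.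
  - by rewrite le_max lexx.
  exists k; first by rewrite hnZ ck mulVf // gt_eqF.
  split=> [g|].
    rewrite dk; apply: (le_trans (ler_wpM2r _ (hN g))); first by rewrite invr_ge0 ltW.
    by rewrite mulrAC ler_wpM2r ?hn_ge0 // le_max lexx orbT.
  rewrite SD formDl [X in nc X]addrC.
  have c1 : nc (hfs_dot H2 (S x) k) <= hn (S x).
    rewrite dk ler_pdivrMr //; exact: hn_CS.
  have c2 : hn k0 - 1 <= nc (hfs_dot H2 (S f1) k).
    rewrite dk ler_pdivlMr //.
    have -> : S f1 = k0 + (S f1 - k0) by rewrite addrC subrK.
    rewrite formDl hn_dot; apply: le_trans (nc_lower _ _).
    rewrite nc_real ger0_norm ?sqr_ge0 // mulrBl mul1r -expr2 lerB //.
    apply: (le_trans (hn_CS _ _)); rewrite -[leRHS]mul1r.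
    by apply: ler_wpM2r; rewrite ?hn_ge0 // ltW.
  have := nc_lower (hfs_dot H2 (S f1) k) (hfs_dot H2 (S x) k).
  move: c1 c2 nk0 nSf1; clear; lra.
have /choice [F hF] : forall np : nat * (H1 * R), exists q : H1 * R, 0 < np.2.2 ->
   [/\ hn (q.1 - np.2.1) <= 2^-1 ^+ np.1 / np.2.2, np.2.2 <= q.2 &
    exists2 k, hn k <= 1 & bnd k q.2 /\ np.1%:R <= nc (hfs_dot H2 (S q.1) k)].
  move=> [n [x B]] /=; have [B0|_] := ltP 0 B; last by exists (x, B).
  by have [x' [B' h]] := step n x B B0; exists (x', B').
(* the state is the current point with the bound valid for all previous functionals *)
pose st := fix st n : H1 * R := if n is m.+1 then F (m, st m) else (0, 1).
have Bpos n : 1 <= (st n).2.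
  elim: n => [//|n IH] /=.
  by have [//=|_ h _] := hF (n, st n); [exact: lt_le_trans IH|exact: le_trans h].
have Bgt n : 0 < (st n).2 by exact: lt_le_trans (Bpos n).
have st1 n : hn ((st n.+1).1 - (st n).1) <= 2^-1 ^+ n / (st n).2.
  by have [] := hF (n, st n) (Bgt n).
have st2 n : (st n).2 <= (st n.+1).2 by have [] := hF (n, st n) (Bgt n).
have st3 n : exists2 k, hn k <= 1 &
    bnd k (st n.+1).2 /\ n%:R <= nc (hfs_dot H2 (S (st n.+1).1) k).
  by have [] := hF (n, st n) (Bgt n).
clearbody st.
have dist n j : hn ((st (n + j)%N).1 - (st n).1) <=
    2 * (1 - 2^-1 ^+ j) * (2^-1 ^+ n / (st n).2).
  elim: j => [|j IH]; first by rewrite addn0 subrr hn0 expr0 subrr mulr0 mul0r.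
  rewrite addnS.
  apply: (le_trans (hn_tri _ (st (n + j)%N).1 _)).
  apply: (le_trans (lerD (st1 _) IH)).
  have Bm : (st n).2 <= (st (n + j)%N).2.
    by elim: {IH} j => [|j IH]; rewrite ?addn0 // addnS; exact: le_trans (st2 _).
  have : 2^-1 ^+ (n + j) / (st (n + j)%N).2 <= 2^-1 ^+ j * (2^-1 ^+ n / (st n).2).
    rewrite mulrA -exprD (addnC j n) ler_wpM2l ?exprn_ge0 //.
    by rewrite lef_pV2 ?posrE ?Bgt.
  rewrite exprS; move: (2^-1 ^+ j) (2^-1 ^+ n / _) (_ / _) => a b c; clear; nra.
have dist2 n m : (n <= m)%N -> hn ((st m).1 - (st n).1) <= 2 * 2^-1 ^+ n / (st n).2.
  move=> nm; rewrite -(subnKC nm); apply: (le_trans (dist _ _)).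
  rewrite -[leRHS]mulrA ler_wpM2r // ?divr_ge0 ?exprn_ge0 ?(ltW (Bgt _)) //.
  by rewrite ler_piMr // gerBl exprn_ge0.
have cau : forall e : R, 0 < e -> exists N : nat, forall m n : nat,
    (N <= m)%N -> (N <= n)%N -> hn ((st m).1 - (st n).1) < e.
  move=> e e0; have h2 : 0 <= (2^-1 : R) by [].
  have h21 : (2^-1 : R) < 1 by rewrite invf_lt1 // ltr1n.
  have [N hN] := geom_small 5 h2 h21 e0.
  exists N => m n hm hn'; apply: (le_lt_trans (hn_tri _ (st N).1 _)).
  have d2 p : (N <= p)%N -> hn ((st p).1 - (st N).1) <= 2 * 2^-1 ^+ N.
    move=> hp; apply: (le_trans (dist2 _ _ hp)).
    rewrite ler_pdivrMr // ler_peMr ?Bpos // mulr_ge0 // exprn_ge0 //.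
  have p0 : 0 < (2^-1 : R) ^+ N by rewrite exprn_gt0.
  have := d2 m hm; have := d2 n hn'; rewrite (hn_dist (st n).1).
  move: hN p0; clear; lra.
have [l hl] := hn_complete cau.
have ld n : hn (l - (st n).1) <= 2 / (st n).2.
  apply/ler_addgt0Pl => e e0; have [N hN] := hl e e0.
  have := hN (maxn N n) (leq_maxl _ _); rewrite hn_dist => h1.
  have h2 := dist2 _ _ (leq_maxr N n).
  apply: (le_trans (hn_tri _ (st (maxn N n)).1 _)); apply: lerD; first exact: ltW.
  apply: (le_trans h2); rewrite -mulrA ler_wpM2l // ler_piMl //.
    by rewrite invr_ge0 ltW.
  by rewrite exprn_ile1 // invf_le1 // ler1n.
have big n : n%:R - 2 <= hn (S l).
  have [k k1 [kb kn]] := st3 n.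
  have h1 : nc (hfs_dot H2 (S l) k) <= hn (S l).
    by apply: (le_trans (hn_CS _ _)); rewrite ler_piMr ?hn_ge0.
  have h2 : nc (hfs_dot H2 (S ((st n.+1).1 - l)) k) <= 2.
    apply: (le_trans (kb _)); rewrite hn_dist mulrC -(ler_pdivlMr _ _ (Bgt _)).
    exact: ld.
  have h3 := ncD (hfs_dot H2 (S ((st n.+1).1 - l)) k) (hfs_dot H2 (S l) k).
  rewrite -formDl -SD subrK in h3.
  move: h1 h2 h3 kn; clear; lra.
have := big (Num.truncn (hn (S l) + 2)).+1.
have := truncnS_gt (hn (S l) + 2); clear; lra.
Qed.

End UniformBoundedness.

Section BoundedInverse.
Context {R : realType} {X1 X2 : Type}
  (H1 : hilbert_function_space R X1) (H2 : hilbert_function_space R X2).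
Local Notation C := R[i].

(** The functionals [g |-> <S g, k>] are bounded when [k] is the reproducing kernel
    at [phi x] with [lam x] nonzero, for then they are [g |-> g x / lam x].  An
    element orthogonal to all such kernels is killed by the injective map [W]. *)
Lemma wco_inverse (lam : X1 -> C) (phi : X1 -> X2) (W : H2 -> H1) :
  (forall x : X2, exists k : H2, forall f, hfs_eval f x = hfs_dot H2 f k) ->
  invertible_weighted_composition lam phi W ->
  exists S : H1 -> H2, [/\ cancel W S, cancel S W,
    forall (c : C) f g, S (c *: f + g) = c *: S f + S g &
    exists M : R, forall f, hn (S f) <= M * hn f].
Proof.
move=> ker [Wev _ [S WS SW]].
have Wlin (c : C) f g : W (c *: f + g) = c *: W f + W g.
  apply: hfs_eval_inj => x; rewrite hfs_eval_linear !Wev hfs_eval_linear; ring.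
have Slin (c : C) f g : S (c *: f + g) = c *: S f + S g.
  by apply: (can_inj WS); rewrite Wlin !SW.
exists S; split=> //; apply: gliding_hump => // f e e0.
pose D (k : H2) := exists N : R, forall g, nc (hfs_dot H2 (S g) k) <= N * hn g.
have Dlin (c : C) k k' : D k -> D k' -> D (c *: k + k').
  move=> [N hN] [N' hN']; exists (nc c * N + N') => g.
  rewrite formDr formZr; apply: (le_trans (ncD _ _)); rewrite mulrDl lerD //.
  by rewrite ncM nc_conj -mulrA ler_wpM2l ?nc_ge0.
have D0 : D 0 by exists 0 => g; rewrite linear0r nc0 mul0r.
suff Do h : (forall k, D k -> hfs_dot H2 h k = 0) -> h = 0.
  by have [k Dk hk] := hfs_dense D0 Dlin Do f e0; exists k.
move=> hD; apply: (can_inj WS); apply: hfs_eval_inj => x.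
rewrite Wev; have -> : W 0 = 0.
  by have := Wlin (-1) 0 0; rewrite scaler0 add0r scaleN1r addNr.
rewrite he0; have [->|lx] := eqVneq (lam x) 0; first by rewrite mul0r.
have [k hk] := ker (phi x).
rewrite hk hD ?mulr0 //.
have [N N0 hN] := he_bounded H1 x.
exists (N / nc (lam x)) => g.
rewrite -hk.
have -> : hfs_eval (S g) (phi x) = hfs_eval g x / lam x.
  by rewrite -{2}(SW g) Wev mulrAC divff // mul1r.
rewrite ncM ncV mulrAC ler_wpM2r // invr_ge0; exact: nc_ge0.
Qed.

End BoundedInverse.

(** * The domains *)

Section Domains.
Context {R : realType}.
Implicit Types (a : nat -> R) (t : R).

(** For nonnegative terms, bounded partial sums amount to convergence. *)
Definition summ a t := exists C : R, forall N, \sum_(n < N) a n * t ^+ n <= C.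

Lemma summP a t : (forall n, 0 <= a n) -> 0 <= t -> summ a t <-> cvgn (pseries a t).
Proof.
move=> a0 t0.
have nd : nondecreasing_seq (pseries a t).
  apply/nondecreasing_seqP => n; rewrite /pseries /series /=.
  by rewrite big_nat_recr //= lerDl mulr_ge0 // exprn_ge0.
split=> [[C hC]|cv].
  apply: nondecreasing_is_cvgn => //; exists C => _ [n _ <-].
  by rewrite /pseries /series /= big_mkord.
exists (limn (pseries a t)) => N; have := nondecreasing_cvgn_le nd cv N.
by rewrite /pseries /series /= big_mkord.
Qed.

Lemma summ_le a t t' : (forall n, 0 <= a n) -> 0 <= t' -> t' <= t ->
  summ a t -> summ a t'.
Proof.
move=> a0 t0 le [C hC]; exists C => N; apply: le_trans (hC N).
apply: ler_sum => n _; rewrite ler_wpM2l //; apply: lerXn2r => //; rewrite nnegrE //.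
exact: le_trans le.
Qed.

Lemma generating_ge0 a : generating_function a -> forall n, 0 <= a n.
Proof. by move=> [_ h _] n; exact: ltW. Qed.

Lemma summ_radius_le a t : generating_function a -> 0 <= t -> summ a t ->
  (t%:E <= convergence_radius a)%E.
Proof.
move=> ga t0 /(summP (generating_ge0 ga) t0) h; apply: ereal_sup_ubound.
by exists t.
Qed.

Lemma summ_radius_lt a t : generating_function a -> 0 <= t ->
  (t%:E < convergence_radius a)%E -> exists2 t', t < t' & summ a t'.
Proof.
move=> ga t0 /ereal_sup_gt [_ [x [x0 cx] <-]]; rewrite lte_fin => lt.
by exists x => //; apply/(summP (generating_ge0 ga) x0).
Qed.

Section Fixed.
Context {d : nat} {a : nat -> R} (ga : generating_function a).
Local Notation V := 'rV[R[i]^o]_d.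
Local Notation DX := (@natural_domain R d a).
Local Notation DB := (@open_domain R d a).
Let a0 := generating_ge0 ga.

Lemma sqrt_lt (r2 : R) (z : V) : (en z < Num.sqrt r2) = (en z ^+ 2 < r2).
Proof.
have [r0|r0] := ltP 0 r2; last first.
  rewrite (ler0_sqrtr r0) ltNge en_ge0 /=; apply/esym/negbTE.
  by rewrite -leNgt (le_trans r0) // sqr_ge0.
rewrite -{2}(sqr_sqrtr (ltW r0)) ltr_pXn2r ?nnegrE ?en_ge0 ?sqrtr_ge0 //.
Qed.

Lemma sqrt_le (r2 : R) (z : V) : 0 <= r2 ->
  (en z <= Num.sqrt r2) = (en z ^+ 2 <= r2).
Proof.
move=> r0.
by rewrite -{2}(sqr_sqrtr r0) ler_pXn2r ?nnegrE ?en_ge0 ?sqrtr_ge0.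
Qed.

Lemma natural_domainP (z : V) : DX z <-> summ a (en z ^+ 2).
Proof.
have z0 : 0 <= en z ^+ 2 by exact: sqr_ge0.
have := @summ_radius_lt a (en z ^+ 2) ga z0.
have := @summ_radius_le a (en z ^+ 2) ga z0.
have : (0 < convergence_radius a)%E by case: ga.
have enz : euclid_norm z = en z by rewrite en.unlock.
rewrite /natural_domain; case E : (convergence_radius a) => [r2| |] //=.
- rewrite lte_fin => r0 le lt; have r20 := ltW r0.
  case: asboolP => cv; rewrite /mkset enz.
    rewrite sqrt_le //; split=> [h|/le]; last by rewrite lee_fin.
    by apply: (summ_le a0 z0 h); apply/(summP a0 r20).
  rewrite sqrt_lt; split=> [h|h].
    have [|t' lt' /(summ_le a0 z0 (ltW lt')) //] := lt.
    by rewrite lte_fin.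
  rewrite lt_neqAle; have := le h; rewrite lee_fin => ->; rewrite andbT.
  apply/eqP => e; apply: cv; rewrite -e; exact/(summP a0 z0).
- move=> _ _ lt; split=> // _; have [|t' lt' h] := lt; first exact: ltry.
  exact: (summ_le a0 z0 (ltW lt') h).
Qed.

Lemma open_domainP (z : V) : DB z <-> exists2 t, en z ^+ 2 < t & summ a t.
Proof.
have z0 : 0 <= en z ^+ 2 by exact: sqr_ge0.
have := @summ_radius_lt a (en z ^+ 2) ga z0.
have le t : en z ^+ 2 < t -> summ a t -> (t%:E <= convergence_radius a)%E.
  by move=> lt; apply: summ_radius_le => //; exact: le_trans (ltW lt).
have : (0 < convergence_radius a)%E by case: ga.
move: le; have enz : euclid_norm z = en z by rewrite en.unlock.
rewrite /open_domain; case E : (convergence_radius a) => [r2| |] //=.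
- rewrite lte_fin => le r0 lt; rewrite /mkset enz sqrt_lt; split=> [h|[t tz /(le _ tz)]].
    by apply: lt; rewrite lte_fin.
  by rewrite lee_fin; exact: lt_le_trans.
- move=> _ _ lt; split=> // _; apply: lt; exact: ltry.
Qed.

Lemma domain_le (z w : V) : en w <= en z -> DX z -> DX w.
Proof.
move=> le /natural_domainP h; apply/natural_domainP.
apply: (summ_le a0 (sqr_ge0 _) _ h).
by apply: lerXn2r; rewrite ?nnegrE ?en_ge0.
Qed.

Lemma domain_lt (z w : V) : en w < en z -> DX z -> DB w.
Proof.
move=> le /natural_domainP h; apply/open_domainP; exists (en z ^+ 2); last exact: h.
by rewrite ltr_pXn2r ?nnegrE ?en_ge0.
Qed.

Lemma open_domain_sub (z : V) : DB z -> DX z.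
Proof.
move=> /open_domainP [t tz h]; apply/natural_domainP.
exact: (summ_le a0 (sqr_ge0 _) (ltW tz) h).
Qed.

Lemma open_domain_le (z w : V) : en w <= en z -> DB z -> DB w.
Proof.
move=> le /open_domainP [t tz h]; apply/open_domainP; exists t; last exact: h.
apply: le_lt_trans tz; by apply: lerXn2r; rewrite ?nnegrE ?en_ge0.
Qed.

Lemma open_domain0 : DB 0.
Proof.
apply/open_domainP; rewrite en0 expr0n /=.
by apply: summ_radius_lt => //; case: ga.
Qed.

Lemma not_open_domain (z w : V) : ~ DB z -> DX w -> en w <= en z.
Proof.
by move=> nz Xw; rewrite leNgt; apply/negP => lt; apply: nz; exact: domain_lt Xw.
Qed.

Lemma segment_norm (p y : V) (t : R) : 0 <= t -> t <= 1 ->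
  en (p + t%:C *: (y - p)) <= (1 - t) * en p + t * en y.
Proof.
move=> t0 t1.
have -> : p + t%:C *: (y - p) = (1 - t)%:C *: p + t%:C *: y.
  by rewrite scalerBr rcB scalerBl scale1r addrCA addrC.
apply: (le_trans (enD _ _)); rewrite !enZ !nc_real !ger0_norm ?subr_ge0 //.
Qed.

Lemma segment_domain (p y : V) (t : R) : DX p -> DX y -> 0 <= t -> t <= 1 ->
  DX (p + t%:C *: (y - p)).
Proof.
move=> Xp Xy t0 t1; have le := segment_norm p y t0 t1.
have [h|h] := leP (en p) (en y).
  apply: (domain_le _ Xy); apply: (le_trans le).
  have : (1 - t) * en p <= (1 - t) * en y by rewrite ler_wpM2l // subr_ge0.
  by move=> h'; apply: (le_trans (lerD h' (lexx _))); rewrite -mulrDl subrK mul1r.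
apply: (domain_le _ Xp); apply: (le_trans le).
have h' : t * en y <= t * en p by rewrite ler_wpM2l // ltW.
by apply: (le_trans (lerD (lexx _) h')); rewrite -mulrDl subrK mul1r.
Qed.

Lemma segment_open (p y : V) (t : R) : DB p -> DX y -> 0 <= t -> t < 1 ->
  DB (p + t%:C *: (y - p)).
Proof.
move=> Bp Xy t0 t1; have le := segment_norm p y t0 (ltW t1).
have [h|h] := ltP (en p) (en y).
  apply: (domain_lt _ Xy); apply: (le_lt_trans le).
  have h' : (1 - t) * en p < (1 - t) * en y by rewrite ltr_pM2l // subr_gt0.
  have e : en y = (1 - t) * en y + t * en y by rewrite -mulrDl subrK mul1r.
  by rewrite [ltRHS]e ltrD2r.
apply: (open_domain_le _ Bp); apply: (le_trans le).
have h' : t * en y <= t * en p by rewrite ler_wpM2l.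
by apply: (le_trans (lerD (lexx _) h')); rewrite -mulrDl subrK mul1r.
Qed.

(** Non-entireness enters here: the domain is a ball of finite radius [r].  It is
    closed or open, and the two cases are treated differently in [selfmap_onto]. *)
Lemma natural_domain_cases : ~ entire a -> exists r : R, [/\ 0 < r,
  forall z : V, en z < r -> DB z, forall z : V, DX z -> en z <= r &
  (forall z : V, en z <= r -> DX z) /\ summ a (r ^+ 2) \/
  (forall z : V, DX z -> DB z /\ en z < r)].
Proof.
move=> na; have : (0 < convergence_radius a)%E by case: ga.
have rl t := @summ_radius_lt a t ga; have re t := @summ_radius_le a t ga.
move: na rl re; rewrite /entire.
case E : (convergence_radius a) => [r2| |] //= _ rl re; rewrite lte_fin => r0.
have r20 := ltW r0.
exists (Num.sqrt r2); split.
- by rewrite sqrtr_gt0.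
- move=> z; rewrite sqrt_lt => h; apply/open_domainP.
  by apply: rl; rewrite ?sqr_ge0.
- move=> z /natural_domainP h; rewrite sqrt_le //.
  by have := re _ (sqr_ge0 _) h; rewrite lee_fin.
have [h|h] := pselect (summ a r2); [left|right].
  split; last by rewrite sqr_sqrtr.
  move=> z; rewrite sqrt_le // => le; apply/natural_domainP.
  exact: (summ_le a0 (sqr_ge0 _) le h).
move=> z /natural_domainP hz; have lt : en z ^+ 2 < r2.
  have := re _ (sqr_ge0 _) hz; rewrite lee_fin lt_neqAle => ->.
  by rewrite andbT; apply/eqP => e; apply: h; rewrite -e.
split; last by rewrite sqrt_lt.
by apply/open_domainP; apply: rl; rewrite ?sqr_ge0 // lte_fin.
Qed.

End Fixed.
End Domains.

(** * Elements of a weighted Hardy space *)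

Section Evaluation.
Context {R : realType} {d : nat} {a : nat -> R}
  {H : hilbert_function_space R (@natural_domain R d a)}.
Local Notation C := R[i].
Local Notation V := 'rV[C^o]_d.
Local Notation DX := (@natural_domain R d a).
Implicit Types (f g : H) (z w : V).

(** Evaluation at the points of the ambient space, extended by 0, so that points
    need not carry a proof of membership. *)
Definition ev f z : C :=
  oapp (hfs_eval f) 0 (insub z : option (@natural_domain R d a)).

Lemma evE f (x : @natural_domain R d a) : ev f (\val x) = hfs_eval f x.
Proof. by rewrite /ev valK. Qed.

Lemma domain_val z : DX z -> exists x : @natural_domain R d a, \val x = z.
Proof. by move=> h; exists (SigSub (mem_set h)). Qed.

Lemma val_domain (x : @natural_domain R d a) : DX (\val x).
Proof. exact: set_valP. Qed.

Lemma evD f g z : ev (f + g) z = ev f z + ev g z.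
Proof. by rewrite /ev; case: insub => [x|] /=; rewrite ?heD ?addr0. Qed.
Lemma evZ (c : C) f z : ev (c *: f) z = c * ev f z.
Proof. by rewrite /ev; case: insub => [x|] /=; rewrite ?heZ ?mulr0. Qed.
Lemma ev0 z : ev (0 : H) z = 0.
Proof. by rewrite /ev; case: insub => [x|] //=; rewrite he0. Qed.
Lemma evB f g z : ev (f - g) z = ev f z - ev g z.
Proof. by rewrite /ev; case: insub => [x|] /=; rewrite ?heB ?subr0. Qed.
Lemma ev_sum (I : Type) (r : seq I) (P : pred I) (F : I -> H) z :
  ev (\sum_(i <- r | P i) F i) z = \sum_(i <- r | P i) ev (F i) z.
Proof.
elim/big_rec2: _ => [|i y1 y2 _ <-]; first exact: ev0.
exact: evD.
Qed.

Lemma ev_inj f g : (forall z, DX z -> ev f z = ev g z) -> f = g.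
Proof.
by move=> h; apply: hfs_eval_inj => x; rewrite -!evE; apply/h/val_domain.
Qed.

Lemma hn_orth_sum (F : nat -> H) N : (forall n m, n != m -> hfs_dot H (F n) (F m) = 0) ->
  hn (\sum_(n < N) F n) ^+ 2 = \sum_(n < N) hn (F n) ^+ 2.
Proof.
move=> o; elim: N => [|N IH]; first by rewrite !big_ord0 hn0 expr0n.
rewrite !big_ord_recr /= -IH !hnE; apply: fnormD_orth.
rewrite form_suml big1 // => n _; apply: o.
by rewrite ltn_eqF // ltn_ord.
Qed.

End Evaluation.

Section WeightedHardy.
Context {R : realType} {d : nat} {a : nat -> R}
  {H : hilbert_function_space R (@natural_domain R d a)} (hH : weighted_hardy H).
Local Notation C := R[i].
Local Notation V := 'rV[C^o]_d.
Local Notation DX := (@natural_domain R d a).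
Local Notation dot := (hfs_dot H).
Implicit Types (f g : H) (z w : V) (al be : multi_index d).

Definition mon : multi_index d -> H := projT1 (cid (wh_monomials hH)).

Lemma mon_ev al z : DX z -> ev (mon al) z = monomial al z.
Proof.
move=> /domain_val [x <-]; rewrite evE /mon; case: cid => m /= [h _ _ _ _].
exact: h.
Qed.

Lemma mon_neq0 al : mon al != 0.
Proof. by rewrite /mon; case: cid => m /= [_ h _ _ _]. Qed.

Lemma mon_orth al be : al != be -> dot (mon al) (mon be) = 0.
Proof.
by rewrite /mon; case: cid => m /= [_ _ h _ _] => /eqP; exact: h.
Qed.

Lemma mon_dense f (e : R) : 0 < e -> exists (s : seq (multi_index d)) c,
  hn (f - \sum_(al <- s) c al *: mon al) < e.
Proof. by rewrite hn.unlock /mon; case: cid => m /= [_ _ _ h _]; exact: h. Qed.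

Lemma mon_dot_neq0 al : dot (mon al) (mon al) != 0.
Proof. by rewrite gt_eqF // neq0_dnorm_gt0 // mon_neq0. Qed.

Lemma kernelP z : DX z -> exists2 k : H, forall f, ev f z = dot f k &
  forall w, DX w -> forall e : R, 0 < e -> exists N, forall n, (N <= n)%N ->
    nc (ev k w - \sum_(j < n) (a j)%:C * cdot w z ^+ j) < e.
Proof.
move=> /domain_val [x <-]; have [k [h1 h2]] := wh_kernel hH x; exists k.
  by move=> f; rewrite evE.
move=> _ /domain_val [y <-] e e0; have := h2 y; rewrite evE.
move=> /cvgrPdist_lt /(_ e%:C); rewrite ltcR => /(_ e0) [N _ hN].
exists N => n /hN; rewrite /= ncE ltcR /series /= big_mkord.
by [].
Qed.

Definition one : H := mon [ffun=> 0%N].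
Lemma ev_one z : DX z -> ev one z = 1.
Proof.
by move=> h; rewrite mon_ev // /monomial big1 // => i _; rewrite ffunE expr0.
Qed.

Definition mi_delta (j : 'I_d) : multi_index d := [ffun i => (i == j : nat)].

Lemma monomial_delta j z : monomial (mi_delta j) z = z 0 j.
Proof.
rewrite /monomial (bigD1 j) //= big1 => [|i ij].
  by rewrite ffunE eqxx mulr1.
by rewrite ffunE (negPf ij) expr0.
Qed.

Definition crd (j : 'I_d) : H := mon (mi_delta j).
Lemma ev_crd j z : DX z -> ev (crd j) z = z 0 j.
Proof. by move=> h; rewrite mon_ev // monomial_delta. Qed.

(** The Taylor coefficient of index [al], as a Fourier coefficient. *)
Definition cf f al : C := dot f (mon al) / dot (mon al) (mon al).

(** Multi-indices are enumerated through their codes, which turns the expansion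
    along the monomials into an ordinary series. *)
Definition term f (n : nat) : H :=
  if (pickle_inv n : option (multi_index d)) is Some al then cf f al *: mon al else 0.

Definition psum f N : H := \sum_(n < N) term f n.

Lemma pickle_invE n al : (pickle_inv n : option (multi_index d)) = Some al -> pickle al = n.
Proof. by move=> e; have := pickle_invK (T := multi_index d) n; rewrite e. Qed.

Lemma term_pickle f al : term f (pickle al) = cf f al *: mon al.
Proof. by rewrite /term pickleK_inv. Qed.

Lemma term_orth f g n m : n != m -> dot (term f n) (term g m) = 0.
Proof.
rewrite /term; case En : (pickle_inv n) => [al|] nm; last by rewrite linear0l.
case Em : (pickle_inv m) => [be|]; last by rewrite linear0r.
rewrite formZl formZr mon_orth ?mulr0 //; apply: contra nm => /eqP e.
by rewrite -(pickle_invE En) -(pickle_invE Em) e.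
Qed.

Lemma term_mon_orth f n al : n != pickle al -> dot (term f n) (mon al) = 0.
Proof.
rewrite /term; case En : (pickle_inv n) => [be|] nm; last by rewrite linear0l.
rewrite formZl mon_orth ?mulr0 //; apply: contra nm => /eqP e.
by rewrite -(pickle_invE En) e.
Qed.

Lemma psum_resid f N al : (pickle al < N)%N -> dot (f - psum f N) (mon al) = 0.
Proof.
move=> h; rewrite formBl /psum form_suml (bigD1 (Ordinal h)) //= big1 ?addr0.
  by rewrite term_pickle formZl /cf divfK ?subrr // mon_dot_neq0.
move=> n hn'; apply: term_mon_orth; apply: contra hn' => /eqP e.
by apply/eqP/val_inj.
Qed.

(** Partial sums are orthogonal projections, hence at least as close to [f] as any
    combination of the same monomials. *)
Lemma psum_cvg f (e : R) : 0 < e ->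
  exists N0, forall N, (N0 <= N)%N -> hn (f - psum f N) < e.
Proof.
move=> e0; have [s [c hs]] := mon_dense f e0.
exists (\max_(al <- s) (pickle al)).+1 => N hN.
set g := \sum_(_ <- s) _ in hs.
apply: le_lt_trans hs.
have o : dot (f - psum f N) (psum f N - g) = 0.
  have oz al : (pickle al < N)%N -> dot (f - psum f N) (mon al) = 0.
    exact: psum_resid.
  rewrite formBr /psum /g !form_sumr big1 ?sub0r => [|n _]; last first.
    rewrite /term; case En : (pickle_inv _) => [al|]; last by rewrite linear0r.
    by rewrite formZr -/(psum f N) oz ?mulr0 // (pickle_invE En).
  rewrite -/(psum f N) big_seq big1 ?oppr0 // => al als.
  rewrite formZr oz ?mulr0 //; apply: leq_trans hN; rewrite ltnS.
  by rewrite (big_rem al) //= leq_maxl.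
rewrite -(ler_pXn2r (_ : (0 < 2)%N)) ?nnegrE ?hn_ge0 //.
have -> : f - g = (f - psum f N) + (psum f N - g) by rewrite addrA subrK.
by rewrite [X in _ <= X ^+ 2]hnE (fnormD_orth o) -!hnE lerDl sqr_ge0.
Qed.

Lemma psum_sqr f N : hn (psum f N) ^+ 2 = \sum_(n < N) hn (term f n) ^+ 2.
Proof. by apply: hn_orth_sum => n m; exact: term_orth. Qed.

Lemma psum_le f N : hn (psum f N) <= hn f.
Proof.
have o : dot (f - psum f N) (psum f N) = 0.
  rewrite {2}/psum form_sumr big1 // => n _.
  rewrite /term; case En : (pickle_inv _) => [al|]; last by rewrite linear0r.
  by rewrite formZr psum_resid ?mulr0 // (pickle_invE En).
rewrite -(ler_pXn2r (_ : (0 < 2)%N)) ?nnegrE ?hn_ge0 //.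
rewrite -{2}(subrK (psum f N) f) [X in _ <= X ^+ 2]hnE (fnormD_orth o) -!hnE.
by rewrite lerDr sqr_ge0.
Qed.

Lemma ev_bounded z : exists2 M : R, 0 <= M & forall f, nc (ev f z) <= M * hn f.
Proof.
have [/domain_val [x <-]|nz] := pselect (DX z).
  by have [M M0 h] := he_bounded H x; exists M => // f; rewrite evE.
exists 0 => // f; rewrite /ev; case: insubP => [x _ e|_] /=; last by rewrite nc0 mul0r.
by case: nz; rewrite -e; exact: val_domain.
Qed.

Lemma ev_psum f N z : DX z -> ev (psum f N) z =
  \sum_(n < N) (if (pickle_inv n : option (multi_index d)) is Some al
    then cf f al * monomial al z else 0).
Proof.
move=> Xz; rewrite ev_sum; apply: eq_bigr => n _; rewrite /term.
by case: pickle_inv => [al|]; rewrite ?ev0 // evZ mon_ev.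
Qed.

Lemma psum_ev_cvg f z (e : R) : DX z -> 0 < e ->
  exists N0, forall N, (N0 <= N)%N -> nc (ev f z - ev (psum f N) z) < e.
Proof.
move=> Xz e0; have [M M0 hM] := ev_bounded z.
have e1 : 0 < e / (M + 1) by rewrite divr_gt0 // ltr_wpDl.
have [N0 h] := psum_cvg f e1; exists N0 => N /h lt.
rewrite -evB; apply: (le_lt_trans (hM _)).
move: lt; rewrite ltr_pdivlMr ?ltr_wpDl // => lt.
by apply: le_lt_trans lt; rewrite mulrC ler_wpM2l ?hn_ge0 // lerDl.
Qed.

(** The kernel [k] at [z] satisfies [|k|^2 = k z = G (|z|^2)]. *)
Lemma kernel_norm z (C0 t : R) : DX z -> en z ^+ 2 <= t ->
  (forall N, \sum_(n < N) a n * t ^+ n <= C0) ->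
  exists2 k : H, hn k ^+ 2 <= C0 & forall f, ev f z = dot f k.
Proof.
move=> Xz zt hC; have [k hk hser] := kernelP Xz; exists k => //.
have a0 := generating_ge0 (wh_generating hH).
apply/ler_addgt0Pl => e e0; have [N hN] := hser z Xz e e0.
have := hN N (leqnn _); rewrite hk hn_dot => {}hN.
have h1 : nc (\sum_(j < N) (a j)%:C * cdot z z ^+ j) <= C0.
  apply: le_trans (hC N); apply: (le_trans (nc_sum _ _ _)); apply: ler_sum => j _.
  rewrite ncM nc_real (ger0_norm (a0 j)) cdotzz ncX nc_real (ger0_norm (sqr_ge0 _)).
  rewrite ler_wpM2l //; apply: lerXn2r => //; rewrite nnegrE; first exact: sqr_ge0.
  by apply: le_trans zt; exact: sqr_ge0.
have -> : hn k ^+ 2 = nc (hn k ^+ 2)%:C by rewrite nc_real ger0_norm ?sqr_ge0.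
rewrite -[X in nc X](subrK (\sum_(j < N) (a j)%:C * cdot z z ^+ j)).
by apply: (le_trans (ncD _ _)); apply: lerD => //; exact: ltW.
Qed.

Lemma ev_unif (t : R) : summ a t -> exists2 M : R, 0 <= M &
  forall z, en z ^+ 2 <= t -> forall f, nc (ev f z) <= M * hn f.
Proof.
move=> [C0 hC]; exists (Num.sqrt C0); first exact: sqrtr_ge0.
move=> z zt f; have t0 : 0 <= t by apply: le_trans zt; exact: sqr_ge0.
have Xz : DX z.
  apply/(natural_domainP (wh_generating hH)).
  by apply: (summ_le (generating_ge0 (wh_generating hH)) (sqr_ge0 _) zt); exists C0.
have [k kC ->] := kernel_norm Xz zt hC.
apply: (le_trans (hn_CS _ _)); rewrite mulrC ler_wpM2r ?hn_ge0 //.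
rewrite -(ler_pXn2r (_ : (0 < 2)%N)) ?nnegrE ?hn_ge0 ?sqrtr_ge0 // sqr_sqrtr //.
by apply: le_trans kC; exact: sqr_ge0.
Qed.

(** Replacing the coefficients of [f] by their moduli does not change its norm, and
    the point with coordinates [|x_j|] has the norm of [x]: the sum of moduli is a
    value of another element at another point. *)
Lemma abs_sum_unif (t : R) : summ a t -> exists2 M : R, 0 <= M &
  forall x, en x ^+ 2 <= t -> forall f N,
  \sum_(n < N) (if (pickle_inv n : option (multi_index d)) is Some al
    then nc (cf f al) * nc (monomial al x) else 0) <= M * hn f.
Proof.
move=> ht; have [M M0 hM] := ev_unif ht; exists M => // x xt f N.
pose y : V := \row_j (nc (x 0 j))%:C.
have yx : en y ^+ 2 = en x ^+ 2.
  by rewrite !en_sqr; apply: eq_bigr => j _; rewrite mxE nc_real ger0_norm ?nc_ge0.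
have Xy : DX y.
  apply/(natural_domainP (wh_generating hH)); rewrite yx.
  exact: (summ_le (generating_ge0 (wh_generating hH)) (sqr_ge0 _) xt).
pose G (n : nat) : H := if (pickle_inv n : option (multi_index d)) is Some al
  then (nc (cf f al))%:C *: mon al else 0.
have nG n : hn (G n) = hn (term f n).
  rewrite /G /term; case: pickle_inv => [al|] //.
  by rewrite !hnZ nc_real ger0_norm ?nc_ge0.
have sG : hn (\sum_(n < N) G n) <= hn f.
  apply: le_trans (psum_le f N).
  rewrite -(ler_pXn2r (_ : (0 < 2)%N)) ?nnegrE ?hn_ge0 // psum_sqr hn_orth_sum.
    by apply: ler_sum => n _; rewrite nG.
  move=> n m nm; rewrite /G.
  have := term_orth f f nm; rewrite /term.
  case En : (pickle_inv n) => [al|]; last by rewrite !linear0l.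
  case Em : (pickle_inv m) => [be|]; last by rewrite !linear0r.
  move=> _; rewrite formZl formZr mon_orth ?mulr0 //.
  apply: contra nm => /eqP e.
  by rewrite -(pickle_invE En) -(pickle_invE Em) e.
apply: le_trans (ler_wpM2l M0 sG).
have yt : en y ^+ 2 <= t by rewrite yx.
apply: le_trans (hM y yt _).
rewrite ev_sum -[leLHS]ger0_norm; last first.
  apply: sumr_ge0 => n _; case: pickle_inv => [al|] //.
  by rewrite mulr_ge0 ?nc_ge0.
rewrite -nc_real rc_sum.
rewrite le_eqVlt; apply/orP; left; apply/eqP; congr nc; apply: eq_bigr => n _.
rewrite /G; case: pickle_inv => [al|]; last by rewrite ev0.
rewrite evZ mon_ev // rcM; congr (_ * _); rewrite /monomial.
rewrite (big_morph (@Normc.normc R) (@ncM R) (@nc1 R)).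
rewrite (big_morph (real_complex R) (@rcM R) (erefl _)).
by apply: eq_bigr => j _; rewrite ncX rcX mxE.
Qed.

End WeightedHardy.

(** * Complex limits and dominated polynomials *)

Section ComplexLimits.
Context {R : realType}.
Local Notation C := R[i].

Definition cvg_to (u : nat -> C) (l : C) := forall e : R, 0 < e ->
  exists N0, forall N, (N0 <= N)%N -> nc (l - u N) <= e.

Lemma abs_cvg (u : nat -> C) (B : R) :
  (forall N, \sum_(n < N) nc (u n) <= B) ->
  exists l, cvg_to (fun N => \sum_(n < N) u n) l.
Proof.
move=> hB.
have part (p : C -> R) : (forall x, `|p x| <= nc x) ->
    (forall N, p (\sum_(n < N) u n) = \sum_(n < N) p (u n)) ->
    exists l : R, forall e : R, 0 < e -> exists N0, forall N, (N0 <= N)%N ->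
      `|l - p (\sum_(n < N) u n)| <= e.
  move=> ple psum.
  have cn : cvgn [normed series (fun n => p (u n))].
    have E n : [normed series (fun n => p (u n))] n = \sum_(i < n) `|p (u i)|.
      by rewrite /= /series /= big_mkord.
    apply: nondecreasing_is_cvgn.
      apply/nondecreasing_seqP => n; rewrite !E big_ord_recr /= lerDl.
      exact: normr_ge0.
    exists B => _ [n _ <-]; rewrite E.
    by apply: le_trans (hB n); apply: ler_sum => i _; exact: ple.
  have /cvg_ex [l /= /cvgrPdist_le hl] := normed_cvg cn.
  exists l => e e0; have [N0 _ hN] := hl e e0; exists N0 => N /hN.
  by rewrite /series /= big_mkord psum.
have [l1 h1] : exists l : R, forall e : R, 0 < e -> exists N0, forall N, (N0 <= N)%N ->
      `|l - complex.Re (\sum_(n < N) u n)| <= e.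
  apply: part => [x|N]; first exact: nc_Re.
  by rewrite (big_morph (@complex.Re R) (id1 := 0) (op1 := +%R)) // => -[? ?] [].
have [l2 h2] : exists l : R, forall e : R, 0 < e -> exists N0, forall N, (N0 <= N)%N ->
      `|l - complex.Im (\sum_(n < N) u n)| <= e.
  apply: part => [x|N]; first exact: nc_Im.
  by rewrite (big_morph (@complex.Im R) (id1 := 0) (op1 := +%R)) // => -[? ?] [].
exists (l1 +i* l2) => e e0; have e2 : 0 < e / 2 by rewrite divr_gt0.
have [N1 H1] := h1 _ e2; have [N2 H2] := h2 _ e2.
exists (maxn N1 N2) => N; rewrite geq_max => /andP[/H1 g1 /H2 g2].
move: g1 g2; case: (\sum_(n < N) u n) => x y /= g1 g2.
by apply: (le_trans (nc_le_ReIm _)); rewrite /= [leRHS]splitr lerD.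
Qed.

Lemma cvg_to_uniq u l l' : cvg_to u l -> cvg_to u l' -> l = l'.
Proof.
move=> h h'; apply/eqP; rewrite -subr_eq0; apply/eqP; apply: nc_small0 => e e0.
have e2 : 0 < e / 2 by rewrite divr_gt0.
have [N1 H1] := h _ e2; have [N2 H2] := h' _ e2.
apply: (le_trans (nc_tri _ (u (maxn N1 N2)) _)); rewrite [leRHS]splitr lerD //.
  by rewrite H1 // leq_maxl.
by rewrite nc_dist H2 // leq_maxr.
Qed.

Lemma cvg_to_cst u l N0 : (forall N, (N0 <= N)%N -> u N = l) -> cvg_to u l.
Proof. by move=> h e e0; exists N0 => N /h ->; rewrite subrr nc0 ltW. Qed.

Lemma cvg_to_sum (I : Type) (r : seq I) (u : I -> nat -> C) (l c : I -> C) :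
  (forall k, cvg_to (u k) (l k)) ->
  cvg_to (fun N => \sum_(k <- r) u k N * c k) (\sum_(k <- r) l k * c k).
Proof.
move=> h; elim: r => [|i r IH] e e0.
  by exists 0%N => N _; rewrite !big_nil subrr nc0 ltW.
have e2 : 0 < e / 2 by rewrite divr_gt0.
have e3 : 0 < e / 2 / (nc (c i) + 1) by rewrite divr_gt0 // ltr_wpDl ?nc_ge0.
have [N1 H1] := IH _ e2; have [N2 H2] := h i _ e3.
exists (maxn N1 N2) => N; rewrite geq_max => /andP[/H1 g1 /H2 g2].
rewrite !big_cons opprD addrACA -mulrBl.
apply: (le_trans (ncD _ _)); rewrite [leRHS]splitr [leLHS]addrC.
apply: lerD => //; rewrite ncM.
move: g2; rewrite ler_pdivlMr ?ltr_wpDl ?nc_ge0 // => g2.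
by apply: le_trans g2; rewrite ler_wpM2l ?nc_ge0 // lerDl.
Qed.

Lemma cvg_toM u v l l' : cvg_to u l -> cvg_to v l' ->
  cvg_to (fun n => u n * v n) (l * l').
Proof.
move=> hu hv e e0; pose K := nc l + nc l' + 1 + 1.
have K0 : 0 < K by rewrite /K ltr_wpDl // !addr_ge0 ?nc_ge0.
have e1 : 0 < Num.min 1 (e / K) by rewrite lt_min ltr01 divr_gt0.
have [N1 H1] := hu _ e1; have [N2 H2] := hv _ e1.
exists (maxn N1 N2) => N; rewrite geq_max => /andP[/H1 g1 /H2 g2].
have -> : l * l' - u N * v N = l * (l' - v N) + (l - u N) * (l' - (l' - v N)) by ring.
move: g1 g2; rewrite !le_min => /andP[g1 g1'] /andP[g2 g2'].
have b1 : nc (l * (l' - v N)) <= nc l * (e / K) by rewrite ncM ler_wpM2l ?nc_ge0.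
have b2 : nc ((l - u N) * (l' - (l' - v N))) <= (e / K) * (nc l' + 1).
  rewrite ncM ler_pM ?nc_ge0 //; apply: (le_trans (ncB _ _)).
  by rewrite lerD2l.
apply: (le_trans (ncD _ _)); apply: (le_trans (lerD b1 b2)).
rewrite mulrC -mulrDr mulrAC ler_pdivrMr // ler_wpM2l ?(ltW e0) //.
by rewrite addrA lerDl.
Qed.

Lemma cvg_toB u v l l' : cvg_to u l -> cvg_to v l' ->
  cvg_to (fun n => u n - v n) (l - l').
Proof.
move=> hu hv e e0; have e2 : 0 < e / 2 by rewrite divr_gt0.
have [N1 H1] := hu _ e2; have [N2 H2] := hv _ e2.
exists (maxn N1 N2) => N; rewrite geq_max => /andP[/H1 g1 /H2 g2].
have -> : l - l' - (u N - v N) = (l - u N) - (l' - v N) by ring.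
by apply: (le_trans (ncB _ _)); rewrite [leRHS]splitr lerD.
Qed.

Lemma tay_limit (u : C -> C) (M s : R) (d : nat -> C)
    (uN : nat -> C -> C) (dN : nat -> nat -> C) : 0 < s ->
  (forall N, tay (uN N) M s (dN N)) ->
  (forall eta, nc eta <= s -> cvg_to (fun N => uN N eta) (u eta)) ->
  (forall k, cvg_to (fun N => dN N k) (d k)) ->
  tay u M s d.
Proof.
move=> s0 ht hu hd; split=> // K eta he.
apply/ler_addgt0Pl => e e0; have e2 : 0 < e / 2 by rewrite divr_gt0.
have [N1 H1] := hu eta he _ e2.
have [N2 H2] := cvg_to_sum (index_enum 'I_K) (fun k => eta ^+ k)
  (fun k : 'I_K => hd k) e2.
pose N := maxn N1 N2; have g1 := H1 N (leq_maxl _ _); have g2 := H2 N (leq_maxr _ _).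
have [_ g3] := ht N; have {}g3 := g3 K eta he.
set S := \sum_(k < K) d k * _ in g2 *; set SN := \sum_(k < K) _ in g2 g3.
have -> : u eta - S = (u eta - uN N eta) - (S - SN) + (uN N eta - SN) by ring.
apply: (le_trans (ncD _ _)); apply: lerD => //.
by apply: (le_trans (ncB _ _)); rewrite [leRHS]splitr lerD.
Qed.

End ComplexLimits.

Section DominatedPoly.
Context {R : realType}.
Local Notation C := R[i].

Definition dom (P : {poly C}) (Q : {poly R}) := forall k, nc P`_k <= Q`_k.

Lemma dom_ge0 P Q : dom P Q -> forall k, 0 <= Q`_k.
Proof. by move=> h k; apply: le_trans (h k); exact: nc_ge0. Qed.

Lemma domM P Q P' Q' : dom P Q -> dom P' Q' -> dom (P * P') (Q * Q').
Proof.
move=> h h' k; rewrite !coefM; apply: (le_trans (nc_sum _ _ _)).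
by apply: ler_sum => i _; rewrite ncM ler_pM ?nc_ge0.
Qed.

Lemma dom1 : dom 1 1.
Proof. by move=> k; rewrite !coef1; case: eqP; rewrite ?nc1 ?nc0. Qed.

Lemma dom_prod (I : Type) (r : seq I) (P : I -> {poly C}) (Q : I -> {poly R}) :
  (forall i, dom (P i) (Q i)) -> dom (\prod_(i <- r) P i) (\prod_(i <- r) Q i).
Proof.
move=> h; elim: r => [|i r IH]; first by rewrite !big_nil; exact: dom1.
by rewrite !big_cons; exact: domM.
Qed.

Lemma domX P Q n : dom P Q -> dom (P ^+ n) (Q ^+ n).
Proof.
move=> h; elim: n => [|n IH]; first by rewrite !expr0; exact: dom1.
by rewrite !exprS; exact: domM.
Qed.

Lemma dom_lin (x y : C) : dom (x%:P + y *: 'X) ((nc x)%:P + nc y *: 'X).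
Proof.
move=> k; rewrite !coefD !coefZ !coefX !coefC.
by case: k => [|[|k]] /=; rewrite ?mulr0 ?mulr1 ?addr0 ?add0r ?nc0.
Qed.

(** Domination makes [Q.[s]] a bound for [P] and for all its remainders. *)
Lemma tay_poly (P : {poly C}) Q (s : R) : dom P Q -> 0 < s ->
  tay (fun eta => P.[eta]) Q.[s] s (fun k => P`_k).
Proof.
move=> h s0; split=> // K eta he; set q := nc eta / s.
have q0 : 0 <= q by rewrite divr_ge0 ?nc_ge0 // ltW.
have q1 : q <= 1 by rewrite ler_pdivrMr ?mul1r.
have ne : nc eta = q * s by rewrite /q divfK ?gt_eqF.
(* both polynomials are summed over the same range of exponents *)
pose m := maxn (size P) (size Q).
have Pm : P.[eta] = \sum_(k < K + m) P`_k * eta ^+ k.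
  apply: horner_coef_wide; apply: leq_trans (leq_addl _ _); exact: leq_maxl.
have Qm : Q.[s] = \sum_(k < K + m) Q`_k * s ^+ k.
  apply: horner_coef_wide; apply: leq_trans (leq_addl _ _); exact: leq_maxr.
have Q0 k : 0 <= Q`_k * s ^+ k by rewrite mulr_ge0 ?(dom_ge0 h) // exprn_ge0 // ltW.
rewrite Pm big_split_ord /= addrAC subrr add0r.
apply: (@le_trans _ _ (\sum_(i < m) (Q`_(K + i) * s ^+ (K + i)) * q ^+ K)).
  apply: (le_trans (nc_sum _ _ _)); apply: ler_sum => i _.
  rewrite ncM ncX ne exprMn [q ^+ _ * _]mulrC mulrA.
  have -> : q ^+ (K + i) = q ^+ K * q ^+ i by rewrite exprD.
  have k0 := exprn_ge0 K q0; have i0 := exprn_ge0 i q0; have i1 : q ^+ i <= 1 by rewrite exprn_ile1.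
  apply: ler_pM.
  - by rewrite mulr_ge0 ?nc_ge0 // exprn_ge0 // ltW.
  - by rewrite mulr_ge0.
  - by rewrite ler_wpM2r ?h // exprn_ge0 // ltW.
  - by rewrite ler_piMr.
rewrite -mulr_suml ler_wpM2r ?exprn_ge0 // Qm big_split_ord /= lerDr.
by apply: sumr_ge0.
Qed.

End DominatedPoly.

(** * Taylor expansions along lines *)

Section TaylorOfElements.
Context {R : realType} {d : nat} {a : nat -> R}
  {H : hilbert_function_space R (@natural_domain R d a)} (hH : weighted_hardy H).
Local Notation C := R[i].
Local Notation V := 'rV[C^o]_d.
Local Notation DX := (@natural_domain R d a).
Local Notation DB := (@open_domain R d a).
Implicit Types (f g : H) (y z w : V) (al : multi_index d).

Definition mon_poly y w al : {poly C} :=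
  \prod_(i < d) ((y 0 i : C)%:P + (w 0 i : C) *: 'X) ^+ al i.

Lemma mon_polyE y w al (eta : C) :
  (mon_poly y w al).[eta] = monomial al (y + eta *: w).
Proof.
rewrite horner_prod; apply: eq_bigr => i _.
rewrite horner_exp hornerD hornerC hornerZ hornerX !mxE.
by congr (_ ^+ _); rewrite [_ * eta]mulrC.
Qed.

(** The contribution of the [n]-th monomial to the [k]-th Taylor coefficient of [f]
    on the line through [y] with direction [w]. *)
Definition tcoef f y w (n k : nat) : C :=
  if (pickle_inv n : option (multi_index d)) is Some al
  then cf hH f al * (mon_poly y w al)`_k else 0.

(** On the line, each monomial is dominated by its value at the point with
    coordinates [|y_j| + s |w_j|], which is still in the domain; absolute
    convergence there gives constants that are uniform in the direction. *)
Lemma ev_tay y (rho : R) : DB y -> 0 < rho -> exists s : R, [/\ 0 < s,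
  forall w (eta : C), en w <= rho -> nc eta <= s -> DB (y + eta *: w) &
  forall f, exists M, forall w, en w <= rho -> exists2 e,
    tay (fun eta => ev f (y + eta *: w)) M s e &
    forall k, cvg_to (fun N => \sum_(n < N) tcoef f y w n k) (e k)].
Proof.
have ga := wh_generating hH.
move=> /(open_domainP ga) [t yt ht] rho0.
have zt : en y < Num.sqrt t by rewrite sqrt_lt.
have t0 : 0 <= t by apply: le_trans (ltW yt); exact: sqr_ge0.
pose s := (Num.sqrt t - en y) / (2 * rho).
have s0 : 0 < s by rewrite divr_gt0 ?subr_gt0 // mulr_gt0.
have srho : en y + s * rho < Num.sqrt t.
  have -> : s * rho = (Num.sqrt t - en y) / 2 by rewrite /s; field; rewrite gt_eqF.
  by move: zt; clear; lra.
clearbody s.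
have DBs w eta : en w <= rho -> nc eta <= s -> DB (y + eta *: w).
  move=> hw he; apply/(open_domainP ga); exists t => //; rewrite -sqrt_lt.
  apply: le_lt_trans srho; apply: (le_trans (enD _ _)); rewrite lerD2l enZ.
  by rewrite ler_pM ?nc_ge0 ?en_ge0.
have [M M0 hM] := abs_sum_unif hH ht.
exists s; split=> // f; exists (M * hn f) => w hw.
pose zt' : V := \row_j (nc (y 0 j) + s * nc (w 0 j))%:C.
have ztt : en zt' ^+ 2 <= t.
  rewrite -sqrt_le //; apply: le_trans (ltW srho).
  pose y1 : V := \row_j (nc (y 0 j))%:C; pose w1 : V := \row_j (nc (w 0 j))%:C.
  have E (v : V) : en (\row_j (nc (v 0 j))%:C : V) = en v.
    apply/eqP; rewrite -(eqrXn2 (_ : (0 < 2)%N)) ?en_ge0 // !en_sqr; apply/eqP.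
    by apply: eq_bigr => j _; rewrite mxE nc_real ger0_norm ?nc_ge0.
  have -> : zt' = y1 + s%:C *: w1 by apply/rowP => j; rewrite !mxE rcD rcM.
  apply: (le_trans (enD _ _)); rewrite enZ !E nc_real (ger0_norm (ltW s0)) lerD2l.
  by rewrite ler_wpM2l // ltW.
pose Q al : {poly R} := \prod_(i < d) ((nc (y 0 i))%:P + nc (w 0 i) *: 'X) ^+ al i.
have hdom al : dom (mon_poly y w al) (Q al).
  by apply: dom_prod => i; apply: domX; exact: dom_lin.
have Qs al : (Q al).[s] = nc (monomial al zt').
  rewrite horner_prod /monomial (big_morph (@Normc.normc R) (@ncM R) (@nc1 R)).
  apply: eq_bigr => i _.
  rewrite horner_exp hornerD hornerC hornerZ hornerX ncX mxE nc_real.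
  by rewrite ger0_norm 1?mulrC // addr_ge0 ?mulr_ge0 ?nc_ge0 // ltW.
pose T (n : nat) (eta : C) : C :=
  if (pickle_inv n : option (multi_index d)) is Some al
  then cf hH f al * (mon_poly y w al).[eta] else 0.
pose Mn (n : nat) : R :=
  if (pickle_inv n : option (multi_index d)) is Some al
  then nc (cf hH f al) * nc (monomial al zt') else 0.
have hT n : tay (T n) (Mn n) s (tcoef f y w n).
  rewrite /T /Mn /tcoef; case: pickle_inv => [al|]; last exact: tay0.
  by rewrite -Qs; apply: tay_scale; exact: tay_poly (hdom al) s0.
have hS N : tay (fun eta => \sum_(n < N) T n eta) (M * hn f) s
    (fun k => \sum_(n < N) tcoef f y w n k).
  have := @tay_sum _ _ (enum 'I_N) (fun n => T n) (fun n => Mn n) s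
    (fun n => tcoef f y w n) s0 (fun n _ => hT n).
  rewrite big_enum /= => h; have h' := tay_M_le h (hM _ ztt f N).
  have E1 : (fun eta => \sum_(n <- enum 'I_N) T n eta) = (fun eta => \sum_(n < N) T n eta).
    by apply/funext => eta; rewrite big_enum.
  have E2 : (fun k => \sum_(n <- enum 'I_N) tcoef f y w n k) =
      (fun k => \sum_(n < N) tcoef f y w n k).
    by apply/funext => eta; rewrite big_enum.
  by rewrite -E1 -E2.
have cvk k : exists l, cvg_to (fun N => \sum_(n < N) tcoef f y w n k) l.
  have sk : 0 < s ^+ k by rewrite exprn_gt0.
  apply: (@abs_cvg R (fun n => tcoef f y w n k) (M * hn f / s ^+ k)) => N.
  rewrite ler_pdivlMr // mulr_suml; apply: le_trans (hM _ ztt f N).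
  apply: ler_sum => n _; rewrite /tcoef; case: pickle_inv => [al|]; last first.
    by rewrite nc0 mul0r.
  rewrite ncM -mulrA ler_wpM2l ?nc_ge0 // -Qs.
  apply: (@le_trans _ _ ((Q al)`_k * s ^+ k)).
    by apply: ler_wpM2r; [exact: ltW|exact: hdom].
  have [kQ|kQ] := ltnP k (size (Q al)).
    rewrite horner_coef (bigD1 (Ordinal kQ)) //= lerDl sumr_ge0 // => i _.
    by apply: mulr_ge0; [exact: dom_ge0 (hdom al) _|rewrite exprn_ge0 // ltW].
  rewrite nth_default // mul0r horner_coef sumr_ge0 // => i _.
  by apply: mulr_ge0; [exact: dom_ge0 (hdom al) _|rewrite exprn_ge0 // ltW].
have /choice [e he] := cvk; exists e => //.
apply: (tay_limit s0 hS) => // eta heta e' e'0.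
have Xz : DX (y + eta *: w) by apply: (open_domain_sub ga); apply: DBs.
have [N0 hN0] := psum_ev_cvg hH f Xz e'0; exists N0 => N /hN0 /ltW.
rewrite ev_psum //; congr (nc (_ - _) <= _); apply: eq_bigr => n _.
by rewrite /T; case: pickle_inv => // al; rewrite mon_polyE.
Qed.

End TaylorOfElements.

(** * First order behaviour at the origin *)

Section AtTheOrigin.
Context {R : realType} {d : nat} {a : nat -> R}
  {H : hilbert_function_space R (@natural_domain R d a)} (hH : weighted_hardy H).
Local Notation C := R[i].
Local Notation V := 'rV[C^o]_d.
Local Notation DB := (@open_domain R d a).
Implicit Types (f g : H) (y z w : V) (al : multi_index d).

Lemma mon_poly0 w al : mon_poly 0 w al = (monomial al w)%:P * 'X^(mi_degree al).
Proof.
rewrite /mon_poly (eq_bigr (fun i => ((w 0 i : C) ^+ al i)%:P * 'X ^+ al i)).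
  by rewrite big_split /= -expr_sum -rmorph_prod.
by move=> i _; rewrite mxE add0r -mul_polyC exprMn rmorphXn.
Qed.

Lemma mon_poly0_coef w al k :
  (mon_poly 0 w al)`_k = if mi_degree al == k then monomial al w else 0.
Proof.
rewrite mon_poly0 coefCM coefXn [k == _]eq_sym.
by case: eqP; rewrite ?mulr1 ?mulr0.
Qed.

Lemma mi_degree1 al : mi_degree al = 1%N -> exists j, al = mi_delta j.
Proof.
rewrite /mi_degree => h.
have [j aj] : exists j, al j != 0%N.
  apply/existsP; apply: contraT; rewrite negb_exists => /forallP z.
  by move: h; rewrite big1 // => i _; apply/eqP; move: (z i); rewrite negbK.
exists j; apply/ffunP => i; rewrite ffunE.
move: h; rewrite (bigD1 j) //=.
have [->|ij] := eqVneq i j; first by move: (\sum_(_ | _) _)%N aj => m; lia.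
rewrite (bigD1 i) //=; move: (\sum_(_ | _) _)%N aj => m; lia.
Qed.

(** The Taylor coefficient of order 1 in the direction [w] is linear in [w], since
    only the monomials of degree 1 contribute to it. *)
Lemma ev_diff0 : exists2 s : R, 0 < s & forall f, exists (l : 'I_d -> C) (M : R),
  0 <= M /\ forall z, en z <= s -> DB z /\
    nc (ev f z - ev f 0 - \sum_j z 0 j * l j) <= M * en z ^+ 2.
Proof.
have [s [s0 hDB htay]] := ev_tay hH (open_domain0 (wh_generating hH)) ltr01.
exists s => // f; have [M hM] := htay f.
pose ej (j : 'I_d) : V := delta_mx 0 j.
have nej j : en (ej j) <= 1.
  rewrite -(ler_pXn2r (_ : (0 < 2)%N)) ?nnegrE ?en_ge0 // en_sqr expr1n.
  rewrite (bigD1 j) //= big1 ?addr0 => [|i ij].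
    by rewrite mxE !eqxx nc1 expr1n.
  by rewrite mxE (negPf ij) andbF nc0 expr0n.
have /choice [E hE] : forall j, exists e, [/\ tay (fun eta => ev f (0 + eta *: ej j)) M s e &
    forall k, cvg_to (fun N => \sum_(n < N) tcoef hH f 0 (ej j) n k) (e k)].
  by move=> j; have [e h1 h2] := hM _ (nej j); exists e.
have M0 : 0 <= M.
  have h01 : en (0 : V) <= 1 by rewrite en0.
  by have [e h _] := hM 0 h01; exact: tay_M_ge0 h.
exists (fun j => E j 1%N), (M / s ^+ 2); split.
  by rewrite divr_ge0 // exprn_ge0 // ltW.
move=> z zs; have [->|z0] := eqVneq z 0.
  split; first exact: (open_domain0 (wh_generating hH)).
  rewrite subrr sub0r ncN big1 ?nc0 => [|j _]; last by rewrite mxE mul0r.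
  by rewrite en0 expr0n mulr0.
have nz := en_gt0 z0.
pose w : V := (en z)^-1%:C *: z.
have nw : en w <= 1.
  by rewrite enZ nc_real ger0_norm ?invr_ge0 ?en_ge0 // mulVf // gt_eqF.
have zw : z = (en z)%:C *: w.
  by rewrite scalerA -rcM divff ?gt_eqF // scale1r.
have ncz : nc (en z)%:C = en z by rewrite nc_real ger0_norm // en_ge0.
split; first by rewrite zw -[X in DB X]add0r; apply: hDB; rewrite ?ncz.
have [e he hc] := hM w nw.
have e1 : e 1%N = \sum_j w 0 j * E j 1%N.
  apply: (cvg_to_uniq (hc 1%N)).
  have := cvg_to_sum (index_enum 'I_d) (fun j => w 0 j : C) (fun j => (hE j).2 1%N).
  rewrite (eq_bigr (fun j => w 0 j * E j 1%N)); last by move=> j _; rewrite mulrC.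
  move=> h e' e'0; have [N0 hN] := h e' e'0; exists N0 => N /hN.
  congr (nc (_ - _) <= _).
  rewrite (eq_bigr (fun j => \sum_(n < N) tcoef hH f 0 (ej j) n 1 * w 0 j)); last first.
    by move=> j _; rewrite mulr_suml.
  rewrite exchange_big /=; apply: eq_bigr => n _; rewrite /tcoef.
  case: pickle_inv => [al|]; last by rewrite big1 // => j _; rewrite mul0r.
  rewrite mon_poly0_coef; have [dal|dal] := eqVneq (mi_degree al) 1%N; last first.
    by rewrite mulr0 big1 // => j _; rewrite mon_poly0_coef (negPf dal) mulr0 mul0r.
  have [j0 alE] := mi_degree1 dal; subst al.
  rewrite monomial_delta (bigD1 j0) //= big1 ?addr0 => [|j jj].
    by rewrite mon_poly0_coef dal eqxx monomial_delta mxE !eqxx mulr1.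
  rewrite mon_poly0_coef dal eqxx monomial_delta mxE [j0 == j]eq_sym (negPf jj).
  by rewrite andbF mulr0 mul0r.
have [_ /(_ 2%N (en z)%:C)] := he; rewrite ncz => /(_ zs).
rewrite add0r -zw !big_ord_recr big_ord0 /= add0r expr0 mulr1 expr1.
have <- : ev f 0 = e 0%N by rewrite -(tay_at0 he) scale0r addr0.
rewrite e1 mulr_suml opprD addrA expr_div_n mulrA mulrAC.
congr (nc (_ - _) <= _); apply: eq_bigr => j _.
have -> : z 0 j = (en z)%:C * w 0 j by rewrite {1}zw [LHS]mxE.
by rewrite mulrC mulrA.
Qed.

End AtTheOrigin.

(** * Powers of the first coordinate, continuity and unitary invariance *)

Section Axis.
Context {R : realType} {d : nat} {a : nat -> R}
  {H : hilbert_function_space R (@natural_domain R d.+1 a)} (hH : weighted_hardy H).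
Local Notation C := R[i].
Local Notation V := 'rV[C^o]_d.+1.
Local Notation DX := (@natural_domain R d.+1 a).
Implicit Types (f g : H) (y z w : V).

Definition e0 : V := delta_mx 0 0.

Lemma en_e0 : en e0 = 1.
Proof.
apply/eqP; rewrite -(eqrXn2 (_ : (0 < 2)%N)) ?en_ge0 // en_sqr expr1n.
rewrite (bigD1 0) //= big1 ?addr0 => [|i ij].
  by rewrite mxE !eqxx nc1 expr1n.
by rewrite mxE (negPf ij) andbF nc0 expr0n.
Qed.

Definition axis (n : nat) : multi_index d.+1 := [ffun i => if i == 0 then n else 0%N].

Lemma monomial_axis n z : monomial (axis n) z = z 0 0 ^+ n.
Proof.
rewrite /monomial (bigD1 0) //= big1 => [|i ij]; first by rewrite ffunE eqxx mulr1.
by rewrite ffunE (negPf ij) expr0.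
Qed.

Lemma axis_inj : injective axis.
Proof. by move=> n m /ffunP /(_ 0); rewrite !ffunE eqxx. Qed.

Lemma mon_poly_axis al k : (mon_poly 0 e0 al)`_k = (al == axis k)%:R.
Proof.
rewrite mon_poly0_coef; case: eqP => [deg|deg]; last first.
  case: eqP => // ak; case: deg; rewrite ak /mi_degree (bigD1 0) //= big1.
    by rewrite ffunE eqxx addn0.
  by move=> i ij; rewrite ffunE (negPf ij).
have [->|ak] := eqVneq al (axis k).
  by rewrite monomial_axis mxE !eqxx expr1n.
have [i [i0 ai]] : exists i, i != 0 /\ al i != 0%N.
  apply: contrapT => /forallNP h; move/eqP: ak; apply; apply/ffunP => i.
  have z j : j != 0 -> al j = 0%N.
    move=> j0; apply/eqP; apply: contrapT => aj; apply: (h j); split=> //.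
    exact/negP.
  rewrite ffunE; case: eqP => [->|/eqP /z //].
  by rewrite -deg /mi_degree (bigD1 0) //= big1 ?addn0 // => j /z.
rewrite /monomial (bigD1 i) //= mxE (negPf i0) andbF expr0n.
by rewrite (negPf ai) mul0r.
Qed.

Lemma axis_tay f : exists M s, tay (fun eta => ev f (eta *: e0)) M s
  (fun k => cf hH f (axis k)).
Proof.
have [s [s0 _ /(_ f) [M hM]]] := ev_tay hH (open_domain0 (wh_generating hH)) ltr01.
have le1 : en e0 <= 1 by rewrite en_e0.
have [e he hc] := hM e0 le1; exists M, s.
have -> : (fun k => cf hH f (axis k)) = e.
  apply/funext => k; symmetry; apply: (cvg_to_uniq (hc k)).
  apply: (@cvg_to_cst _ _ _ (pickle (axis k)).+1) => N hN.
  rewrite (bigD1 (Ordinal hN)) //= big1 ?addr0 => [|n nk].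
    by rewrite /tcoef pickleK_inv mon_poly_axis eqxx mulr1.
  rewrite /tcoef; case E : (pickle_inv n) => [al|] //.
  rewrite mon_poly_axis; case: eqP => [ak|_]; last by rewrite mulr0.
  by move: nk; rewrite -val_eqE /= -(pickle_invE E) ak eqxx.
by apply: (tay_ext he) => eta _; rewrite add0r.
Qed.

(** The Taylor coefficient of order [n] of the kernel at [r e0], along the first
    axis, is [a n * r ^ n] by its expansion and [r ^ n / |z_0^n|^2] by the
    reproducing property. *)
Lemma mon_axis_norm n : hn (mon hH (axis n)) ^+ 2 = (a n)^-1.
Proof.
have ga := wh_generating hH; have a0 := generating_ge0 ga.
have := open_domain0 ga (d := d.+1); move=> /(open_domainP ga) [t].
rewrite en0 expr0n /= => t0 ht; pose r := Num.sqrt t.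
have r0 : 0 < r by rewrite sqrtr_gt0.
have rt : r ^+ 2 = t by rewrite sqr_sqrtr // ltW.
have ncr : nc r%:C = r by rewrite nc_real ger0_norm // ltW.
clearbody r; pose w : V := r%:C *: e0.
have nw : en w = r by rewrite enZ en_e0 mulr1.
have Xw : DX w by apply/(natural_domainP ga); rewrite nw rt.
have [k hk hser] := kernelP hH Xw.
have [M [s hs]] := axis_tay k.
have cfk : cf hH k (axis n) = r%:C ^+ n / (hn (mon hH (axis n)) ^+ 2)%:C.
  rewrite /cf hn_dot; congr (_ / _); rewrite formC -hk mon_ev // monomial_axis.
  by rewrite !mxE !eqxx mulr1 -rcX conjc_real.
have [C0 hC] := ht.
(* the kernel at [r e0] is the sum of the [a j (r eta)^j] on the axis *)
have hs' : tay (fun eta => ev k (eta *: e0)) C0 r (fun j => (a j)%:C * r%:C ^+ j).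
  pose P N : {poly C} := \poly_(j < N) ((a j)%:C * r%:C ^+ j).
  pose Q N : {poly R} := \poly_(j < N) (a j * r ^+ j).
  have dPQ N : dom (P N) (Q N).
    move=> j; rewrite !coef_poly; case: ifP => _; last by rewrite nc0.
    by rewrite ncM ncX ncr nc_real ger0_norm.
  have QC N : (Q N).[r] <= C0.
    apply: le_trans (hC N); rewrite horner_poly; apply: ler_sum => j _.
    by rewrite -mulrA -exprD -rt -exprM addnn mul2n.
  apply: (@tay_limit _ _ _ _ _ (fun N eta => (P N).[eta]) (fun N j => (P N)`_j)) => //.
  - by move=> N; apply: (tay_M_le (tay_poly (dPQ N) r0)).
  - move=> eta he e e0'.
    have Xe : DX (eta *: e0).
      by apply: (domain_le ga _ Xw); rewrite enZ en_e0 mulr1 nw.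
    have [N0 hN0] := hser _ Xe e e0'; exists N0 => N /hN0 /ltW.
    congr (nc (_ - _) <= _); rewrite horner_poly; apply: eq_bigr => j _.
    rewrite cdotZl cdotZr cdotzz en_e0 expr1n conjc_real.
    have -> : eta * (r%:C * 1%:C) = r%:C * eta by rewrite mulr1 mulrC.
    by rewrite exprMn mulrA.
  - by move=> j; apply: (@cvg_to_cst _ _ _ j.+1) => N hN; rewrite coef_poly hN.
have := tay_uniq hs hs' n; rewrite cfk -rcX -rcM.
have hp : 0 < hn (mon hH (axis n)) ^+ 2.
  rewrite exprn_gt0 // lt_neqAle hn_ge0 andbT eq_sym; apply/eqP => /hn_eq0 /eqP.
  by rewrite (negPf (mon_neq0 _ _)).
have rn : r ^+ n != 0 by rewrite expf_neq0 // gt_eqF.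
have -> : (r ^+ n)%:C / (hn (mon hH (axis n)) ^+ 2)%:C =
  (r ^+ n / (hn (mon hH (axis n)) ^+ 2))%:C.
  by rewrite (rcM (r ^+ n)); congr (_ * _); symmetry; exact: fmorphV.
move=> /complexI; rewrite mulrC => /(mulIf rn) <-.
by rewrite invrK.
Qed.

End Axis.

Section ContinuityAndUnitaries.
Context {R : realType} {d : nat} {a : nat -> R}
  {H : hilbert_function_space R (@natural_domain R d a)} (hH : weighted_hardy H).
Local Notation C := R[i].
Local Notation V := 'rV[C^o]_d.
Local Notation DX := (@natural_domain R d a).
Implicit Types (f g : H) (y z w : V).

Lemma ev_cont f z (e : R) : DX z -> 0 < e -> exists2 delta : R, 0 < delta &
  forall w, DX w -> en (w - z) < delta -> nc (ev f w - ev f z) < e.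
Proof.
move=> Xz e0; have [F [hF cF _]] := wh_holomorphic hH f.
have evF w : DX w -> ev f w = F w.
  by move=> /domain_val [x <-]; rewrite evE hF.
have /subspace_continuousP /(_ z Xz) /cvgrPdist_lt /(_ e%:C) := cF.
rewrite ltcR => /(_ e0); rewrite near_withinE => /nbhs_ballP [eps /= eps0 heps].
exists (complex.Re eps).
  by move: eps0; rewrite ltcE => /andP[].
move=> w Xw hw; rewrite !evF // nc_dist -ltcR -ncE; apply: heps => //.
split=> // i j; rewrite /ball /= ord1.
have epsE : eps = (complex.Re eps)%:C.
  by move: eps0; rewrite ltcE => /andP[/eqP]; case: (eps) => x y /= -> _.
rewrite epsE ncE ltcR; apply: le_lt_trans hw.
by have := nc_le_en (w - z) j; rewrite !mxE nc_dist.
Qed.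

(** Let [D] consist of the [g] whose composite with [U] exists in the space and is
    compatible with inner products.  It contains the kernels, because
    [<w U, z> = <w, z U^*>], so it is dense; the composition is isometric on
    [D] and extends by completeness. *)
Lemma unitary_comp (U : 'M[C]_d) : U \is unitarymx -> exists W : H -> H,
  (forall f z, DX z -> ev (W f) z = ev f (z *m U : V)) /\ (forall f, hn (W f) = hn f).
Proof.
move=> uU; have ga := wh_generating hH.
have XU z : DX z -> DX (z *m U : V).
  by move=> Xz; apply: (domain_le ga _ Xz); rewrite en_unitaryE.
have uU' : (U^t*)%sesqui \is unitarymx by rewrite trmxC_unitary.
have XU' z : DX z -> DX (z *m (U^t*)%sesqui : V).
  by move=> Xz; apply: (domain_le ga _ Xz); rewrite en_unitaryE.
have UU' z : (z *m U *m (U^t*)%sesqui : V) = z.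
  by rewrite -mulmxA (unitarymxP uU) mulmx1.
have U'U z : (z *m (U^t*)%sesqui *m U : V) = z.
  have := unitarymxP uU'; rewrite trmxCK => h.
  by rewrite -mulmxA h mulmx1.
pose rel f f' := forall z, DX z -> ev f' z = ev f (z *m U : V).
pose D g := exists2 g', rel g g' &
  forall f f', rel f f' -> hfs_dot H f g = hfs_dot H f' g'.
have relB f f' g g' : rel f f' -> rel g g' -> rel (f - g) (f' - g').
  by move=> h h' z Xz; rewrite !evB h // h'.
have D0 : D 0 by exists 0 => [z _|f f' _]; rewrite ?ev0 // !linear0r.
have Dlin (c : C) g h : D g -> D h -> D (c *: g + h).
  move=> [g' r1 h1] [k' r2 h2]; exists (c *: g' + k') => [z Xz|f f' r].
    by rewrite !evD !evZ r1 // r2.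
  by rewrite !formDr !formZr (h1 _ _ r) (h2 _ _ r).
(* [D] contains the kernels *)
have DX' f : (forall g, D g -> hfs_dot H f g = 0) -> f = 0.
  move=> h; apply: ev_inj => z Xz; rewrite ev0.
  have [k hk hser] := kernelP hH Xz; rewrite hk; apply: h.
  have [k' hk' hser'] := kernelP hH (XU' z Xz); exists k' => [w Xw|g g' r].
    have E : cdot w (z *m (U^t*)%sesqui : V) = cdot (w *m U : V) z.
      by rewrite -(en_unitary _ _ uU) U'U.
    apply: (@cvg_to_uniq _ (fun n => \sum_(j < n) (a j)%:C * cdot (w *m U : V) z ^+ j)).
      move=> e e0; have := hser' w Xw e e0; rewrite E => -[N0 hN].
      by exists N0 => N hNN; apply/ltW/hN.
    move=> e e0; have [N0 hN] := hser _ (XU w Xw) e e0.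
    by exists N0 => N hNN; apply/ltW/hN.
  by rewrite -hk -hk' r ?U'U //; exact: XU'.
have Dnorm g g' : D g -> rel g g' -> hn g' = hn g.
  move=> [g2 r2 h2] r; have -> : g' = g2.
    by apply: ev_inj => z Xz; rewrite r // r2.
  apply/eqP; rewrite -(eqrXn2 (_ : (0 < 2)%N)) ?hn_ge0 //; apply/eqP.
  by apply: complexI; rewrite -!hn_dot -(h2 _ _ r2).
have main f : exists f', rel f f' /\ hn f' = hn f.
  have /choice [u hu] : forall n : nat, exists gg : H * H,
      [/\ D gg.1, rel gg.1 gg.2 & hn (f - gg.1) < n.+1%:R^-1].
    move=> n; have n0 : 0 < n.+1%:R^-1 :> R by rewrite invr_gt0.
    have [g Dg hg] := hfs_dense D0 Dlin DX' f n0.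
    by have [g' r _] := Dg; exists (g, g').
  have inv_small (t : R) : 0 < t -> exists N : nat, forall n, (N <= n)%N -> n.+1%:R^-1 < t.
    move=> t0; exists (Num.truncn t^-1).+1 => n hn'.
    rewrite invf_plt ?posrE //; apply: (lt_le_trans (truncnS_gt _)).
    by rewrite ler_nat; apply: leq_trans hn' _.
  have close (t : R) : 0 < t -> exists N : nat, forall n, (N <= n)%N -> hn (f - (u n).1) < t.
    move=> t0; have [N hN] := inv_small t t0; exists N => n /hN.
    by have [_ _] := hu n; exact: lt_trans.
  have diff n m : hn ((u n).2 - (u m).2) = hn ((u n).1 - (u m).1).
    have [D1 r1 _] := hu n; have [D2 r2 _] := hu m.
    apply: Dnorm; last exact: relB.
    by rewrite addrC -scaleN1r; apply: Dlin.
  have [l hl] : exists l : H, forall e : R, 0 < e -> exists N : nat,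
      forall n : nat, (N <= n)%N -> hn ((u n).2 - l) < e.
    apply: hn_complete => e e0; have e2 : 0 < e / 2 by rewrite divr_gt0.
    have [N hN] := close _ e2; exists N => m n hm hn'; rewrite diff.
    apply: (le_lt_trans (hn_tri _ f _)); rewrite [ltRHS]splitr; apply: ltrD.
      by rewrite hn_dist; exact: hN.
    exact: hN.
  exists l; split=> [z Xz|].
    apply/eqP; rewrite -subr_eq0; apply/eqP; apply: nc_small0 => e e0.
    have [M1 M10 hM1] := ev_bounded (H := H) z.
    have [M2 M20 hM2] := ev_bounded (H := H) (z *m U : V).
    have e1 : 0 < e / (M1 + M2 + 1) by rewrite divr_gt0 // ltr_wpDl // addr_ge0.
    have [N1 h1] := hl _ e1; have [N2 h2] := close _ e1.
    pose n := maxn N1 N2; have g1 := h1 n (leq_maxl _ _); have g2 := h2 n (leq_maxr _ _).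
    have [_ r _] := hu n.
    have -> : ev l z - ev f (z *m U : V) =
        ev (l - (u n).2) z - ev (f - (u n).1) (z *m U : V).
      by rewrite !evB r //; ring.
    apply: (le_trans (ncB _ _)).
    apply: (@le_trans _ _ (M1 * (e / (M1 + M2 + 1)) + M2 * (e / (M1 + M2 + 1)))).
      apply: lerD.
        by apply: (le_trans (hM1 _)); rewrite ler_wpM2l // hn_dist ltW.
      by apply: (le_trans (hM2 _)); rewrite ler_wpM2l // ltW.
    rewrite -mulrDl mulrA ler_pdivrMr ?ltr_wpDl ?addr_ge0 //.
    by rewrite mulrC ler_wpM2l ?(ltW e0) // lerDl.
  apply/eqP; rewrite eq_le; apply/andP; split; apply/ler_addgt0Pl => e e0;
    (have e2 : 0 < e / 2 by rewrite divr_gt0);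
    have [N1 h1] := hl _ e2; have [N2 h2] := close _ e2;
    pose n := maxn N1 N2; have g1 := h1 n (leq_maxl _ _);
    have g2 := h2 n (leq_maxr _ _); have [D1 r1 _] := hu n;
    have nn := Dnorm _ _ D1 r1.
  - have := hnB (u n).2 ((u n).2 - l); rewrite subKr nn.
    have := hnB f (f - (u n).1); rewrite subKr.
    move: g1 g2; clear; lra.
  - have := hnD (f - (u n).1) (u n).1; rewrite subrK -nn.
    have := hnD ((u n).2 - l) l; rewrite subrK.
    move: g1 g2; clear; lra.
have /choice [W hW] := main; exists W; split=> f *; last by case: (hW f).
by have [r _] := hW f; exact: r.
Qed.

End ContinuityAndUnitaries.

(** * Weighted composition operators *)

Section Wco.
Context {R : realType}.
Local Notation C := R[i].

(** The symbols act on the ambient spaces.  The bounded inverse is the one given by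
    [wco_inverse]; requiring it makes the notion stable under inversion. *)
Definition wco {d1 d2 : nat} {a b : nat -> R}
    {H1 : hilbert_function_space R (@natural_domain R d1 a)}
    {H2 : hilbert_function_space R (@natural_domain R d2 b)}
    (lam : 'rV[C^o]_d1 -> C) (phi : 'rV[C^o]_d1 -> 'rV[C^o]_d2) (W : H2 -> H1) :=
  [/\ forall z, natural_domain a z -> natural_domain b (phi z),
      forall f z, natural_domain a z -> ev (W f) z = lam z * ev f (phi z),
      exists M : R, forall f, hn (W f) <= M * hn f &
      exists S : H1 -> H2, [/\ cancel W S, cancel S W,
        forall (c : C) f g, S (c *: f + g) = c *: S f + S g &
        exists M : R, forall f, hn (S f) <= M * hn f]].

Section Two.
Context {d1 d2 : nat} {a b : nat -> R}
    {H1 : hilbert_function_space R (@natural_domain R d1 a)}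
    {H2 : hilbert_function_space R (@natural_domain R d2 b)}
    (hH1 : weighted_hardy H1) (hH2 : weighted_hardy H2).
Local Notation V1 := 'rV[C^o]_d1.
Local Notation V2 := 'rV[C^o]_d2.

Lemma wco_of_weakly_related : weakly_related H1 H2 ->
  exists lam phi (W : H2 -> H1), wco lam phi W.
Proof.
move=> [lam [phi [W hW]]].
pose ins (z : V1) : option (@natural_domain R d1 a) := insub z.
exists (fun z => oapp lam 0 (ins z)), (fun z => oapp (fun x => \val (phi x)) 0 (ins z)), W.
have [W1 [M hM] _] := hW.
have insE (x : @natural_domain R d1 a) : ins (\val x) = Some x by rewrite /ins valK.
split.
- by move=> _ /domain_val [x <-]; rewrite insE /=; exact: val_domain.
- by move=> f _ /domain_val [x <-]; rewrite insE /= !evE; exact: W1.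
- by exists M => f; rewrite hn.unlock.
apply: wco_inverse hW => x; have [k hk _] := kernelP hH2 (val_domain x).
by exists k => f; rewrite -evE.
Qed.

Context {lam : V1 -> C} {phi : V1 -> V2} {W : H2 -> H1} (hW : wco lam phi W).

Lemma wco_lin (c : C) f g : W (c *: f + g) = c *: W f + W g.
Proof.
have [X h _ _] := hW; apply: ev_inj => z Xz.
by rewrite !(h, evD, evZ) //; ring.
Qed.

Lemma wco_dom z : natural_domain a z -> natural_domain b (phi z).
Proof. by case: hW => h _ _ _; exact: h. Qed.

Lemma wco_ev f z : natural_domain a z -> ev (W f) z = lam z * ev f (phi z).
Proof. by case: hW => _ h _ _; exact: h. Qed.

Lemma wco_neq0 z : natural_domain a z -> lam z != 0.
Proof.
move=> Xz; have [_ _ _ [S [_ SW _ _]]] := hW.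
have := ev_one hH1 Xz; rewrite -(SW (one hH1)) wco_ev //.
by apply: contra_eq_neq => ->; rewrite mul0r eq_sym oner_eq0.
Qed.

Lemma wco_lamE z : natural_domain a z -> lam z = ev (W (one hH2)) z.
Proof. by move=> Xz; rewrite wco_ev // ev_one ?mulr1 //; exact: wco_dom. Qed.

Lemma wco_phiE z j : natural_domain a z ->
  ev (W (crd hH2 j)) z = lam z * phi z 0 j.
Proof. by move=> Xz; rewrite wco_ev // ev_crd //; exact: wco_dom. Qed.

(** As [W] is onto, [f z * lam z' = f z' * lam z] for all elements [f] of [H1];
    take for [f] the constant 1 and the coordinates. *)
Lemma wco_inj z z' : natural_domain a z -> natural_domain a z' ->
  phi z = phi z' -> z = z'.
Proof.
move=> Xz Xz' e; have [_ _ _ [S [_ SW _ _]]] := hW.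
have h (f : H1) : ev f z * lam z' = ev f z' * lam z.
  by rewrite -(SW f) !wco_ev // e; ring.
have el : lam z' = lam z by have := h (one hH1); rewrite !ev_one // !mul1r.
apply/rowP => j; have := h (crd hH1 j); rewrite !ev_crd // el.
by move/(mulIf (wco_neq0 Xz)).
Qed.

(** The maximum principle applied to [lam] and [lam * phi] makes [phi] constant on a
    piece of the line through [y], contrary to injectivity. *)
Lemma wco_no_max y w (delta : R) : open_domain a y -> w != 0 -> 0 < delta ->
  (forall eta, nc eta < delta -> natural_domain a (y + eta *: w) ->
     en (phi (y + eta *: w)) <= en (phi y)) -> False.
Proof.
move=> By w0 del0 hmax; have ga := wh_generating hH1.
have nw := en_gt0 w0.
have [s [s0 hDB htay]] := ev_tay hH1 By nw.
have hD e : nc e <= s -> natural_domain a (y + e *: w).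
  by move=> he; apply: (open_domain_sub ga); exact: hDB.
have /choice [Mu hMu] : forall j, exists M, exists e,
    tay (fun eta => ev (W (crd hH2 j)) (y + eta *: w)) M s e.
  move=> j; have [M hM] := htay (W (crd hH2 j)).
  by have [e he _] := hM w (lexx _); exists M, e.
have /choice [cu hcu] := hMu.
have [N hN] := htay (W (one hH2)); have [e he _] := hN w (lexx _).
have Xy : natural_domain a y by exact: open_domain_sub.
have Dl eta : nc eta <= s -> ev (W (one hH2)) (y + eta *: w) = lam (y + eta *: w).
  by move=> h; rewrite -(wco_lamE (hD _ h)).
have nc00 : nc (0 : C) <= s by rewrite nc0 ltW.
have y0 : y + (0 : C) *: w = y by rewrite scale0r addr0.
have m0 : 0 < Num.min delta s by rewrite lt_min del0.
have sumE eta : nc eta <= s ->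
    \sum_j nc (ev (W (crd hH2 j)) (y + eta *: w)) ^+ 2 =
    en (phi (y + eta *: w)) ^+ 2 * nc (lam (y + eta *: w)) ^+ 2.
  move=> h; rewrite en_sqr mulr_suml; apply: eq_bigr => j _.
  by rewrite (wco_phiE j (hD _ h)) ncM exprMn mulrC.
have D0 : ev (W (one hH2)) (y + (0 : C) *: w) != 0 by rewrite Dl //; exact: (wco_neq0 (hD _ nc00)).
have [||delta' d'0 hd'] := tay_max_vec hcu he D0 (en_ge0 (phi y)) m0.
- move=> eta; rewrite lt_min => /andP[h1 /ltW h2].
  rewrite sumE // Dl //; apply: ler_wpM2r; first exact: sqr_ge0.
  apply: lerXn2r; rewrite ?nnegrE ?en_ge0 //; apply: hmax => //; exact: hD.
- by rewrite sumE // Dl // y0.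
pose t := Num.min (delta' / 2) s.
have t0 : 0 < t by rewrite lt_min divr_gt0.
have nt : nc t%:C = t by rewrite nc_real ger0_norm // ltW.
have ts : nc t%:C <= s by rewrite nt ge_min lexx orbT.
have td : nc t%:C < delta'.
  rewrite nt; apply: (@le_lt_trans _ _ (delta' / 2)); first by rewrite ge_min lexx.
  by rewrite ltr_pdivrMr // ltr_pMr // ltr1n.
have same : phi (y + t%:C *: w) = phi y.
  apply/rowP => j; have := hd' _ td j.
  rewrite (wco_phiE j (hD _ ts)) (wco_phiE j (hD _ nc00)) !Dl // y0.
  have l1 := wco_neq0 (hD _ ts); have l2 := wco_neq0 Xy.
  have l12 : lam (y + t%:C *: w) * lam y != 0 by rewrite mulf_neq0.
  move=> h; apply: (mulfI l12); rewrite mulrAC h mulrAC.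
  by congr (_ * _); exact: mulrC.
have := wco_inj (hD _ ts) Xy same.
rewrite -[RHS]addr0 => /addrI /eqP; rewrite scaler_eq0 (negPf w0) orbF rc_eq0.
by rewrite gt_eqF.
Qed.

End Two.

(** Otherwise [phi 0] has the largest norm of all points of the target domain. *)
Lemma wco_center {d1 d2 : nat} {a b : nat -> R}
    {H1 : hilbert_function_space R (@natural_domain R d1.+1 a)}
    {H2 : hilbert_function_space R (@natural_domain R d2 b)}
    (hH1 : weighted_hardy H1) (hH2 : weighted_hardy H2)
    lam phi (W : H2 -> H1) : wco lam phi W -> open_domain b (phi 0).
Proof.
move=> hW; apply: contrapT => nB; have ga := wh_generating hH1.
have e00 : (e0 : 'rV[C^o]_d1.+1) != 0.
  by apply/eqP => h; have := en_e0 (R := R) (d := d1); rewrite h en0 => /eqP; rewrite eq_sym oner_eq0.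
apply: (wco_no_max hH1 hH2 hW (open_domain0 ga) e00 ltr01) => eta _ Xe.
apply: (not_open_domain (wh_generating hH2) nB); exact: (wco_dom hW Xe).
Qed.

Lemma wco_comp {d1 d2 d3 : nat} {a b c : nat -> R}
    {H1 : hilbert_function_space R (@natural_domain R d1 a)}
    {H2 : hilbert_function_space R (@natural_domain R d2 b)}
    {H3 : hilbert_function_space R (@natural_domain R d3 c)}
    lam1 phi1 (W1 : H2 -> H1) lam2 phi2 (W2 : H3 -> H2) :
  wco lam1 phi1 W1 -> wco lam2 phi2 W2 ->
  wco (fun z => lam1 z * lam2 (phi1 z)) (phi2 \o phi1) (W1 \o W2).
Proof.
move=> [X1 e1 [M1 h1] [S1 [w1 s1 l1 [N1 n1]]]] [X2 e2 [M2 h2] [S2 [w2 s2 l2 [N2 n2]]]].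
have bound (k k' x y z : R) : 0 <= y -> y <= k' * z -> x <= k * y -> x <= `|k| * k' * z.
  move=> y0 hy hx; apply: (le_trans hx).
  apply: (@le_trans _ _ (`|k| * y)); first by rewrite ler_wpM2r // ler_norm.
  by rewrite -mulrA ler_wpM2l.
split.
- by move=> z /X1 /X2.
- by move=> f z Xz; rewrite /= e1 // e2 ?mulrA //; exact: X1.
- exists (`|M1| * M2) => f /=; exact: bound (hn_ge0 _) (h2 f) (h1 _).
exists (S2 \o S1); split.
- exact: can_comp.
- exact: can_comp.
- by move=> k f g /=; rewrite l1 l2.
- exists (`|N2| * N1) => f /=; exact: bound (hn_ge0 _) (n1 f) (n2 _).
Qed.

Lemma wco_inv {d1 d2 : nat} {a b : nat -> R}
    {H1 : hilbert_function_space R (@natural_domain R d1 a)}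
    {H2 : hilbert_function_space R (@natural_domain R d2 b)}
    (hH1 : weighted_hardy H1) lam phi (W : H2 -> H1) theta : wco lam phi W ->
  (forall y, natural_domain b y -> natural_domain a (theta y) /\ phi (theta y) = y) ->
  exists (mu : 'rV[C^o]_d2 -> C) (S : H1 -> H2), wco mu theta S.
Proof.
move=> hW ht; have [X1 e1 [M1 h1] [S [w1 s1 l1 [N1 n1]]]] := hW.
exists (fun y => (lam (theta y))^-1), S; split.
- by move=> y /ht [].
- move=> f y /ht [Xt pt]; rewrite -{2}(s1 f) e1 // pt mulrA mulVf ?mul1r //.
  exact: (wco_neq0 hH1 hW).
- by exists N1.
exists W; split=> //; [exact: (wco_lin hW)|by exists M1].
Qed.

Lemma wco_unitary {d : nat} {a : nat -> R}
    {H : hilbert_function_space R (@natural_domain R d a)} (hH : weighted_hardy H)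
    (U : 'M[C]_d) : U \is unitarymx ->
  exists W : H -> H, wco (fun=> 1) (fun z => z *m U) W.
Proof.
move=> uU; have ga := wh_generating hH.
have uU' : (U^t*)%sesqui \is unitarymx by rewrite trmxC_unitary.
have XU (M : 'M[C]_d) (z : 'rV[C^o]_d) : M \is unitarymx ->
    natural_domain a z -> natural_domain a (z *m M : 'rV[C^o]_d).
  by move=> uM Xz; apply: (domain_le ga _ Xz); rewrite en_unitaryE.
have [W [Wev Wn]] := unitary_comp hH uU; have [S [Sev Sn]] := unitary_comp hH uU'.
exists W; split.
- by move=> z; exact: XU.
- by move=> f z Xz; rewrite mul1r Wev.
- by exists 1 => f; rewrite mul1r Wn.
exists S; split.
- move=> f; apply: ev_inj => z Xz; rewrite Sev // Wev; last exact: XU.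
  have := unitarymxP uU'; rewrite trmxCK => h.
  by rewrite -mulmxA h mulmx1.
- move=> f; apply: ev_inj => z Xz; rewrite Wev // Sev; last exact: XU.
  by rewrite -mulmxA (unitarymxP uU) mulmx1.
- move=> c f g; apply: ev_inj => z Xz; rewrite !evD !evZ !Sev //.
  by rewrite evD evZ.
- by exists 1 => f; rewrite mul1r Sn.
Qed.

End Wco.

(** * The derivative of a symbol at the origin *)

Section WcoDiff.
Context {R : realType} {d1 d2 : nat} {a b : nat -> R}
    {H1 : hilbert_function_space R (@natural_domain R d1 a)}
    {H2 : hilbert_function_space R (@natural_domain R d2 b)}
    (hH1 : weighted_hardy H1) (hH2 : weighted_hardy H2).
Local Notation C := R[i].

Lemma nc_lin (l : 'I_d1 -> C) (z : 'rV[C^o]_d1) :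
  nc (\sum_i z 0 i * l i) <= (\sum_i nc (l i)) * en z.
Proof.
apply: (le_trans (nc_sum _ _ _)); rewrite mulr_suml; apply: ler_sum => i _.
by rewrite ncM mulrC ler_wpM2l ?nc_ge0 // nc_le_en.
Qed.

(** The coordinates of [phi] are quotients of [lam * phi], the images of the
    coordinate functions, by [lam], the image of 1; all of them are
    differentiable at 0 by [ev_diff0]. *)
Lemma wco_diff lam phi (W : H2 -> H1) : wco lam phi W ->
  exists (A : 'M[C]_(d1, d2)) (s K : R), [/\ 0 < s, 0 <= K &
    forall z : 'rV[C^o]_d1, en z <= s -> natural_domain a z /\
      en (phi z - phi 0 - (z *m A : 'rV[C^o]_d2)) <= K * en z ^+ 2].
Proof.
move=> hW; have ga := wh_generating hH1.
have X0 := open_domain_sub ga (open_domain0 ga (d := d1)).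
have [s s0 hs] := ev_diff0 hH1.
have [l0 [M0 [M00 h0]]] := hs (W (one hH2)).
have /choice [lM hlM] : forall j, exists lM : ('I_d1 -> C) * R, 0 <= lM.2 /\
    forall z, en z <= s -> natural_domain a z /\
    nc (ev (W (crd hH2 j)) z - ev (W (crd hH2 j)) 0 - \sum_i z 0 i * lM.1 i)
      <= lM.2 * en z ^+ 2.
  move=> j; have [l [M [hM h]]] := hs (W (crd hH2 j)); exists (l, M); split=> //.
  by move=> z /h [/(open_domain_sub ga)].
pose l j := (lM j).1; pose M j := (lM j).2.
have Mge0 j : 0 <= M j by case: (hlM j).
have hM j z : en z <= s -> nc (lam z * phi z 0 j - lam 0 * phi 0 0 j -
    \sum_i z 0 i * l j i) <= M j * en z ^+ 2.
  move=> zs; have [_ h] := hlM j; have [Xz] := h z zs.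
  by rewrite !(wco_phiE hH2 hW).
have {}h0 z : en z <= s -> natural_domain a z /\
    nc (lam z - lam 0 - \sum_i z 0 i * l0 i) <= M0 * en z ^+ 2.
  move=> zs; have [/(open_domain_sub ga) Xz h] := h0 z zs; split=> //.
  by rewrite !(wco_lamE hH2 hW).
clearbody l M.
have D0 : lam 0 != 0 := wco_neq0 hH1 hW X0.
pose D := nc (lam 0); have Dgt : 0 < D by rewrite nc_gt0.
pose L0 := \sum_i nc (l0 i).
have L00 : 0 <= L0 by apply: sumr_ge0 => i _; exact: nc_ge0.
pose A : 'M[C]_(d1, d2) := \matrix_(i, j) ((l j i - phi 0 0 j * l0 i) / lam 0).
pose al j := \sum_i nc (A i j).
have al0 j : 0 <= al j by apply: sumr_ge0 => i _; exact: nc_ge0.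
pose Kj j := M j + nc (phi 0 0 j) * M0 + al j * (L0 + M0).
have Kj0 j : 0 <= Kj j.
  by rewrite /Kj !addr_ge0 // mulr_ge0 // ?nc_ge0 // addr_ge0.
pose s' := Num.min (Num.min s 1) (D / (2 * (L0 + M0 + 1))).
have LM0 : 0 <= L0 + M0 by rewrite addr_ge0.
have s'0 : 0 < s'.
  by rewrite !lt_min s0 ltr01 divr_gt0 // mulr_gt0 // ltr_wpDl.
exists A, s', (\sum_j 2 * Kj j / D); split=> //.
  by apply: sumr_ge0 => j _; rewrite divr_ge0 ?(ltW Dgt) // mulr_ge0.
move=> z; rewrite !le_min => /andP[/andP[zs z1] zD].
have [Xz hz] := h0 z zs; split=> //.
have nz0 := en_ge0 z.
have z2 : en z ^+ 2 <= en z by rewrite expr2 ler_piMr.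
have dl : nc (lam z - lam 0) <= (L0 + M0) * en z.
  rewrite -(subrK (\sum_i z 0 i * l0 i) (lam z - lam 0)).
  apply: (le_trans (ncD _ _)); rewrite mulrDl addrC lerD ?nc_lin //.
  by apply: (le_trans hz); rewrite ler_wpM2l.
have lz : D / 2 <= nc (lam z).
  have h1 : D <= nc (lam z) + nc (lam z - lam 0).
    by rewrite /D -{1}(subKr (lam z) (lam 0)) ncB.
  have h2 : (L0 + M0) * en z <= D / 2.
    apply: (@le_trans _ _ ((L0 + M0 + 1) * (D / (2 * (L0 + M0 + 1))))).
      by apply: ler_pM => //; rewrite lerDl.
    rewrite le_eqVlt; apply/orP; left; apply/eqP; field.
    by rewrite gt_eqF // ltr_wpDl.
  move: h1 h2 dl; clear -LM0; move: (nc (lam z - lam 0)) (nc (lam z)) ((L0 + M0) * en z) D.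
  by move=> *; lra.
apply: (le_trans (en_le_sum _)); rewrite mulr_suml; apply: ler_sum => j _.
have -> : 2 * Kj j / D * en z ^+ 2 = (Kj j * en z ^+ 2) / (D / 2).
  by field; rewrite gt_eqF.
rewrite ler_pdivlMr ?divr_gt0 //.
set x := _ 0 j.
apply: (@le_trans _ _ (nc x * nc (lam z))); first by rewrite ler_wpM2l ?nc_ge0.
pose Az := \sum_i z 0 i * A i j.
have xE : x = phi z 0 j - phi 0 0 j - Az by rewrite /x !mxE.
have AzE : Az * lam 0 = \sum_i z 0 i * l j i - phi 0 0 j * \sum_i z 0 i * l0 i.
  rewrite /Az mulr_suml mulr_sumr -sumrB; apply: eq_bigr => i _.
  by rewrite mxE -mulrA divfK // mulrBr mulrCA.
rewrite -ncM.
have -> : x * lam z =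
   (lam z * phi z 0 j - lam 0 * phi 0 0 j - \sum_i z 0 i * l j i)
   - phi 0 0 j * (lam z - lam 0 - \sum_i z 0 i * l0 i)
   - Az * (lam z - lam 0).
  have e : Az * lam z = Az * lam 0 + Az * (lam z - lam 0) by ring.
  rewrite xE mulrBl e AzE; ring.
apply: (le_trans (ncB _ _)); rewrite /Kj 2!mulrDl; apply: lerD.
  apply: (le_trans (ncB _ _)); apply: lerD; first exact: hM.
  by rewrite ncM -mulrA ler_wpM2l ?nc_ge0.
rewrite ncM expr2 mulrACA; apply: ler_pM; rewrite ?nc_ge0 //; exact: nc_lin.
Qed.

End WcoDiff.

(** * Analytic functions on the open domain *)

Section Analytic.
Context {R : realType} {d : nat} {a : nat -> R}
  {H : hilbert_function_space R (@natural_domain R d a)} (hH : weighted_hardy H).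
Local Notation C := R[i].
Local Notation V := 'rV[C^o]_d.
Local Notation DB := (@open_domain R d a).

Lemma le_small (x c k t0 : R) : 0 < t0 ->
  (forall t, 0 < t -> t <= t0 -> x <= c + k * t) -> x <= c.
Proof.
move=> t00 h; apply/ler_addgt0Pl => e e0; rewrite addrC.
pose t := Num.min t0 (e / (`|k| + 1)).
have k1 : 0 < `|k| + 1 by rewrite ltr_wpDl.
have tp : 0 < t by rewrite lt_min t00 divr_gt0.
have tt0 : t <= t0 by rewrite ge_min lexx.
apply: (le_trans (h t tp tt0)); rewrite lerD2l.
apply: (@le_trans _ _ (`|k| * t)); first by rewrite ler_wpM2r ?ler_norm // ltW.
have : t * (`|k| + 1) <= e by rewrite -ler_pdivlMr // ge_min lexx orbT.
by apply: le_trans; rewrite mulrC ler_wpM2l ?(ltW tp) // lerDl.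
Qed.

(** Expansions along the lines through every point, with radius and bound uniform
    over the directions of bounded length. *)
Definition analytic (F : V -> C) := forall y (rho : R), DB y -> 0 < rho ->
  exists (s M : R), 0 < s /\ forall w, en w <= rho ->
    (forall eta : C, nc eta <= s -> DB (y + eta *: w)) /\
    exists e, tay (fun eta => F (y + eta *: w)) M s e.

Lemma analytic_ev f : analytic (ev (H := H) f).
Proof.
move=> y rho By rho0; have [s [s0 hDB /(_ f) [M hM]]] := ev_tay hH By rho0.
exists s, M; split=> // w hw; split; first by move=> eta; exact: hDB.
by have [e he _] := hM w hw; exists e.
Qed.

Lemma analytic_common F G y rho : analytic F -> analytic G -> DB y -> 0 < rho ->
  exists (s M N : R), 0 < s /\ forall w, en w <= rho ->
    [/\ forall eta : C, nc eta <= s -> DB (y + eta *: w),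
    exists e, tay (fun eta => F (y + eta *: w)) M s e &
    exists e, tay (fun eta => G (y + eta *: w)) N s e].
Proof.
move=> hF hG By rho0; have [s [M [s0 hM]]] := hF y rho By rho0.
have [s' [N [s'0 hN]]] := hG y rho By rho0.
exists (Num.min s s'), M, N; split; first by rewrite lt_min s0.
have m0 : 0 < Num.min s s' by rewrite lt_min s0.
move=> w hw; have [h1 [e he]] := hM w hw; have [_ [e' he']] := hN w hw; split.
- by move=> eta; rewrite le_min => /andP[h _]; exact: h1.
- by exists e; apply: (tay_shrink he); rewrite // ge_min lexx.
- by exists e'; apply: (tay_shrink he'); rewrite // ge_min lexx orbT.
Qed.

Lemma analyticM F G : analytic F -> analytic G -> analytic (fun z => F z * G z).
Proof.
move=> hF hG y rho By rho0.
have [s [M [N [s0 h]]]] := analytic_common hF hG By rho0.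
exists (s / 2), (2 * M * N); split; first by rewrite divr_gt0.
move=> w hw; have [h1 [e he] [e' he']] := h w hw; split; last exact: tay_mul he he'.
move=> eta he0; apply: h1; apply: (le_trans he0).
by rewrite ler_pdivrMr // ler_pMr // ler1n.
Qed.

Lemma analyticB F G : analytic F -> analytic G -> analytic (fun z => F z - G z).
Proof.
move=> hF hG y rho By rho0.
have [s [M [N [s0 h]]]] := analytic_common hF hG By rho0.
exists s, (M + N); split=> // w hw; have [h1 [e he] [e' he']] := h w hw; split=> //.
by exists (fun k => e k - e' k); exact: tay_sub.
Qed.

Lemma analytic_lip F y : analytic F -> DB y -> exists (s M : R), [/\ 0 < s, 0 <= M &
  forall u, en u <= s -> DB (y + u) /\ nc (F (y + u) - F y) <= M * en u].
Proof.
move=> hF By; have [s [M [s0 h]]] := hF y 1 By ltr01.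
have M0 : 0 <= M.
  have h01 : en (0 : V) <= 1 by rewrite en0.
  by have [_ [e he]] := h 0 h01; exact: tay_M_ge0 he.
exists s, (M / s); split=> //; first by rewrite divr_ge0 // ltW.
move=> u us; have [->|u0] := eqVneq u 0.
  by rewrite addr0 subrr nc0 en0 mulr0.
have nu := en_gt0 u0; pose w : V := (en u)^-1%:C *: u.
have uw : u = (en u)%:C *: w by rewrite scalerA -rcM divff ?gt_eqF // scale1r.
have nw : en w <= 1.
  by rewrite enZ nc_real ger0_norm ?invr_ge0 ?en_ge0 // mulVf // gt_eqF.
have ncu : nc (en u)%:C = en u by rewrite nc_real ger0_norm // en_ge0.
have [h1 [e he]] := h w nw; split; first by rewrite uw; apply: h1; rewrite ncu.
have [_ /(_ 1%N (en u)%:C)] := he; rewrite ncu => /(_ us).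
rewrite -uw big_ord1 expr0 mulr1 expr1 -(tay_at0 he) scale0r addr0.
by rewrite mulrA mulrAC.
Qed.

(** Zeros propagate along the segment from [p] to [y]: at the supremum of the
    parameters up to which [F] vanishes, they accumulate and the one-variable
    theorem carries them further. *)
Lemma analytic_identity F p (s0 : R) : analytic F -> DB p -> 0 < s0 ->
  (forall u, en u < s0 -> F (p + u) = 0) -> forall y, DB y -> F y = 0.
Proof.
have ga := wh_generating hH.
move=> hF Bp s00 F0 y By; have [->|yp] := eqVneq y p.
  by rewrite -[p]addr0 F0 // en0.
pose v : V := y - p; have v0 : v != 0 by rewrite subr_eq0.
have nv := en_gt0 v0.
have seg (t : R) : 0 <= t -> t <= 1 -> DB (p + t%:C *: v).
  move=> t0 t1.
  have [->|tn1] := eqVneq t 1; first by rewrite scale1r addrC subrK.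
  by apply: (segment_open ga Bp (open_domain_sub ga By) t0); rewrite lt_neqAle tn1.
pose G (t : R) := F (p + t%:C *: v).
pose Z : set R := (fun t => 0 <= t /\ t <= 1 /\ forall t', 0 <= t' -> t' <= t -> G t' = 0).
pose t1 := Num.min 1 (s0 / (2 * en v)).
have v20 : 0 < 2 * en v by rewrite mulr_gt0.
have t10 : 0 < t1 by rewrite lt_min ltr01 divr_gt0.
have Zt1 : Z t1.
  split; first exact: ltW.
  split; first by rewrite ge_min lexx.
  move=> t' t'0 t't1; apply: F0; rewrite enZ nc_real ger0_norm //.
  have : t' * (2 * en v) <= s0.
    by rewrite -ler_pdivlMr // (le_trans t't1) // ge_min lexx orbT.
  move: s00; clear; lra.
have supZ : has_sup Z by split; [exists t1|exists 1 => t [_ [h _]]].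
pose sg := sup Z.
have sg1 : sg <= 1 by apply: ge_sup; [exists t1|move=> t [_ [h _]]].
have sgt1 : t1 <= sg by apply: ub_le_sup => //; exact: supZ.2.
have sg0 : 0 < sg by apply: lt_le_trans sgt1.
have below t' : 0 <= t' -> t' < sg -> G t' = 0.
  move=> h0 h; have e0 : 0 < sg - t' by rewrite subr_gt0.
  have [t [_ [_ ht]] lt] := sup_adherent e0 supZ.
  by apply: ht => //; move: lt; rewrite /sg; move: (sup Z) => x; clear; lra.
have [s [M [sp h]]] := hF _ _ (seg sg (ltW sg0) sg1) nv.
have [_ [e he]] := h v (lexx _).
have shift (t : R) : p + sg%:C *: v + (t - sg)%:C *: v = p + t%:C *: v.
  by rewrite -addrA -scalerDl -rcD [sg + _]addrC subrK.
have e0 := tay_zero he.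
have {e0}ez : forall k, e k = 0.
  apply: e0 => delta del0.
  pose t := Num.max (sg / 2) (sg - delta / 2).
  have tsg : t < sg.
    rewrite gt_max ltr_pdivrMr // ltr_pMr // ltr1n /=.
    by rewrite gtrBl divr_gt0.
  exists (t - sg)%:C; split.
  - by rewrite rc_eq0 subr_eq0 lt_eqF.
  - rewrite nc_real ltr0_norm ?subr_lt0 // opprB ltrBlDl -ltrBlDr.
    rewrite lt_max; apply/orP; right; rewrite ltrD2l ltrN2.
    by rewrite ltr_pdivrMr // ltr_pMr // ltr1n.
  - rewrite shift; apply: below => //.
    by rewrite le_max divr_ge0 // ltW.
have after t : 0 <= t -> t <= 1 -> t < sg + s / 2 -> G t = 0.
  move=> h0 h1 h2; have [|tsg] := ltP t sg; first exact: below.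
  rewrite /G -shift; apply: (tay_all0 he ez).
  rewrite nc_real ger0_norm ?subr_ge0 // ltrBlDl (lt_trans h2) // ltrD2l.
  by rewrite ltr_pdivrMr // ltr_pMr // ltr1n.
have G1 : G 1 = 0.
  apply: (after) => //; rewrite ltNge; apply/negP => le.
  have Zt : Z (sg + s / 4).
    have s40 : 0 < s / 4 by rewrite divr_gt0.
    have s42 : s / 4 < s / 2 by rewrite ltr_pM2l // ltf_pV2 ?posrE // ltr_nat.
    split; first by rewrite addr_ge0 // ltW.
    split; first by apply: le_trans le; rewrite lerD2l ltW.
    move=> t' h0 h1; apply: after => //.
      by apply: (le_trans h1); apply: le_trans le; rewrite lerD2l ltW.
    by apply: (le_lt_trans h1); rewrite ltrD2l.
  have := ub_le_sup supZ.2 Zt; rewrite -/sg gerDl leNgt divr_gt0 //.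
by move: G1; rewrite /G scale1r /v [p + _]addrC subrK.
Qed.

End Analytic.

(** * The range of the symbol of a self-map *)

Section SelfMap.
Context {R : realType} {d : nat} {a : nat -> R}
  {H : hilbert_function_space R (@natural_domain R d.+1 a)} (hH : weighted_hardy H).
Local Notation C := R[i].
Local Notation V := 'rV[C^o]_d.+1.
Local Notation DX := (@natural_domain R d.+1 a).
Local Notation DB := (@open_domain R d.+1 a).
Local Notation analytic := (@analytic R d.+1 a).
Context {lam : V -> C} {phi : V -> V} {T : H -> H} (hT : wco lam phi T).

Lemma selfmap_center : DB (phi 0).
Proof. exact: wco_center hH hH _ _ _ hT. Qed.

(** Let [g j] and [h] be the preimages under [T] of [z_j] and 1; then
    [g j (phi z) = z_j * h (phi z)] and [h (phi 0)] is not 0.  If [v A = 0], then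
    [phi (t v) - phi 0] is [O(t^2)], and so is the left-hand side at [t v]; the
    right-hand side is [t v_j h (phi 0)] up to a factor tending to 1, so [v = 0]. *)
Lemma selfmap_derivative : exists (A : 'M[C]_d.+1) (s K : R),
  [/\ A \in unitmx, 0 < s, 0 <= K & forall z : V, en z <= s -> DX z /\
      en (phi z - phi 0 - (z *m A : V)) <= K * en z ^+ 2].
Proof.
have ga := wh_generating hH.
have [A [s [K [s0 K0 hA]]]] := wco_diff hH hH hT.
exists A, s, K; split=> //.
have [_ _ _ [S [_ SW _ _]]] := hT.
have Sev g z : DX z -> ev (S g) (phi z) = ev g z / lam z.
  move=> Xz; rewrite -{2}(SW g) (wco_ev hT _ Xz) mulrAC mulfV ?mul1r //.
  exact: (wco_neq0 hH hT).
pose h := S (one hH); pose g j := S (crd hH j).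
have gh j z : DX z -> ev (g j) (phi z) = z 0 j * ev h (phi z).
  by move=> Xz; rewrite !Sev // ev_crd // ev_one // mul1r.
have h0 : ev h (phi 0) != 0.
  have X0 := open_domain_sub ga (open_domain0 ga (d := d.+1)).
  by rewrite Sev // ev_one // mul1r invr_eq0; exact: (wco_neq0 hH hT).
have inj v : (v : V) *m A = 0 -> v = 0.
  move=> vA; apply: contrapT => /eqP v0; have nv := en_gt0 v0.
  have [j vj] : exists j, v 0 j != 0.
    apply: contrapT => /forallNP hv; move/eqP: v0; apply; apply/rowP => j.
    by rewrite mxE; apply/eqP/negPn/negP; exact: hv.
  have [s1 [M1 [s10 M10 hM1]]] := analytic_lip (analytic_ev hH (g j)) selfmap_center.
  have [s2 [M2 [s20 M20 hM2]]] := analytic_lip (analytic_ev hH h) selfmap_center.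
  pose B := en v; pose K' := K * B ^+ 2 + 1.
  have K'0 : 0 < K' by rewrite ltr_wpDl // mulr_ge0 // exprn_ge0 // en_ge0.
  have eta0 : 0 < nc (ev h (phi 0)) by rewrite nc_gt0.
  pose t0 := Num.min (Num.min 1 (s / B)) (Num.min (Num.min (s1 / K') (s2 / K'))
    (nc (ev h (phi 0)) / (2 * (M2 * K' + 1)))).
  have MK : 0 < M2 * K' + 1 by rewrite ltr_wpDl // mulr_ge0 // ltW.
  have t00 : 0 < t0.
    by rewrite !lt_min ltr01 !divr_gt0 ?mulr_gt0.
  suff : nc (v 0 j) * (nc (ev h (phi 0)) / 2) <= 0.
    by rewrite leNgt mulr_gt0 ?nc_gt0 // divr_gt0 ?nc_gt0.
  apply: (le_small (k := M1 * K') t00) => t tp; rewrite !le_min add0r.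
  move=> /andP[/andP[t1 tB] /andP[/andP[ts1 ts2] tM]].
  have nct : nc t%:C = t by rewrite nc_real ger0_norm // ltW.
  have ntv : en (t%:C *: v) = t * B by rewrite enZ nct.
  have tv : en (t%:C *: v) <= s by rewrite ntv -ler_pdivlMr.
  have [Xz hz] := hA _ tv.
  pose u := phi (t%:C *: v) - phi 0.
  have uE : phi (t%:C *: v) = phi 0 + u by rewrite /u addrC subrK.
  have nu : en u <= K' * t ^+ 2.
    move: hz; rewrite -scalemxAl vA scaler0 subr0 ntv -/u => hz.
    apply: (le_trans hz); rewrite exprMn mulrCA mulrC.
    by rewrite ler_wpM2r ?sqr_ge0 // lerDl.
  have t2 : t ^+ 2 <= t by rewrite expr2 ler_piMr // ltW.
  have nu1 : en u <= K' * t by apply: (le_trans nu); rewrite ler_wpM2l // ltW.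
  have us1 : en u <= s1.
    by apply: (le_trans nu1); rewrite mulrC -ler_pdivlMr.
  have us2 : en u <= s2.
    by apply: (le_trans nu1); rewrite mulrC -ler_pdivlMr.
  have [_ b1] := hM1 u us1; have [_ b2] := hM2 u us2.
  have X0 := open_domain_sub ga (open_domain0 ga (d := d.+1)).
  have g0 : ev (g j) (phi 0) = 0 by rewrite gh // mxE mul0r.
  rewrite g0 subr0 -uE gh // in b1.
  rewrite mxE ncM ncM nct in b1.
  have low : nc (ev h (phi 0)) / 2 <= nc (ev h (phi (t%:C *: v))).
    rewrite -uE in b2.
    have b3 : M2 * en u <= nc (ev h (phi 0)) / 2.
      apply: (@le_trans _ _ ((M2 * K' + 1) * t)).
        rewrite mulrDl mul1r -mulrA; apply: (le_trans (ler_wpM2l M20 nu1)).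
        by rewrite lerDl ltW.
      rewrite mulrC -ler_pdivlMr //; apply: (le_trans tM).
      by rewrite invfM mulrA.
    have b4 : nc (ev h (phi 0)) <= nc (ev h (phi (t%:C *: v))) +
        nc (ev h (phi (t%:C *: v)) - ev h (phi 0)).
      by rewrite -{1}(subKr (ev h (phi (t%:C *: v))) (ev h (phi 0))) ncB.
    rewrite [leLHS](_ : _ = nc (ev h (phi 0)) - nc (ev h (phi 0)) / 2); last first.
      by rewrite {2}[nc _]splitr addrK.
    rewrite lerBlDr; apply: (le_trans b4); rewrite lerD2l.
    exact: le_trans b2 b3.
  rewrite -(ler_pM2l tp) [leLHS]mulrA.
  apply: (@le_trans _ _ (t * nc (v 0 j) * nc (ev h (phi (t%:C *: v))))).
    by apply: ler_wpM2l => //; rewrite mulr_ge0 ?nc_ge0 // ltW.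
  apply: (le_trans b1); apply: (le_trans (ler_wpM2l M10 nu)).
  by rewrite le_eqVlt; apply/orP; left; apply/eqP; ring.
rewrite -row_free_unit -kermx_eq0; apply/eqP/row_matrixP => i.
rewrite row0; apply: inj; rewrite -row_mul mulmx_ker.
by rewrite row0.
Qed.

(** The range of [phi] contains points [p + t (w + r)] with [r = O(t)] for every
    direction [w], because the derivative is onto.  By induction on [m], if the
    homogeneous terms of [F] at [p] of order below [m] vanish, then the one of
    order [m] is [O(t)] at [w + r], hence 0 at [w] by continuity. *)
Lemma selfmap_near F : analytic F -> (forall z, DX z -> F (phi z) = 0) ->
  exists2 s : R, 0 < s & forall u, en u < s -> F (phi 0 + u) = 0.
Proof.
move=> hF F0; have ga := wh_generating hH.
have [A [sA [K [uA sA0 K0 hA]]]] := selfmap_derivative.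
have Bp := selfmap_center; set p := phi 0 in hA Bp *.
have [s [M [s0 hM]]] := hF p 1 Bp ltr01.
have /choice [E hE] : forall w : V, exists e, en w <= 1 ->
    (forall eta : C, nc eta <= s -> DB (p + eta *: w)) /\
    tay (fun eta => F (p + eta *: w)) M s e.
  move=> w; have [w1|w1] := leP (en w) 1; last by exists (fun=> 0).
  by have [h [e he]] := hM w w1; exists e.
have M0 : 0 <= M.
  have h01 : en (0 : V) <= 1 by rewrite en0.
  by have [_ he] := hE 0 h01; exact: tay_M_ge0 he.
have Ez : forall m w, en w < 1 -> E w m = 0.
  elim/ltn_ind => m IH w w1.
  pose v : V := w *m invmx A; have vA : v *m A = w by rewrite mulmxKV.
  pose B := en v; have B0 : 0 <= B := en_ge0 v.
  apply/eqP; rewrite -nc_eq0 eq_le nc_ge0 andbT.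
  apply: (le_small (k := 2 * M / s ^+ m.+1) s0) => tau tau0 taus; rewrite add0r.
  have nctau : nc tau%:C = tau by rewrite nc_real ger0_norm // ltW.
  have [hDBw tw] := hE w (ltW w1).
  have taus' : nc tau%:C <= s by rewrite nctau.
  have [s3 [M3 [s30 M30 hM3]]] := analytic_lip hF (hDBw _ taus').
  have lowz w' k : en w' < 1 -> (k < m)%N -> E w' k = 0 by move=> h hk; exact: IH.
  have rem w' (eta : C) : en w' < 1 -> nc eta <= s ->
      nc (F (p + eta *: w') - E w' m * eta ^+ m) <= M * (nc eta / s) ^+ m.+1.
    move=> h hs; have [_ [_ /(_ m.+1 eta hs)]] := hE w' (ltW h).
    by rewrite big_ord_recr /= big1 ?add0r // => i _; rewrite lowz ?mul0r.
  have tm0 : 0 < tau ^+ m by rewrite exprn_gt0.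
  have -> : 2 * M / s ^+ m.+1 * tau = (2 * M * (tau / s) ^+ m.+1) / tau ^+ m.
    rewrite expr_div_n [tau ^+ m.+1]exprS; field.
    by rewrite !gt_eqF // exprn_gt0.
  rewrite ler_pdivlMr //.
  pose kk := K * B ^+ 2; have kk0 : 0 <= kk by rewrite mulr_ge0 // sqr_ge0.
  pose t0 := Num.min (Num.min (sA / (B + 1)) s) (Num.min ((1 - en w) / (kk + 1) / 2)
     (s3 / (tau * kk + 1))).
  have B1 : 0 < B + 1 by rewrite ltr_wpDl.
  have k1 : 0 < kk + 1 by rewrite ltr_wpDl.
  have tk1 : 0 < tau * kk + 1 by rewrite ltr_wpDl // mulr_ge0 // ltW.
  have t00 : 0 < t0 by rewrite !lt_min s0 !divr_gt0 // subr_gt0.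
  apply: (le_small (k := M / s ^+ m.+1 * tau ^+ m + M3 * (tau * kk)) t00) => t tp.
  rewrite !le_min => /andP[/andP[tA ts] /andP[tk t3]].
  have nct : nc t%:C = t by rewrite nc_real ger0_norm // ltW.
  have ntv : en (t%:C *: v) <= sA.
    rewrite enZ nct; apply: (@le_trans _ _ (t * (B + 1))); last by rewrite -ler_pdivlMr.
    by rewrite ler_wpM2l ?(ltW tp) // lerDl.
  have [Xz hz] := hA _ ntv.
  pose r : V := t^-1%:C *: (phi (t%:C *: v) - p - (t%:C *: v *m A : V)).
  have tC0 : t%:C != 0 :> C by rewrite rc_eq0 gt_eqF.
  have rE : phi (t%:C *: v) = p + t%:C *: (w + r).
    have yE : t%:C *: w = (t%:C *: v *m A : V) by rewrite -vA scalemxAl.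
    rewrite scalerDr yE /r scalerA -rcM divff ?gt_eqF // scale1r.
    by move: (_ *m A : V) => y; rewrite (addrC y) subrK addrC subrK.
  have nr : en r <= kk * t.
    rewrite enZ nc_real ger0_norm ?invr_ge0 ?(ltW tp) // mulrC ler_pdivrMr //.
    apply: (le_trans hz); rewrite enZ nct /kk -/B.
    by rewrite le_eqVlt; apply/orP; left; apply/eqP; ring.
  have wr1 : en (w + r) < 1.
    apply: (le_lt_trans (enD _ _)); rewrite -ltrBrDl; apply: (le_lt_trans nr).
    have h1 : t * (kk + 1) <= (1 - en w) / 2.
      by rewrite -ler_pdivlMr // mulrAC.
    have h2 : 0 < 1 - en w by rewrite subr_gt0.
    apply: (@le_lt_trans _ _ (t * (kk + 1))).
      by rewrite mulrC ler_wpM2l ?(ltW tp) // lerDl.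
    by apply: (le_lt_trans h1); rewrite ltr_pdivrMr // ltr_pMr // ltr1n.
  have tsn : nc t%:C <= s by rewrite nct.
  have e1 := rem (w + r) _ wr1 tsn.
  rewrite -rE F0 // sub0r ncN ncM ncX nct expr_div_n in e1.
  have {}e1 : nc (E (w + r) m) <= M / s ^+ m.+1 * t.
    have tmp : 0 < t ^+ m by rewrite exprn_gt0.
    rewrite -(ler_pM2r tmp); apply: (le_trans e1).
    by rewrite exprS le_eqVlt; apply/orP; left; apply/eqP; ring.
  have e2 := rem (w + r) _ wr1 taus'; have e3 := rem w _ w1 taus'.
  rewrite nctau in e2 e3.
  have ntr : en (tau%:C *: r) <= tau * kk * t.
    by rewrite enZ nctau -mulrA ler_wpM2l // ltW.
  have tr3 : en (tau%:C *: r) <= s3.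
    apply: (le_trans ntr); apply: (@le_trans _ _ (t * (tau * kk + 1))).
      by rewrite mulrC ler_wpM2l ?(ltW tp) // lerDl.
    by rewrite -ler_pdivlMr.
  have [_ e4] := hM3 _ tr3.
  have {}e4 : nc (F (p + tau%:C *: (w + r)) - F (p + tau%:C *: w)) <= M3 * (tau * kk) * t.
    rewrite scalerDr addrA; apply: (le_trans e4).
    by rewrite -mulrA ler_wpM2l.
  have -> : nc (E w m) * tau ^+ m = nc (E w m * tau%:C ^+ m) by rewrite ncM ncX nctau.
  set q := (tau / s) ^+ m.+1 in e2 e3 *.
  have -> : E w m * tau%:C ^+ m = - (F (p + tau%:C *: w) - E w m * tau%:C ^+ m)
    - (F (p + tau%:C *: (w + r)) - F (p + tau%:C *: w))
    + (F (p + tau%:C *: (w + r)) - E (w + r) m * tau%:C ^+ m)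
    + E (w + r) m * tau%:C ^+ m by ring.
  have e5 : nc (E (w + r) m * tau%:C ^+ m) <= M / s ^+ m.+1 * tau ^+ m * t.
    by rewrite ncM ncX nctau mulrAC ler_wpM2r // ltW.
  apply: (le_trans (ncD _ _)).
  have -> : 2 * M * q + (M / s ^+ m.+1 * tau ^+ m + M3 * (tau * kk)) * t =
    (M * q + M3 * (tau * kk) * t + M * q) + M / s ^+ m.+1 * tau ^+ m * t by ring.
  apply: lerD => //; apply: (le_trans (ncD _ _)); apply: lerD => //.
  by apply: (le_trans (ncB _ _)); apply: lerD => //; rewrite ncN.
exists s => // u us; have [->|u0] := eqVneq u 0.
  rewrite addr0; apply: (F0 0).
  exact: (open_domain_sub ga (open_domain0 ga (d := d.+1))).
have nu := en_gt0 u0.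
pose eta := (en u + s) / 2.
have eta0 : 0 < eta by rewrite divr_gt0 // addr_gt0.
have etas : eta < s by rewrite ltr_pdivrMr // mulr_natr mulr2n ltrD2r.
have ueta : en u < eta by rewrite ltr_pdivlMr // mulr_natr mulr2n ltrD2l.
pose w : V := eta^-1%:C *: u.
have w1 : en w < 1.
  by rewrite enZ nc_real ger0_norm ?invr_ge0 ?(ltW eta0) // mulrC ltr_pdivrMr // mul1r.
have -> : u = eta%:C *: w by rewrite scalerA -rcM divff ?gt_eqF // scale1r.
have [_ tw] := hE w (ltW w1).
apply: (tay_all0 tw) => [k|]; first exact: Ez.
by rewrite nc_real ger0_norm // ltW.
Qed.

End SelfMap.

(** * Inverting the symbol of a self-map *)

Section Segments.
Context {R : realType} {d : nat} {a : nat -> R}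
  {H : hilbert_function_space R (@natural_domain R d a)} (hH : weighted_hardy H).
Local Notation C := R[i].
Local Notation V := 'rV[C^o]_d.
Local Notation DX := (@natural_domain R d a).

Lemma ev_segment f (p y : V) (t0 e : R) : DX p -> DX y -> 0 <= t0 -> t0 <= 1 -> 0 < e ->
  exists2 delta : R, 0 < delta & forall t, 0 <= t -> t <= 1 -> `|t - t0| < delta ->
    nc (ev (H := H) f (p + t%:C *: (y - p)) - ev f (p + t0%:C *: (y - p))) < e.
Proof.
move=> Xp Xy h0 h1 e0.
have [delta d0 hd] := ev_cont hH f (segment_domain (wh_generating hH) Xp Xy h0 h1) e0.
have n0 := en_ge0 (y - p); have n1 : 0 < en (y - p) + 1 by rewrite ltr_wpDl.
exists (delta / (en (y - p) + 1)); first by rewrite divr_gt0.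
move=> t tt0 tt1; rewrite ltr_pdivlMr // => lt.
apply: hd; first exact: (segment_domain (wh_generating hH)).
have -> : p + t%:C *: (y - p) - (p + t0%:C *: (y - p)) = (t - t0)%:C *: (y - p).
  by rewrite rcB scalerBl opprD addrACA subrr add0r.
rewrite enZ nc_real; apply: le_lt_trans lt.
by rewrite ler_wpM2l // lerDl.
Qed.

Lemma ev_approach f (p y : V) : DX p -> DX y ->
  cvg_to (fun n => ev (H := H) f (p + (1 - n.+1%:R^-1)%:C *: (y - p))) (ev f y).
Proof.
move=> Xp Xy e e0.
have [delta d0 hd] := ev_segment f Xp Xy ler01 (lexx 1) e0.
exists (Num.truncn delta^-1).+1 => n hn'.
have y1 : p + (1 : R)%:C *: (y - p) = y by rewrite scale1r addrC subrK.
have n1 : n.+1%:R^-1 <= 1 :> R by rewrite invf_le1 // ler1n.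
have n0 : 0 <= n.+1%:R^-1 :> R by rewrite invr_ge0.
have := hd (1 - n.+1%:R^-1); rewrite y1 nc_dist subr_ge0 gerBl => h.
apply/ltW/h => //; rewrite addrAC subrr sub0r normrN ger0_norm //.
rewrite invf_plt ?posrE //; apply: (lt_le_trans (truncnS_gt _)).
by rewrite ler_nat; apply: leq_trans hn' _.
Qed.

End Segments.

Section SelfMapSurjective.
Context {R : realType} {d : nat} {a : nat -> R}
  {H : hilbert_function_space R (@natural_domain R d.+1 a)} (hH : weighted_hardy H).
Local Notation C := R[i].
Local Notation V := 'rV[C^o]_d.+1.
Local Notation DX := (@natural_domain R d.+1 a).
Context {lam : V -> C} {phi : V -> V} {T : H -> H} (hT : wco lam phi T).
Context {S : H -> H} (ST : cancel S T).

Lemma inv_ev g z : DX z -> ev (S g) (phi z) = ev g z / lam z.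
Proof.
move=> Xz; rewrite -{2}(ST g) (wco_ev hT _ Xz) mulrAC mulfV ?mul1r //.
exact: (wco_neq0 hH hT).
Qed.

(** At the points [phi z] this is [inv_ev].  It extends to the open domain by
    [selfmap_near] and the identity theorem, and to the boundary along segments. *)
Lemma selfmap_mult u1 u2 u3 :
  (forall z, DX z -> ev u1 z * ev u2 z = ev u3 z) -> forall y, DX y ->
  ev (S u1) y * ev (S u2) y = ev (S u3) y * ev (S (one hH)) y.
Proof.
move=> h; have ga := wh_generating hH; have Bp := selfmap_center hH hT.
pose F y := ev (S u1) y * ev (S u2) y - ev (S u3) y * ev (S (one hH)) y.
have hF : @analytic R d.+1 a F.
  by apply: analyticB; apply: analyticM; exact: analytic_ev.
have F0 z : DX z -> F (phi z) = 0.
  move=> Xz; rewrite /F !inv_ev // -h // ev_one //.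
  have := wco_neq0 hH hT Xz; set l := lam z => l0; field; exact: l0.
have [s s0 hs] := selfmap_near hH hT hF F0.
have FB := analytic_identity hH hF Bp s0 hs.
move=> y Xy; apply/eqP; rewrite -subr_eq0; apply/eqP.
have Xp := open_domain_sub ga Bp.
have cv g := ev_approach hH g Xp Xy.
apply: (cvg_to_uniq (cvg_toB (cvg_toM (cv (S u1)) (cv (S u2)))
  (cvg_toM (cv (S u3)) (cv (S (one hH)))))).
apply: (@cvg_to_cst _ _ _ 0%N) => n _; apply: FB; apply: (segment_open ga Bp Xy).
  by rewrite subr_ge0 invf_le1 // ler1n.
by rewrite gtrBl invr_gt0.
Qed.

Context (Slin : forall (c : C) f g, S (c *: f + g) = c *: S f + S g).
Context {N : R} (SN : forall f, hn (S f) <= N * hn f).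

Lemma inv0 : S 0 = 0.
Proof. by have := Slin (-1) 0 0; rewrite scaler0 add0r scaleN1r addNr. Qed.
Lemma invZ (c : C) f : S (c *: f) = c *: S f.
Proof. by rewrite -[c *: f]addr0 Slin inv0 addr0. Qed.
Lemma invD f g : S (f + g) = S f + S g.
Proof. by rewrite -{1}(scale1r f) Slin scale1r. Qed.
Lemma inv_sum (I : Type) (r : seq I) (P : pred I) (F : I -> H) :
  S (\sum_(i <- r | P i) F i) = \sum_(i <- r | P i) S (F i).
Proof. by rewrite (big_morph S invD inv0). Qed.

(** By [selfmap_mult], [g |-> S g y / S 1 y] takes the value [monomial al x] on each
    monomial, [x] being formed from its values on the coordinates.  It is bounded,
    and the partial sums of the kernel at [x] then show that [G (|x|^2)] is finite,
    so [x] is in the domain and the functional is the evaluation at [x] by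
    density; comparing with [T] gives [phi x = y]. *)
Lemma selfmap_range y : DX y -> ev (S (one hH)) y != 0 ->
  exists2 x, DX x & phi x = y.
Proof.
move=> Xy h0; have ga := wh_generating hH; set h := ev (S (one hH)) y in h0.
have [B B0 hB] : exists2 B : R, 0 <= B & forall g, nc (ev (S g) y) <= B * hn g.
  have [M M0 hM] := ev_bounded (H := H) y; exists (M * `|N|); first by rewrite mulr_ge0.
  move=> g; apply: (le_trans (hM _)); rewrite -mulrA ler_wpM2l //.
  by apply: (le_trans (SN g)); rewrite ler_wpM2r ?hn_ge0 // ler_norm.
pose x : V := \row_j (ev (S (crd hH j)) y / h).
have xj j : ev (S (crd hH j)) y = h * x 0 j by rewrite mxE mulrC divfK.
have Xx : DX x.
  have [U uU xU] := unitary_to_axis x; have [W [Wev Wn]] := unitary_comp hH uU.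
  have XU z : DX z -> DX (z *m U : V).
    by move=> Xz; apply: (domain_le ga _ Xz); rewrite en_unitaryE.
  (* [E n] is the [n]-th power of a linear form whose value at [x] is [en x] *)
  pose E n := W (mon hH (axis n)).
  have Eev n z : DX z -> ev (E n) z = (z *m U : V) 0 0 ^+ n.
    by move=> Xz; rewrite Wev // mon_ev ?monomial_axis //; exact: XU.
  have E1 : E 1%N = \sum_j U j 0 *: crd hH j.
    apply: ev_inj => z Xz; rewrite Eev // expr1 mxE ev_sum; apply: eq_bigr => j _.
    by rewrite evZ ev_crd // mulrC.
  have E0 : E 0%N = one hH.
    by apply: ev_inj => z Xz; rewrite Eev // expr0 ev_one.
  have LE1 : ev (S (E 1%N)) y = h * (en x)%:C.
    have -> : (en x)%:C = \sum_j x 0 j * U j 0.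
      have := congr1 (fun v : V => v 0 0) xU; rewrite !mxE => ->.
      by rewrite !eqxx mulr1.
    rewrite E1 inv_sum ev_sum mulr_sumr; apply: eq_bigr => j _.
    by rewrite invZ evZ xj mulrCA [x 0 j * _]mulrC.
  have LE n : ev (S (E n)) y = h * (en x)%:C ^+ n.
    elim: n => [|n IH]; first by rewrite E0 expr0 mulr1.
    have := @selfmap_mult (E n) (E 1%N) (E n.+1) _ y Xy.
    rewrite IH LE1 -/h => /(_ _)-e; apply: (mulIf h0); rewrite -e.
      by rewrite exprSr; ring.
    by move=> z Xz; rewrite !Eev // expr1 exprSr.
  apply/(natural_domainP ga); exists (B ^+ 2 / nc h ^+ 2) => m.
  set Sm := \sum_(n < m) _.
  have a0 := generating_ge0 ga; have ap n : 0 < a n by case: ga => _ h' _; exact: h'.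
  have Sm0 : 0 <= Sm.
    by apply: sumr_ge0 => n _; rewrite mulr_ge0 // exprn_ge0 // sqr_ge0.
  (* a partial sum of the kernel at [x], with squared norm [Sm] *)
  pose P := \sum_(n < m) (a n * en x ^+ n)%:C *: mon hH (axis n).
  have nP : hn P ^+ 2 = Sm.
    pose FP n := (a n * en x ^+ n)%:C *: mon hH (axis (d := d) n).
    rewrite /P (hn_orth_sum (F := FP)); last first.
      move=> n k nk; rewrite formZl formZr mon_orth ?mulr0 //.
      by apply: contra nk => /eqP /axis_inj ->.
    apply: eq_bigr => n _.
    rewrite hnZ nc_real exprMn mon_axis_norm real_normK ?num_real // exprMn -!exprM.
    by rewrite [(n * 2)%N]mulnC; field; rewrite gt_eqF.
  have WP : W P = \sum_(n < m) (a n * en x ^+ n)%:C *: E n.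
    apply: ev_inj => z Xz; rewrite Wev // !ev_sum; apply: eq_bigr => n _.
    by rewrite !evZ Wev.
  have LP : ev (S (W P)) y = h * Sm%:C.
    rewrite WP inv_sum ev_sum rc_sum mulr_sumr; apply: eq_bigr => n _.
    rewrite invZ evZ LE !rcM !rcX; rewrite -exprM mul2n -addnn exprD.
    by ring.
  have := hB (W P); rewrite LP Wn ncM nc_real ger0_norm // => le1.
  have le2 : (nc h * Sm) ^+ 2 <= B ^+ 2 * Sm.
    by rewrite -nP -exprMn; apply: lerXn2r;
      rewrite ?nnegrE ?mulr_ge0 ?nc_ge0 ?hn_ge0 ?sqr_ge0 //; rewrite nP.
  have [->|Smn] := eqVneq Sm 0; first by rewrite divr_ge0 ?sqr_ge0.
  rewrite ler_pdivlMr ?exprn_gt0 ?nc_gt0 //.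
  have Smp : 0 < Sm by rewrite lt_neqAle eq_sym Smn.
  rewrite -(ler_pM2r Smp); apply: le_trans le2.
  by rewrite le_eqVlt; apply/orP; left; apply/eqP; ring.
have mono n : forall al, mi_degree al = n -> ev (S (mon hH al)) y = h * monomial al x.
  elim: n => [|n IH] al.
    move=> /eqP; rewrite /mi_degree sum_nat_eq0 => /forallP al0.
    have -> : al = [ffun=> 0%N].
      by apply/ffunP => i; rewrite ffunE; apply/eqP; exact: (al0 i).
    rewrite -/(one hH) -/h /monomial big1 ?mulr1 // => i _.
    by rewrite ffunE expr0.
  move=> aln; have [j aj] : exists j, al j != 0%N.
    apply/existsP; apply: contraT; rewrite negb_exists => /forallP z.
    move: aln; rewrite /mi_degree big1 // => i _; apply/eqP.
    by move: (z i); rewrite negbK.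
  pose be : multi_index d.+1 := [ffun i => (al i - (i == j))%N].
  have ab i : al i = ((i == j) + be i)%N.
    by rewrite ffunE; case: eqP => [->|_] /=; [rewrite subnKC // lt0n|rewrite subn0].
  have bed : mi_degree be = n.
    move: aln; rewrite /mi_degree (eq_bigr _ (fun i _ => ab i)) big_split /=.
    by rewrite (bigD1 j) //= eqxx big1 => [|i /negPf -> //]; rewrite addn0 => -[].
  have mE z : monomial al z = z 0 j * monomial be z.
    rewrite /monomial (eq_bigr (fun i => z 0 i ^+ (i == j) * z 0 i ^+ be i)).
      rewrite big_split /= (bigD1 j) //= eqxx expr1 big1 ?mulr1 // => i /negPf ->.
      by rewrite expr0.
    by move=> i _; rewrite ab exprD.
  have := @selfmap_mult (crd hH j) (mon hH be) (mon hH al) _ y Xy.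
  rewrite xj (IH _ bed) -/h => /(_ _)-e; apply: (mulIf h0); rewrite -e ?mE.
    by ring.
  by move=> z Xz; rewrite ev_crd // !mon_ev // mE.
have all_g g : ev (S g) y = h * ev g x.
  apply/eqP; rewrite -subr_eq0; apply/eqP; apply: nc_small0 => e e0.
  have [M M0 hM] := ev_bounded (H := H) x.
  have K1 : 0 < B + nc h * M + 1 by rewrite ltr_wpDl // addr_ge0 // mulr_ge0 // nc_ge0.
  have e1 : 0 < e / (B + nc h * M + 1) by rewrite divr_gt0.
  have [n0 /(_ n0 (leqnn _))] := psum_cvg hH g e1.
  set P := psum _ _ _ => hP.
  have eP : ev (S P) y = h * ev P x.
    rewrite inv_sum !ev_sum mulr_sumr; apply: eq_bigr => n _; rewrite /term.
    case: pickle_inv => [al|]; last by rewrite inv0 !ev0 mulr0.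
    by rewrite invZ !evZ (mono _ _ erefl) mon_ev // mulrCA.
  have -> : ev (S g) y - h * ev g x = ev (S (g - P)) y - h * ev (g - P) x.
    have -> : S (g - P) = S g - S P by rewrite invD -scaleN1r invZ scaleN1r.
    by rewrite !evB eP; ring.
  apply: (le_trans (ncB _ _)); rewrite ncM.
  apply: (@le_trans _ _ (B * hn (g - P) + nc h * (M * hn (g - P)))).
    by apply: lerD => //; rewrite ler_wpM2l ?nc_ge0.
  rewrite mulrA -mulrDl; move: hP; rewrite ltr_pdivlMr // => hP; apply/ltW.
  apply: le_lt_trans hP; rewrite mulrC ler_wpM2l ?hn_ge0 //.
  by rewrite lerDl.
have [_ _ _ [S' [TS' S'T _ _]]] := hT.
have STc : cancel T S by move=> g; apply: (can_inj TS'); rewrite ST.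
have tr (g : H) : ev g y = h * lam x * ev g (phi x).
  by rewrite -{1}(STc g) all_g (wco_ev hT _ Xx) mulrA.
exists x => //.
have Xfx := wco_dom hT Xx.
have hl : h * lam x = 1 by have := tr (one hH); rewrite !ev_one // mulr1.
by apply/rowP => j; have := tr (crd hH j); rewrite !ev_crd // hl mul1r.
Qed.

End SelfMapSurjective.

(** * Surjectivity of the symbol of a self-map *)

Section Onto.
Context {R : realType} {d : nat} {a : nat -> R}
  {H : hilbert_function_space R (@natural_domain R d.+1 a)} (hH : weighted_hardy H).
Local Notation C := R[i].
Local Notation V := 'rV[C^o]_d.+1.
Local Notation DX := (@natural_domain R d.+1 a).
Local Notation DB := (@open_domain R d.+1 a).

Lemma real_between (sg del : R) : 0 < sg -> 0 < del -> exists t : R,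
  [/\ 0 <= t, t < sg & `|t - sg| < del].
Proof.
move=> s0 d0; pose m := Num.min sg del; have m0 : 0 < m by rewrite lt_min s0.
have m2 : m / 2 < m by rewrite ltr_pdivrMr // ltr_pMr // ltr1n.
have m20 : 0 < m / 2 by rewrite divr_gt0.
exists (sg - m / 2); split.
- by rewrite subr_ge0 ltW // (lt_le_trans m2) // ge_min lexx.
- by rewrite gtrBl.
- rewrite addrAC subrr sub0r normrN gtr0_norm //; apply: (lt_le_trans m2).
  by rewrite ge_min lexx orbT.
Qed.

Lemma first_zero (f : H) p y : DX p -> DX y -> ev f p != 0 -> ev f y = 0 ->
  exists sg : R, [/\ 0 < sg, sg <= 1, ev f (p + sg%:C *: (y - p)) = 0 &
    forall t : R, 0 <= t -> t < sg -> ev f (p + t%:C *: (y - p)) != 0].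
Proof.
move=> Xp Xy fp fy; pose c (t : R) := ev f (p + t%:C *: (y - p)).
pose Z : set R := (fun t => 0 <= t /\ t <= 1 /\ c t = 0).
have Z1 : Z 1 by split=> //; split=> //; rewrite /c scale1r addrC subrK.
have infZ : has_inf Z by split; [exists 1|exists 0 => t []].
pose sg := inf Z.
have sg0 : 0 <= sg by apply: lb_le_inf; [exists 1|move=> t []].
have sg1 : sg <= 1 by apply: ge_inf => //; exact: infZ.2.
have csg : c sg = 0.
  apply/eqP/negPn/negP => cn; have e0 : 0 < nc (c sg) by rewrite nc_gt0.
  have [del d0 hd] := ev_segment hH f Xp Xy sg0 sg1 e0.
  have [t [t0 [t1 ct]] tlt] := inf_adherent d0 infZ.
  have tsg : sg <= t by apply: ge_inf; [exact: infZ.2|].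
  have := hd t t0 t1; rewrite ger0_norm ?subr_ge0 // ltrBlDl => /(_ tlt).
  by rewrite -/(c t) ct sub0r ncN ltxx.
exists sg; split=> //.
  rewrite lt_neqAle sg0 andbT; apply/eqP => e.
  by move: csg; rewrite -e /c scale0r addr0 => /eqP; rewrite (negPf fp).
move=> t t0 tlt; apply/eqP => ct; have := tlt; rewrite ltNge => /negP; apply.
apply: ge_inf; first exact: infZ.2.
by split=> //; split=> //; apply: le_trans sg1; exact: ltW.
Qed.

(** The function [h := S 1] has no zero, for [lam x * h (phi x) = 1], while
    along the preimages of points tending to a first zero of [h] either [lam]
    stays bounded, or the preimages tend to the boundary sphere of an open ball,
    which the maximum principle excludes. *)
Lemma selfmap_onto lam phi (T : H -> H) : ~ entire a -> wco lam phi T ->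
  forall y, DX y -> exists2 x, DX x & phi x = y.
Proof.
move=> na hT; have ga := wh_generating hH.
have [_ _ _ [S [_ ST Slin [N SN]]]] := hT.
have rng := @selfmap_range _ _ _ _ hH _ _ _ hT _ ST Slin _ SN.
set h := S (one hH) in rng.
have Bp := selfmap_center hH hT; have Xp := open_domain_sub ga Bp.
have X0 : DX 0 := open_domain_sub ga (open_domain0 ga (d := d.+1)).
have hp : ev h (phi 0) != 0.
  rewrite (inv_ev hH hT ST) // ev_one // mul1r invr_eq0; exact: (wco_neq0 hH hT).
have inv_at q : DX q -> ev h q != 0 -> exists x, [/\ DX x, lam x * ev h q = 1 &
    forall j, ev (S (crd hH j)) q = x 0 j * ev h q].
  move=> Xq hq; have [x Xx <-] := rng q Xq hq; exists x; split=> //.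
    by rewrite (inv_ev hH hT ST) // ev_one // mul1r divff // (wco_neq0 hH hT).
  by move=> j; rewrite !(inv_ev hH hT ST) // ev_one // ev_crd // mul1r.
suff hn0 y : DX y -> ev h y != 0 by move=> y Xy; apply: rng => //; exact: hn0.
move=> Xy; apply/eqP => hy.
have [sg [sg0 sg1 hsg below]] := first_zero Xp Xy hp hy.
set p := phi 0 in Bp Xp hp hsg below.
have Xseg t : 0 <= t -> t <= 1 -> DX (p + t%:C *: (y - p)).
  exact: (segment_domain ga Xp Xy).
have [r [r0 hB hr [[closed hsum]|hopen]]] := natural_domain_cases ga na (d := d.+1).
  (* closed ball: evaluations, hence [lam], are uniformly bounded *)
  have [B B0 hBd] := ev_unif hH hsum.
  pose L := B * hn (T (one hH)); have L0 : 0 <= L by rewrite mulr_ge0 // hn_ge0.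
  have lamL x : DX x -> nc (lam x) <= L.
    move=> Xx; rewrite (wco_lamE hH hT) //; apply: hBd.
    by apply: lerXn2r; rewrite ?nnegrE ?en_ge0 ?(ltW r0) // hr.
  have e0 : 0 < (L + 1)^-1 by rewrite invr_gt0 ltr_wpDl.
  have [del d0 hd] := ev_segment hH h Xp Xy (ltW sg0) sg1 e0.
  have [t [t0 tsg tdel]] := real_between sg0 d0.
  have t1 : t <= 1 by apply: le_trans sg1; exact: ltW.
  have := hd t t0 t1 tdel; rewrite hsg subr0 => small.
  have [x [Xx lx _]] := inv_at _ (Xseg t t0 t1) (below t t0 tsg).
  have := nc1 (R := R); rewrite -lx ncM => e1.
  have : nc (lam x) * nc (ev h (p + t%:C *: (y - p))) <= L * (L + 1)^-1.
    by apply: ler_pM; rewrite ?nc_ge0 ?lamL // ltW.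
  rewrite e1 leNgt => /negP; apply.
  by rewrite ltr_pdivrMr ?ltr_wpDl // mul1r ltrDl.
(* open ball: divide [h] and the [S z_j] by the power of the variable given by
   the order of the zero *)
pose v := y - p; pose q := p + sg%:C *: v.
have Bq : DB q by case: (hopen _ (Xseg sg (ltW sg0) sg1)).
have v0 : v != 0.
  by apply/eqP => e; move: hy hp; rewrite (_ : y = p) ?(subr0_eq e) // => ->; rewrite eqxx.
have nv := en_gt0 v0.
have [s [s0 hDB htay]] := ev_tay hH Bq nv.
have [Mh /(_ v (lexx _)) [e he _]] := htay h.
have /choice [Mg hMg] : forall j, exists M, exists c,
    tay (fun eta => ev (S (crd hH j)) (q + eta *: v)) M s c.
  by move=> j; have [M /(_ v (lexx _)) [c hc _]] := htay (S (crd hH j)); exists M, c.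
have [cg hcg] := choice hMg.
have [k0 ek0] : exists k, e k != 0.
  apply: contrapT => /forallNP ez.
  have {}ez k : e k = 0 by apply/eqP/negPn/negP; exact: ez.
  have [t [t0 tsg tdel]] := real_between sg0 s0.
  have := below t t0 tsg; have := tay_all0 he ez (eta := (t - sg)%:C).
  rewrite nc_real /q -addrA -scalerDl -rcD [sg + _]addrC subrK => /(_ tdel) ->.
  by rewrite eqxx.
have exk : exists k, e k != 0 by exists k0.
case: (ex_minnP exk) => m em mmin.
have elow k : (k < m)%N -> e k = 0.
  by move=> km; apply/eqP/negPn/negP => /mmin; rewrite leqNgt km.
have tD := tay_shift he elow; set D := shift_fun _ e m in tD.
have D0 : D 0 = e m by rewrite /D /shift_fun eqxx.
have Dne0 : 0 < nc (D 0) by rewrite D0 nc_gt0.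
have DE (eta : C) : eta != 0 -> ev h (q + eta *: v) = D eta * eta ^+ m.
  by move=> h0; rewrite /D /shift_fun (negPf h0) divfK // expf_neq0.
have Dh : 0 < nc (D 0) / 2 by rewrite divr_gt0.
have [del1 d10 hd1] := tay_cont tD Dh.
have Dbig eta : nc eta < del1 -> nc (D 0) / 2 <= nc (D eta).
  move=> /hd1 lt; have : nc (D 0) <= nc (D eta) + nc (D eta - D 0).
    by rewrite -{1}(subKr (D eta) (D 0)) ncB.
  rewrite {1}[nc (D 0)]splitr => le; rewrite -(lerD2r (nc (D 0) / 2)).
  by apply: (le_trans le); rewrite lerD2l ltW.
pose del2 := Num.min del1 s; have d20 : 0 < del2 by rewrite lt_min d10.
have pt (eta : C) : eta != 0 -> nc eta < del2 -> exists x, [/\ DX x,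
    lam x * ev h (q + eta *: v) = 1 &
    forall j, ev (S (crd hH j)) (q + eta *: v) = x 0 j * ev h (q + eta *: v)].
  move=> h0; rewrite lt_min => /andP[h1 h2].
  apply: inv_at; first by apply: (open_domain_sub ga); apply: hDB => //; exact: ltW.
  rewrite DE // mulf_neq0 ?expf_neq0 // -nc_gt0.
  exact: lt_le_trans (Dbig _ h1).
have cglow j k : (k < m)%N -> cg j k = 0.
  apply: (tay_order (A := r * (2 * Mh / s ^+ m)) (hcg j)) => delta del0.
  pose t := Num.min delta del2 / 2.
  have mm0 : 0 < Num.min delta del2 by rewrite lt_min del0.
  have t0 : 0 < t by rewrite divr_gt0.
  have nt : nc t%:C = t by rewrite nc_real ger0_norm // ltW.
  have tt : t < Num.min delta del2 by rewrite ltr_pdivrMr // ltr_pMr // ltr1n.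
  move: (tt); rewrite lt_min => /andP[tdel td2].
  have tn0 : t%:C != 0 :> C by rewrite rc_eq0 gt_eqF.
  exists t%:C; rewrite nt; split=> //.
  have ntd : nc t%:C < del2 by rewrite nt.
  have [x [Xx _ xj]] := pt t%:C tn0 ntd.
  rewrite xj DE // !ncM ncX nt mulrA ler_wpM2r ?exprn_ge0 ?(ltW t0) //.
  apply: ler_pM; rewrite ?nc_ge0 //.
    by apply: (le_trans (nc_le_en _ _)); exact: hr.
  apply: (tay_bound tD); rewrite nt ltW // (lt_le_trans td2) //.
  by rewrite ge_min lexx orbT.
have tu j := tay_shift (hcg j) (cglow j).
pose u j := shift_fun (fun eta => ev (S (crd hH j)) (q + eta *: v)) (cg j) m.
have uE (eta x : C) j : eta != 0 ->
    ev (S (crd hH j)) (q + eta *: v) = x * ev h (q + eta *: v) -> u j eta = x * D eta.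
  move=> h0 ex; rewrite /u /shift_fun (negPf h0) ex DE // mulrA mulfK //.
  by rewrite expf_neq0.
have D00 : D 0 != 0 by rewrite -nc_gt0.
pose x0 : V := \row_j (u j 0 / D 0).
have x0E j : u j 0 = x0 0 j * D 0 by rewrite mxE divfK.
(* the preimages of points of the line tend to x0 *)
have lim (eps : R) : 0 < eps -> exists2 del : R, 0 < del & forall (eta : C) (x : V),
    eta != 0 -> nc eta < del ->
    (forall j, ev (S (crd hH j)) (q + eta *: v) = x 0 j * ev h (q + eta *: v)) ->
    en (x - x0) < eps.
  move=> eps0; pose K := (d.+1)%:R : R; have K0 : 0 < K by rewrite ltr0n.
  pose ep := eps / K * (nc (D 0) / 2) * nc (D 0).
  have ep0 : 0 < ep by rewrite !mulr_gt0 // invr_gt0.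
  have [del3 d30 h3] : exists2 del : R, 0 < del & forall eta, nc eta < del ->
      forall j, nc (u j eta * D 0 - u j 0 * D eta) < ep.
    apply: (fin_delta (m := @Normc.normc R)) => j.
    have tw := tay_sub (tay_scale (D 0) (tu j)) (tay_scale (u j 0) tD).
    have [del dd hd] := tay_cont tw ep0; exists del => // eta /hd.
    by rewrite -/(u j) [D 0 * u j 0]mulrC subrr subr0 [D 0 * _]mulrC.
  exists (Num.min del3 del1); first by rewrite lt_min d30.
  move=> eta x h0; rewrite lt_min => /andP[e3 e1] xj.
  have cj j : nc ((x - x0) 0 j) < eps / K.
    have := h3 eta e3 j; rewrite (uE _ _ _ h0 (xj j)) x0E.
    have -> : x 0 j * D eta * D 0 - x0 0 j * D 0 * D eta =
      (x - x0) 0 j * D eta * D 0 by rewrite !mxE; ring.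
    rewrite !ncM /ep ltr_pM2r // => lt.
    rewrite -(ltr_pM2r Dh); apply: le_lt_trans lt.
    by rewrite ler_wpM2l ?nc_ge0 // Dbig.
  apply: (le_lt_trans (en_le_sum _)).
  apply: (@lt_le_trans _ _ (\sum_(j < d.+1) eps / K)).
    by apply: ltr_sum => //; apply/hasP; exists 0; rewrite ?mem_index_enum.
  by rewrite sumr_const card_ord -[_ *+ _]mulr_natr divfK // gt_eqF.
have pick (del : R) : 0 < del -> exists2 eta : C, eta != 0 & nc eta < del.
  move=> dd; exists (del / 2)%:C; first by rewrite rc_eq0 gt_eqF // divr_gt0.
  by rewrite nc_real ger0_norm ?divr_ge0 ?(ltW dd) // ltr_pdivrMr // ltr_pMr // ltr1n.
have x0r : en x0 <= r.
  apply/ler_addgt0Pl => eps eps0; have [del dd hd] := lim eps eps0.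
  have mm : 0 < Num.min del del2 by rewrite lt_min dd.
  have [eta h0] := pick _ mm.
  rewrite lt_min => /andP[e1 e2]; have [x [Xx _ xj]] := pt _ h0 e2.
  rewrite -[x0](subrK x) addrC; apply: (le_trans (enD _ _)); rewrite addrC.
  by apply: lerD; [rewrite en_dist ltW // (hd eta)|exact: hr].
have [xlt|xge] := ltP (en x0) r.
  have Xx0 : DX x0 by apply: (open_domain_sub ga); exact: hB.
  have [del3 d30 h3] := ev_cont hH (T (one hH)) Xx0 ltr01.
  pose L := nc (lam x0) + 1; have L0 : 0 < L by rewrite ltr_wpDl ?nc_ge0.
  have [del4 d40 h4] := lim del3 d30.
  have iL : 0 < L^-1 by rewrite invr_gt0.
  have [del5 d50 h5] := tay_cont he iL.
  have mm : 0 < Num.min (Num.min del4 del2) del5 by rewrite 2!lt_min d40 d20.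
  have [eta h0] := pick _ mm.
  rewrite 2!lt_min => /andP[/andP[e4 e2] e5].
  have [x [Xx lx xj]] := pt _ h0 e2.
  have xx := h4 eta x h0 e4 xj; have := h3 x Xx xx.
  rewrite -!(wco_lamE hH hT) // => dl.
  have lxL : nc (lam x) < L.
    rewrite -(subrK (lam x0) (lam x)); apply: (le_lt_trans (ncD _ _)).
    by rewrite addrC ltrD2l.
  have := h5 eta e5; rewrite scale0r addr0 -/q hsg subr0 => hs5.
  have := nc1 (R := R); rewrite -lx ncM => e1.
  have : nc (lam x) * nc (ev h (q + eta *: v)) < L * L^-1.
    by apply: ltr_pM; rewrite ?nc_ge0.
  by rewrite e1 divff ?gt_eqF // ltxx.
have xr : en x0 = r by apply/eqP; rewrite eq_le x0r.
have usum (x : V) (eta : C) : (forall j, u j eta = x 0 j * D eta) ->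
    \sum_j nc (u j eta) ^+ 2 = en x ^+ 2 * nc (D eta) ^+ 2.
  move=> hx; rewrite en_sqr mulr_suml; apply: eq_bigr => j _.
  by rewrite hx ncM exprMn.
have [||del3 d30 h3] := tay_max_vec tu tD D00 (ltW r0) d20.
- move=> eta he2; rewrite -/(u _); have [->|h0] := eqVneq eta 0.
    by rewrite (usum _ _ x0E) xr.
  have [x [Xx _ xj]] := pt _ h0 he2.
  rewrite (usum x) => [|j]; last exact: uE.
  apply: ler_wpM2r; first exact: sqr_ge0.
  by apply: lerXn2r; rewrite ?nnegrE ?en_ge0 ?(ltW r0) // hr.
- by rewrite (usum _ _ x0E) xr.
have mm : 0 < Num.min del3 del2 by rewrite lt_min d30.
have [eta h0] := pick _ mm.
rewrite lt_min => /andP[e3 e2]; have [x [Xx _ xj]] := pt _ h0 e2.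
have xx0 : x = x0.
  apply/rowP => j; have := h3 eta e3 j; rewrite -/(u j) (uE _ _ _ h0 (xj j)) x0E.
  have De : D eta != 0.
    rewrite -nc_gt0; apply: lt_le_trans (Dbig _ _) => //.
    by apply: lt_le_trans e2 _; rewrite ge_min lexx.
  have DD : D eta * D 0 != 0 by rewrite mulf_neq0.
  by move=> ee; apply: (mulIf DD); rewrite mulrA ee; ring.
by have [_] := hopen _ Xx; rewrite xx0 xr ltxx.
Qed.

End Onto.

(** * Isomorphisms with mutually inverse symbols *)

Section SymbolContinuity.
Context {R : realType} {d1 d2 : nat} {a b : nat -> R}
    {H1 : hilbert_function_space R (@natural_domain R d1 a)}
    {H2 : hilbert_function_space R (@natural_domain R d2 b)}
    (hH1 : weighted_hardy H1) (hH2 : weighted_hardy H2).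
Local Notation C := R[i].
Local Notation DX := (@natural_domain R d1 a).

(** The symbol is a quotient of elements of the space, which are continuous up to
    the boundary, by one of them without zeros. *)
Lemma wco_cont lam phi (W : H2 -> H1) z (e : R) : wco lam phi W -> DX z -> 0 < e ->
  exists2 del : R, 0 < del & forall w, DX w -> en (w - z) < del ->
    en (phi w - phi z) < e.
Proof.
move=> hW Xz e0; have lz : 0 < nc (lam z) by rewrite nc_gt0 (wco_neq0 hH1 hW).
have lz2 : 0 < nc (lam z) / 2 by rewrite divr_gt0.
have [del1 d10 h1] := ev_cont hH1 (W (one hH2)) Xz lz2.
pose K : R := d2%:R + 1; have K0 : 0 < K by rewrite ltr_wpDl.
have e1 : 0 < e / K * (nc (lam z) / 2) by rewrite !mulr_gt0 // invr_gt0.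
have [del2 d20 h2] : exists2 del : R, 0 < del & forall w,
    en (w - z) < del -> forall j, DX w -> nc ((lam w * (phi w - phi z) 0 j)) < e / K * (nc (lam z) / 2).
  apply: (fin_delta (m := fun w => en (w - z))) => j.
  pose g := W (crd hH2 j) - phi z 0 j *: W (one hH2).
  have gE w : DX w -> ev g w = lam w * (phi w - phi z) 0 j.
    move=> Xw; rewrite evB evZ (wco_phiE hH2 hW) // -(wco_lamE hH2 hW) // !mxE; ring.
  have [del dd hd] := ev_cont hH1 g Xz e1; exists del => // w hw Xw.
  have z0 : ev g z = 0 by rewrite gE // subrr mxE mulr0.
  by have := hd w Xw hw; rewrite z0 subr0 gE.
exists (Num.min del1 del2); first by rewrite lt_min d10.
move=> w Xw; rewrite lt_min => /andP[w1 w2].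
have big : nc (lam z) / 2 <= nc (lam w).
  have := h1 w Xw w1; rewrite -!(wco_lamE hH2 hW) // => lt.
  have : nc (lam z) <= nc (lam w) + nc (lam w - lam z).
    by rewrite -{1}(subKr (lam w) (lam z)) ncB.
  rewrite {1}[nc (lam z)]splitr => le; rewrite -(lerD2r (nc (lam z) / 2)).
  by apply: (le_trans le); rewrite lerD2l ltW.
have cj j : nc ((phi w - phi z) 0 j) <= e / K.
  have := h2 w w2 j Xw; rewrite ncM => lt.
  rewrite -(ler_pM2r lz2); apply: le_trans (ltW lt).
  by rewrite mulrC ler_wpM2r ?nc_ge0.
apply: (le_lt_trans (en_le_sum _)).
apply: (@le_lt_trans _ _ (\sum_(j < d2) e / K)); first exact: ler_sum.
rewrite sumr_const card_ord -[_ *+ _]mulr_natr mulrAC ltr_pdivrMr //.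
by rewrite ltr_pM2l // ltrDl.
Qed.

End SymbolContinuity.

Section Isomorphisms.
Context {R : realType}.
Local Notation C := R[i].

Definition wiso {d1 d2 : nat} {a b : nat -> R}
    (H1 : hilbert_function_space R (@natural_domain R d1 a))
    (H2 : hilbert_function_space R (@natural_domain R d2 b))
    (phi : 'rV[C^o]_d1 -> 'rV[C^o]_d2) (theta : 'rV[C^o]_d2 -> 'rV[C^o]_d1) :=
  [/\ exists lam (W : H2 -> H1), wco lam phi W,
      exists mu (S : H1 -> H2), wco mu theta S,
      forall x, natural_domain a x -> theta (phi x) = x &
      forall y, natural_domain b y -> phi (theta y) = y].

Lemma wiso_sym {d1 d2 : nat} {a b : nat -> R}
    (H1 : hilbert_function_space R (@natural_domain R d1 a))
    (H2 : hilbert_function_space R (@natural_domain R d2 b)) phi theta :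
  wiso H1 H2 phi theta -> wiso H2 H1 theta phi.
Proof. by case. Qed.

Lemma wiso_comp {d1 d2 d3 : nat} {a b c : nat -> R}
    (H1 : hilbert_function_space R (@natural_domain R d1 a))
    (H2 : hilbert_function_space R (@natural_domain R d2 b))
    (H3 : hilbert_function_space R (@natural_domain R d3 c)) phi theta phi' theta' :
  wiso H1 H2 phi theta -> wiso H2 H3 phi' theta' ->
  wiso H1 H3 (phi' \o phi) (theta \o theta').
Proof.
move=> [[l [W hW]] [m [S hS]] h1 h2] [[l' [W' hW']] [m' [S' hS']] h1' h2']; split.
- by exists (fun z => l z * l' (phi z)), (W \o W'); exact: wco_comp.
- by exists (fun z => m' z * m (theta' z)), (S' \o S); exact: wco_comp.
- by move=> x Xx; rewrite /= h1' ?h1 //; exact: (wco_dom hW Xx).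
- by move=> y Xy; rewrite /= h2 ?h2' //; exact: (wco_dom hS' Xy).
Qed.

Lemma wiso_unitary {d : nat} {a : nat -> R}
    (H : hilbert_function_space R (@natural_domain R d a)) (hH : weighted_hardy H)
    (U : 'M[C]_d) : U \is unitarymx ->
  wiso H H (fun z => z *m U) (fun z => z *m (U^t*)%sesqui).
Proof.
move=> uU; have uU' : (U^t*)%sesqui \is unitarymx by rewrite trmxC_unitary.
split.
- by have [W hW] := wco_unitary hH uU; exists (fun=> 1), W.
- by have [W hW] := wco_unitary hH uU'; exists (fun=> 1), W.
- by move=> x _; rewrite -mulmxA (unitarymxP uU) mulmx1.
- move=> x _; have := unitarymxP uU'; rewrite trmxCK => h.
  by rewrite -mulmxA h mulmx1.
Qed.

(** Let [psi] be the symbol of the other operator.  If [psi (phi x) = psi y], then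
    [phi x = y] by injectivity of [psi]: surjectivity of [psi o phi] passes to
    [phi]. *)
Lemma wiso_of_strongly_related {d1 d2 : nat} {a b : nat -> R}
    (H1 : hilbert_function_space R (@natural_domain R d1.+1 a))
    (H2 : hilbert_function_space R (@natural_domain R d2 b))
    (hH1 : weighted_hardy H1) (hH2 : weighted_hardy H2) :
  ~ entire a -> strongly_related H1 H2 -> exists phi theta, wiso H1 H2 phi theta.
Proof.
move=> na [/(wco_of_weakly_related hH2) [lam [phi [W hW]]]].
move=> /(wco_of_weakly_related hH1) [mu [psi [W' hW']]].
have onto1 := selfmap_onto hH1 na (wco_comp hW hW').
have onto y : natural_domain b y -> exists x, natural_domain a x /\ phi x = y.
  move=> Xy; have [x Xx e] := onto1 _ (wco_dom hW' Xy); exists x; split=> //.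
  exact: (wco_inj hH2 hW' (wco_dom hW Xx) Xy e).
have /choice [theta ht] : forall y, exists x, natural_domain b y ->
    natural_domain a x /\ phi x = y.
  move=> y; have [Xy|nX] := pselect (natural_domain b y); last by exists 0.
  by have [x hx] := onto y Xy; exists x.
exists phi, theta; split.
- by exists lam, W.
- have [m [S hS]] := wco_inv hH1 hW ht; by exists m, S.
- move=> x Xx; have [Xt e] := ht _ (wco_dom hW Xx).
  exact: (wco_inj hH1 hW Xt Xx e).
- by move=> y /ht [].
Qed.

End Isomorphisms.

(** * The values of a symbol on a disc *)

Section Recenter.
Context {R : realType} {d1 d2 : nat} {a b : nat -> R}
    {H1 : hilbert_function_space R (@natural_domain R d1.+1 a)}
    {H2 : hilbert_function_space R (@natural_domain R d2.+1 b)}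
    (hH1 : weighted_hardy H1) (hH2 : weighted_hardy H2).
Local Notation C := R[i].
Local Notation V1 := 'rV[C^o]_d1.+1.
Local Notation V2 := 'rV[C^o]_d2.+1.

Local Open Scope classical_set_scope.

(** Real coordinates, in which the disc is a compact subset of the plane. *)
Definition plane (x : R * R) : C := x.1 +i* x.2.

Lemma nc_plane_le (x y : R * R) : nc (plane x - plane y) <= `|x.1 - y.1| + `|x.2 - y.2|.
Proof. exact: nc_le_ReIm. Qed.

Lemma nc_plane_sqr (x : R * R) : nc (plane x) ^+ 2 = x.1 ^+ 2 + x.2 ^+ 2.
Proof. by rewrite /plane /Normc.normc sqr_sqrtr // addr_ge0 // sqr_ge0. Qed.

Definition disc : set (R * R) := [set x | x.1 ^+ 2 + x.2 ^+ 2 <= 1].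

Lemma disc_compact : compact disc.
Proof.
have cA : compact (`[(-1 : R), 1] `*` `[(-1 : R), 1]).
  by apply: compact_setX; exact: segment_compact.
apply: (subclosed_compact _ cA).
  have -> : disc = (fun x : R * R => x.1 * x.1 + x.2 * x.2) @^-1` [set t | t <= 1] by [].
  apply: closed_comp; last exact: closed_le.
  move=> x _; rewrite /continuous_at.
  apply: (@cvgD _ R^o); rewrite ?expr2; apply: (@cvgM R); first [exact: cvg_fst|exact: cvg_snd].
move=> [x y]; rewrite /disc /= => h.
have aux (u v : R) : u ^+ 2 + v ^+ 2 <= 1 -> (`[(-1 : R), 1] : set R) u.
  move=> huv; rewrite /= in_itv /= -ler_norml -(ler_pXn2r (_ : (0 < 2)%N)) ?nnegrE //.
  rewrite real_normK ?num_real // expr1n; apply: le_trans huv.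
  by rewrite lerDl sqr_ge0.
by split; [exact: (aux x y)|apply: (aux y x); rewrite addrC].
Qed.

(** The norm of [theta] attains a maximum on the compact disc through [p]; a maximum
    in its interior is excluded by [wco_no_max]. *)
Lemma max_on_circle (theta : V2 -> V1) mu (S : H1 -> H2) (p : V2) :
  wco mu theta S -> open_domain b p -> p != 0 ->
  exists x : R * R, x.1 ^+ 2 + x.2 ^+ 2 = 1 /\
    en (theta 0) <= en (theta (plane x *: p)).
Proof.
move=> hS Bp p0; have gb := wh_generating hH2; have np := en_gt0 p0.
have nplane x : disc x -> nc (plane x) <= 1.
  move=> Dx; rewrite -(ler_pXn2r (_ : (0 < 2)%N)) ?nnegrE ?nc_ge0 //.
  by rewrite nc_plane_sqr expr1n.
have Bd x : disc x -> open_domain b (plane x *: p).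
  move=> Dx; apply: (open_domain_le gb _ Bp); rewrite enZ.
  by rewrite ler_piMl ?en_ge0 // nplane.
pose N (x : R * R) : R := en (theta (plane x *: p)).
have cN : {within disc, continuous N}.
  apply/subspace_continuousP => x Dx; apply/cvgrPdist_lt => e e0.
  have [del d0 hd] := wco_cont hH2 hH1 hS (open_domain_sub gb (Bd x Dx)) e0.
  have dp0 : 0 < del / en p / 2 by rewrite !divr_gt0.
  rewrite near_withinE.
  have near1 : \forall y \near x, `|x.1 - y.1| < del / en p / 2.
    have : fst @ x --> x.1 by exact: cvg_fst.
    by move=> /cvgrPdist_lt /(_ _ dp0).
  have near2 : \forall y \near x, `|x.2 - y.2| < del / en p / 2.
    have : snd @ x --> x.2 by exact: cvg_snd.
    by move=> /cvgrPdist_lt /(_ _ dp0).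
  near=> y => Dy.
  have yx : en (theta (plane y *: p) - theta (plane x *: p)) < e.
    apply: hd; first exact: (open_domain_sub gb (Bd y Dy)).
    rewrite -scalerBl enZ -ltr_pdivlMr // nc_dist.
    apply: (le_lt_trans (nc_plane_le _ _)); rewrite [ltRHS]splitr; apply: ltrD.
      by near: y.
    by near: y.
  by apply: (le_lt_trans (en_lip _ _)); rewrite en_dist.
have D0 : disc (0, 0) by rewrite /disc /= expr0n /= addr0.
have [|c] := compact_EVT_max _ disc_compact cN; first by exists (0, 0).
rewrite inE => Dc cmax.
have Nc x : disc x -> N x <= N c by move=> Dx; apply: cmax; rewrite inE.
exists c; have [c1|c1] := eqVneq (c.1 ^+ 2 + c.2 ^+ 2) 1.
  split=> //; have := Nc _ D0; rewrite /N (_ : plane (0, 0) = 0) // scale0r.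
  by [].
exfalso.
have clt : nc (plane c) < 1.
  rewrite lt_neqAle nplane // andbT; apply/eqP => e; move/eqP: c1; apply.
  by rewrite -nc_plane_sqr e expr1n.
have d0 : 0 < 1 - nc (plane c) by rewrite subr_gt0.
apply: (wco_no_max hH2 hH1 hS (Bd c Dc) p0 d0) => eta he _.
rewrite -scalerDl.
have -> : plane c + eta = plane (complex.Re (plane c + eta), complex.Im (plane c + eta)).
  by case: (plane c + eta).
apply: Nc; rewrite /disc /mkset -nc_plane_sqr.
have -> : plane (complex.Re (plane c + eta), complex.Im (plane c + eta)) = plane c + eta.
  by case: (plane c + eta).
rewrite -[leRHS](expr1n R 2); apply: lerXn2r; rewrite ?nnegrE ?nc_ge0 //.
apply: (le_trans (ncD _ _)); rewrite addrC -lerBrDr; exact: ltW.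
Unshelve. all: by end_near.
Qed.

(** Intermediate values along the arc of circle from 1 to [plane x]. *)
Lemma rotate_to_norm (theta : V2 -> V1) mu (S : H1 -> H2) (p : V2) (q : R) x :
  wco mu theta S -> natural_domain b p -> x.1 ^+ 2 + x.2 ^+ 2 = 1 ->
  en (theta p) <= q -> q <= en (theta (plane x *: p)) ->
  exists2 c : C, nc c = 1 & en (theta (c *: p)) = q.
Proof.
move=> hS Xp x1 qp qx; have gb := wh_generating hH2.
pose sg : R := if 0 <= x.2 then 1 else -1.
pose z (t : R) : C := plane (cos t, sg * sin t).
have sg2 : sg ^+ 2 = 1 by rewrite /sg; case: ifP => _; rewrite ?sqrrN expr1n.
have z1 t : nc (z t) = 1.
  apply/eqP; rewrite -(eqrXn2 (_ : (0 < 2)%N)) ?nc_ge0 // nc_plane_sqr /= exprMn sg2.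
  by rewrite mul1r cos2Dsin2 expr1n.
have x1i : -1 <= x.1 <= 1.
  rewrite -ler_norml -(ler_pXn2r (_ : (0 < 2)%N)) ?nnegrE //.
  by rewrite real_normK ?num_real // expr1n -x1 lerDl sqr_ge0.
pose t1 := acos x.1.
have t10 : 0 <= t1 by exact: acos_ge0.
have zt1 : z t1 = plane x.
  rewrite /z /t1 acosK // sin_acos //.
  have -> : 1 - x.1 ^+ 2 = x.2 ^+ 2 by rewrite -x1 addrC addKr.
  rewrite sqrtr_sqr /sg /plane /=; congr (_ +i* _).
  by case: ifP => h; [rewrite mul1r ger0_norm|rewrite mulN1r ltr0_norm ?opprK // ltNge h].
have z0 : z 0 = 1 by rewrite /z cos0 sin0 mulr0.
pose N (t : R) := en (theta (z t *: p)).
have Xz t : natural_domain b (z t *: p).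
  by apply: (domain_le gb _ Xp); rewrite enZ z1 mul1r.
have cz t (e : R) : 0 < e -> \forall u \near t, nc (z u - z t) < e.
  move=> e0; have e2 : 0 < e / 2 by rewrite divr_gt0.
  have h1 : \forall u \near t, `|cos t - cos u| < e / 2.
    by have /cvgrPdist_lt /(_ _ e2) := @continuous_cos R t.
  have h2 : \forall u \near t, `|sin t - sin u| < e / 2.
    by have /cvgrPdist_lt /(_ _ e2) := @continuous_sin R t.
  near=> u; rewrite nc_dist; apply: (le_lt_trans (nc_plane_le _ _)).
  rewrite [ltRHS]splitr /= -mulrBr normrM.
  have -> : `|sg| = 1 by rewrite /sg; case: ifP => _; rewrite ?normrN normr1.
  by rewrite mul1r; apply: ltrD; near: u.
have cN : continuous N.
  move=> t; apply/cvgrPdist_lt => e e0.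
  have [del d0 hd] := wco_cont hH2 hH1 hS (Xz t) e0.
  have n1 : 0 < en p + 1 by rewrite ltr_wpDl ?en_ge0.
  have e1 : 0 < del / (en p + 1) by rewrite divr_gt0.
  near=> u.
  have hu : nc (z u - z t) < del / (en p + 1) by near: u; exact: cz.
  have yx : en (theta (z u *: p) - theta (z t *: p)) < e.
    apply: hd => //; rewrite -scalerBl enZ.
    move: hu; rewrite ltr_pdivlMr // => hu; apply: le_lt_trans hu.
    by rewrite ler_wpM2l ?nc_ge0 // lerDl.
  by apply: (le_lt_trans (en_lip _ _)); rewrite en_dist.
have wN : {within `[0, t1], continuous N} by apply: continuous_subspaceT.
have [|t _ Nt] := @IVT R N 0 t1 q t10 wN.
  rewrite ge_min le_max /N z0 scale1r zt1 qp qx orbT.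
  by [].
by exists (z t).
Unshelve. all: by end_near.
Qed.

End Recenter.

(** * Normalization of the symbol *)

Section Normalize.
Context {R : realType} {d1 d2 : nat} {a b : nat -> R}
    {H1 : hilbert_function_space R (@natural_domain R d1.+1 a)}
    {H2 : hilbert_function_space R (@natural_domain R d2.+1 b)}
    (hH1 : weighted_hardy H1) (hH2 : weighted_hardy H2).
Local Notation C := R[i].
Local Notation V1 := 'rV[C^o]_d1.+1.
Local Notation V2 := 'rV[C^o]_d2.+1.

Lemma unitary_scalar (c : C) d : nc c = 1 -> (c%:M : 'M[C]_d) \is unitarymx.
Proof.
move=> c1; apply/unitarymxP; rewrite tr_scalar_mx map_scalar_mx /= -scalar_mxM.
by congr (_%:M); rewrite -[RHS]/(1%:C) -(expr1n R 2) -c1 nc_sqr.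
Qed.

(** Let [p := phi 0].  For some [c] of modulus 1, [theta (c p)] has the norm of
    [theta 0], since it vanishes for [c = 1] and is at least as long for some
    other [c]; then [phi o V o theta o c o phi] maps 0 to 0 when [V] is a unitary
    sending [theta (c p)] to [theta 0]. *)
Lemma wiso_fix0 (phi : V1 -> V2) (theta : V2 -> V1) : wiso H1 H2 phi theta ->
  exists tau sigma, wiso H1 H2 tau sigma /\ tau 0 = 0.
Proof.
move=> h; have [[lam [W hW]] [mu [S hS]] tp pt] := h.
have ga := wh_generating hH1; have gb := wh_generating hH2.
have [p0|p0] := eqVneq (phi 0) 0; first by exists phi, theta.
have X0 := open_domain_sub ga (open_domain0 ga (d := d1.+1)).
have Y0 := open_domain_sub gb (open_domain0 gb (d := d2.+1)).
have Bp : open_domain b (phi 0) := wco_center hH1 hH2 hW.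
have Xp := open_domain_sub gb Bp.
have [x [x1 qx]] := max_on_circle hH1 hH2 hS Bp p0.
have pq : en (theta (phi 0)) <= en (theta 0) by rewrite tp // en0 en_ge0.
have [c c1 ce] := rotate_to_norm hH1 hH2 hS Xp x1 pq qx.
have [M1 u1 e1] := unitary_to_axis (theta (c *: phi 0)).
have [M2 u2 e2] := unitary_to_axis (theta 0).
have h1 := wiso_comp h (wiso_unitary hH2 (unitary_scalar d2.+1 c1)).
have h2 := wiso_comp (wiso_comp h1 (wiso_sym h)) (wiso_unitary hH1 u1).
have h3 := wiso_comp (wiso_comp h2 (wiso_sym (wiso_unitary hH1 u2))) h.
eexists; eexists; split; first exact: h3.
rewrite /= mul_mx_scalar e1 ce -e2 -mulmxA (unitarymxP u2) mulmx1.
by rewrite pt.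
Qed.

Lemma en_mulmx (d d' : nat) (B : 'M[C]_(d, d')) : exists2 N : R, 0 <= N &
  forall z : 'rV[C^o]_d, en (z *m B : 'rV[C^o]_d') <= N * en z.
Proof.
exists (\sum_j \sum_i nc (B i j)) => [|z].
  by apply: sumr_ge0 => j _; apply: sumr_ge0 => i _; exact: nc_ge0.
apply: (le_trans (en_le_sum _)); rewrite mulr_suml; apply: ler_sum => j _.
by rewrite mxE; exact: nc_lin.
Qed.

End Normalize.

Section AxisGerm.
Context {R : realType}.
Local Notation C := R[i].

(** [tau (t e0) = t s e0 + O(t^2)] for small real [t]. *)
Definition axis_germ {d1 d2 : nat} (a : nat -> R) (s : R)
    (tau : 'rV[C^o]_d1.+1 -> 'rV[C^o]_d2.+1) :=
  exists K t0, [/\ 0 < t0, 0 <= K & forall t : R, 0 < t -> t <= t0 ->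
    natural_domain a (t%:C *: e0 : 'rV[C^o]_d1.+1) /\
    en (tau (t%:C *: e0) - (t * s)%:C *: e0) <= K * t ^+ 2].

Lemma en_te0 {d : nat} (t : R) : 0 <= t -> en (t%:C *: e0 : 'rV[C^o]_d.+1) = t.
Proof. by move=> t0; rewrite enZ en_e0 mulr1 nc_real ger0_norm. Qed.

(** A rotation of the target sends the derivative of [tau] in the direction [e0] to a
    multiple [s e0] with [s >= 0]; as [sigma o tau] is the identity, the
    derivative of [sigma] sends [s e0] to [e0], whence [s <> 0]. *)
Lemma wiso_axis {d1 d2 : nat} {a b : nat -> R}
    {H1 : hilbert_function_space R (@natural_domain R d1.+1 a)}
    {H2 : hilbert_function_space R (@natural_domain R d2.+1 b)}
    (hH1 : weighted_hardy H1) (hH2 : weighted_hardy H2) tau sigma :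
  wiso H1 H2 tau sigma -> tau 0 = 0 ->
  exists s tau' sigma', [/\ wiso H1 H2 tau' sigma', 0 < s,
    axis_germ a s tau' & axis_germ b s^-1 sigma'].
Proof.
move=> h tau0; have [[lam [W hW]] _ _ _] := h; have ga := wh_generating hH1.
have [A [sA [KA [sA0 KA0 hA]]]] := wco_diff hH1 hH2 hW.
have [U uU eU] := unitary_to_axis (e0 *m A : 'rV[C^o]_d2.+1).
set s := en _ in eU.
have h' := wiso_comp h (wiso_unitary hH2 uU).
set tau' := (_ \o tau) in h'; set sigma' := (sigma \o _) in h'.
have [_ [mu [S hS]] st ts] := h'.
have X0 := open_domain_sub ga (open_domain0 ga (d := d1.+1)).
have tau'0 : tau' 0 = 0 by rewrite /tau' /= tau0 mul0mx.
have sig0 : sigma' 0 = 0 by rewrite -tau'0 st.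
have germ (t : R) : 0 < t -> t <= sA ->
    natural_domain a (t%:C *: e0 : 'rV[C^o]_d1.+1) /\
    en (tau' (t%:C *: e0) - (t * s)%:C *: e0) <= KA * t ^+ 2.
  move=> t0 tA; have := hA (t%:C *: e0).
  rewrite en_te0 ?(ltW t0) // => /(_ tA) [Xt ht]; split=> //.
  rewrite tau0 subr0 in ht.
  have -> : (t * s)%:C *: e0 = (t%:C *: e0 *m A : 'rV[C^o]_d2.+1) *m U.
    by rewrite -!scalemxAl eU scalerA -rcM.
  by rewrite /tau' /= -mulmxBl en_unitaryE.
have [B [sB [KB [sB0 KB0 hB]]]] := wco_diff hH2 hH1 hS.
have [N N0 hN] := en_mulmx B.
have s0 : 0 <= s by exact: en_ge0.
pose K' := KB * (s + KA) ^+ 2 + N * KA.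
have sK0 : 0 <= s + KA by rewrite addr_ge0.
have K'0 : 0 <= K' by rewrite addr_ge0 // mulr_ge0 // sqr_ge0.
pose m := Num.min (Num.min sA 1) (sB / (s + KA + 1)).
have m0 : 0 < m by rewrite !lt_min sA0 ltr01 divr_gt0 // ltr_wpDl.
have small (t : R) : 0 < t -> t <= m ->
    en (e0 - s%:C *: (e0 *m B) : 'rV[C^o]_d1.+1) <= K' * t.
  move=> t0; rewrite !le_min => /andP[/andP[tA t1] tB].
  have [Xt gt] := germ t t0 tA; set y := tau' _ in gt.
  have t2 : t ^+ 2 <= t by rewrite expr2 ler_piMr // ltW.
  have ny : en y <= (s + KA) * t.
    rewrite -(subrK ((t * s)%:C *: e0) y) mulrDl addrC.
    apply: (le_trans (enD _ _)); apply: lerD.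
      by rewrite en_te0 ?mulr_ge0 ?(ltW t0) // mulrC.
    by apply: (le_trans gt); rewrite ler_wpM2l.
  have ys : en y <= sB.
    apply: (le_trans ny); apply: (@le_trans _ _ (t * (s + KA + 1))).
      by rewrite mulrC ler_wpM2l ?(ltW t0) // lerDl.
    by rewrite -ler_pdivlMr // ltr_wpDl.
  have [_ hy] := hB y ys; rewrite sig0 subr0 /y st // in hy.
  rewrite -(ler_pM2l t0) mulrCA -expr2 -{1}(ger0_norm (ltW t0)) -nc_real -enZ.
  have -> : t%:C *: (e0 - s%:C *: (e0 *m B)) =
      (t%:C *: e0 - (y *m B : 'rV[C^o]_d1.+1)) +
      ((y - (t * s)%:C *: e0) *m B : 'rV[C^o]_d1.+1).
    by rewrite mulmxBl addrA subrK -scalemxAl scalerBr scalerA -rcM.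
  apply: (le_trans (enD _ _)); rewrite mulrDl; apply: lerD.
    apply: (le_trans hy); rewrite -mulrA ler_wpM2l // -exprMn.
    by apply: lerXn2r; rewrite ?nnegrE ?en_ge0 // mulr_ge0 // ltW.
  by apply: (le_trans (hN _)); rewrite -mulrA ler_wpM2l.
have e0E : (e0 : 'rV[C^o]_d1.+1) = s%:C *: (e0 *m B).
  apply/eqP; rewrite -subr_eq0; apply/eqP/en_eq0/eqP.
  rewrite eq_le en_ge0 andbT; apply/ler_addgt0Pl => e e_gt0; rewrite addr0.
  have K1 : 0 < K' + 1 by rewrite ltr_wpDl.
  apply: (le_trans (small (Num.min m (e / (K' + 1))) _ _)).
  - by rewrite lt_min m0 divr_gt0.
  - by rewrite ge_min lexx.
  apply: (@le_trans _ _ (K' * (e / (K' + 1)))).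
    by rewrite ler_wpM2l // ge_min lexx orbT.
  by rewrite mulrA ler_pdivrMr // mulrC ler_wpM2l ?(ltW e_gt0) // lerDl.
have sgt : 0 < s.
  rewrite lt_neqAle s0 andbT; apply/eqP => s00; move/eqP: e0E; rewrite -s00.
  by rewrite scale0r => /eqP e00; have := @en_e0 R d1; rewrite e00 en0 => /eqP; rewrite eq_sym oner_eq0.
have e0B : (e0 *m B : 'rV[C^o]_d1.+1) = (s^-1)%:C *: e0.
  by rewrite e0E scalerA -rcM mulVf ?gt_eqF // scale1r.
exists s, tau', sigma'; split=> //.
  by exists KA, sA.
exists KB, sB; split=> // t t0 tB; have := hB (t%:C *: e0).
rewrite en_te0 ?(ltW t0) // => /(_ tB) [Xt ht]; split=> //.
by move: ht; rewrite sig0 subr0 -scalemxAl e0B scalerA -rcM.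
Qed.

End AxisGerm.

(** * Comparison of the coefficients *)

Section Coefficients.
Context {R : realType} {d1 d2 : nat} {a b : nat -> R}
    {H1 : hilbert_function_space R (@natural_domain R d1.+1 a)}
    {H2 : hilbert_function_space R (@natural_domain R d2.+1 b)}
    (hH1 : weighted_hardy H1) (hH2 : weighted_hardy H2).
Local Notation C := R[i].

Lemma cvg_toX (u : nat -> C) l n : cvg_to u l -> cvg_to (fun k => u k ^+ n) (l ^+ n).
Proof.
move=> h; elim: n => [|n IH].
  by apply: (@cvg_to_cst _ _ _ 0%N) => N _; rewrite !expr0.
have -> : (fun k => u k ^+ n.+1) = (fun k => u k * u k ^+ n).
  by apply/funext => k; rewrite exprS.
by rewrite exprS; exact: cvg_toM.
Qed.

(** On the first axis, [W z_0^n] is [lam * (tau_0) ^ n] and [tau_0 (t e0) / t] tends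
    to [s]: its expansion starts at order [n], with coefficient [lam 0 * s ^ n]. *)
Lemma cf_axis_wco lam tau (W : H2 -> H1) s n : wco lam tau W ->
  axis_germ a s tau ->
  cf hH1 (W (mon hH2 (axis n))) (axis n) = lam 0 * s%:C ^+ n.
Proof.
move=> hW [K [t0 [t00 K0 germ]]]; have ga := wh_generating hH1.
have X0 := open_domain_sub ga (open_domain0 ga (d := d1.+1)).
have [M [r hu]] := axis_tay hH1 (W (mon hH2 (axis n))).
have [L [r' hl]] := axis_tay hH1 (W (one hH2)).
have L0 := tay_M_ge0 hl; have r0 := tay_s_gt0 hu; have r'0 := tay_s_gt0 hl.
set u := (fun eta => _) in hu; set l := (fun eta => _) in hl.
pose m := Num.min (Num.min t0 1) (Num.min r r').
have m0 : 0 < m by rewrite !lt_min t00 ltr01 r0.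
pose q (t : R) : C := tau (t%:C *: e0) 0 0 / t%:C.
have small (t : R) : 0 < t -> t <= m -> [/\ u t%:C = l t%:C * (q t * t%:C) ^+ n,
    nc (l t%:C) <= L & nc (s%:C - q t) <= K * t].
  move=> tp; rewrite !le_min => /andP[/andP[tt0 t1] /andP[tr tr']].
  have [Xt gt] := germ t tp tt0; have tn : t%:C != 0 by rewrite rc_eq0 gt_eqF.
  have nt : nc t%:C = t by rewrite nc_real ger0_norm // ltW.
  split.
  - rewrite /u /l (wco_ev hW) // -(wco_lamE hH2 hW) // mon_ev; last exact: (wco_dom hW Xt).
    by rewrite monomial_axis divfK.
  - by apply: (tay_bound hl); rewrite nt.
  rewrite -(ler_pM2r tp).
  have -> : nc (s%:C - q t) * t = nc ((s%:C - q t) * t%:C) by rewrite ncM nt.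
  rewrite mulrBl divfK // -mulrA -expr2.
  apply: le_trans gt; rewrite nc_dist.
  have := nc_le_en (tau (t%:C *: e0) - (t * s)%:C *: e0) 0.
  by rewrite !mxE !eqxx mulr1 rcM [t%:C * _]mulrC.
have vanish k : (k < n)%N -> cf hH1 (W (mon hH2 (axis n))) (axis k) = 0.
  apply: (tay_order (A := L * (nc s%:C + K) ^+ n) hu) => delta d0.
  pose t := Num.min m (delta / 2); have tp : 0 < t by rewrite lt_min m0 divr_gt0.
  have tm : t <= m by rewrite ge_min lexx.
  have nt : nc t%:C = t by rewrite nc_real ger0_norm // ltW.
  exists t%:C; split; first by rewrite rc_eq0 gt_eqF.
    rewrite nt; apply: (@le_lt_trans _ _ (delta / 2)); first by rewrite ge_min lexx orbT.
    by rewrite ltr_pdivrMr // ltr_pMr // ltr1n.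
  have [-> hL hq] := small t tp tm; rewrite ncM exprMn ncM mulrA !ncX.
  apply: ler_wpM2r; first by rewrite exprn_ge0 // nc_ge0.
  apply: ler_pM; rewrite ?nc_ge0 ?exprn_ge0 ?nc_ge0 //.
  apply: lerXn2r; rewrite ?nnegrE ?addr_ge0 ?nc_ge0 //.
  rewrite -{1}(subKr s%:C (q t)); apply: (le_trans (ncB _ _)); rewrite lerD2l.
  apply: (le_trans hq); rewrite ler_piMr //; apply: (le_trans tm).
  by rewrite !ge_min lexx orbT.
pose t k : R := m / k.+1%:R.
have tp k : 0 < t k by rewrite divr_gt0.
have tm k : t k <= m by rewrite ler_pdivrMr // ler_peMr ?(ltW m0) // ler1n.
have nt k : nc (t k)%:C = t k by rewrite nc_real ger0_norm // ltW.
have tsmall e : 0 < e -> exists N0, forall k, (N0 <= k)%N -> t k < e.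
  move=> e0; exists (Num.truncn (m / e)) => k hk.
  rewrite ltr_pdivrMr // mulrC -ltr_pdivrMr //.
  by apply: (lt_le_trans (truncnS_gt _)); rewrite ler_nat ltnS.
have cq : cvg_to (fun k => q (t k)) s%:C.
  move=> e e0; have K1 : 0 < K + 1 by rewrite ltr_wpDl.
  have [N0 hN] := tsmall _ (divr_gt0 e0 K1); exists N0 => k /hN /ltW.
  rewrite ler_pdivlMr // => h; have [_ _] := small _ (tp k) (tm k).
  by move=> /le_trans; apply; apply: le_trans h; rewrite mulrC ler_wpM2l ?lerDl // ltW.
have cl : cvg_to (fun k => l (t k)%:C) (lam 0).
  have -> : lam 0 = l 0 by rewrite /l scale0r -(wco_lamE hH2 hW).
  move=> e e0; have [del d0 hd] := tay_cont hl e0; have [N0 hN] := tsmall _ d0.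
  by exists N0 => k /hN h; rewrite nc_dist ltW // hd // nt.
have hv := tay_shift hu vanish.
apply: (@cvg_to_uniq _ (fun k => shift_fun u (fun k => cf hH1 (W (mon hH2 (axis n))) (axis k)) n (t k)%:C)).
  have := tay_at0 hv; rewrite add0n => <-.
  move=> e e0; have [del d0 hd] := tay_cont hv e0; have [N0 hN] := tsmall _ d0.
  by exists N0 => k /hN h; rewrite nc_dist ltW // hd // nt.
have -> : (fun k => shift_fun u (fun k => cf hH1 (W (mon hH2 (axis n))) (axis k)) n (t k)%:C)
    = (fun k => l (t k)%:C * q (t k) ^+ n).
  apply/funext => k; have tn : (t k)%:C != 0 by rewrite rc_eq0 gt_eqF.
  have [uE _ _] := small _ (tp k) (tm k).
  rewrite /shift_fun (negPf tn) uE exprMn mulrA mulfK //.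
  by rewrite expf_neq0.
exact: cvg_toM cl (cvg_toX n cq).
Qed.

(** Apply [W] to [z_0^n] and bound the coefficient of [z_0^n] in the image by
    Cauchy-Schwarz. *)
Lemma axis_ratio_bounded lam tau (W : H2 -> H1) s : wco lam tau W ->
  axis_germ a s tau -> 0 < s ->
  exists2 B : R, 0 < B & forall n, b n / a n * (s ^+ 2) ^+ n <= B.
Proof.
move=> hW hg s0; have ga := wh_generating hH1; have gb := wh_generating hH2.
have X0 := open_domain_sub ga (open_domain0 ga (d := d1.+1)).
have [_ _ [M hM] _] := hW.
have lp : 0 < nc (lam 0) by rewrite nc_gt0 (wco_neq0 hH1 hW).
have l2 : 0 < nc (lam 0) ^+ 2 by rewrite exprn_gt0.
exists (M ^+ 2 / nc (lam 0) ^+ 2 + 1) => [|n].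
  by rewrite ltr_wpDl // divr_ge0 // ?sqr_ge0 // ltW.
have [_ ap _] := ga; have [_ bp _] := gb; have an := ap n; have bn := bp n.
set x := mon hH2 (axis n); set y := mon hH1 (axis n).
have yn : hn y ^+ 2 = (a n)^-1 by exact: mon_axis_norm.
have xn : hn x ^+ 2 = (b n)^-1 by exact: mon_axis_norm.
have dE : hfs_dot H1 (W x) y = lam 0 * s%:C ^+ n * (a n)^-1%:C.
  rewrite -yn -hn_dot -(cf_axis_wco n hW hg) divfK //; exact: mon_dot_neq0.
have ineq : nc (lam 0) * s ^+ n * (a n)^-1 <= M * hn x * hn y.
  have -> : nc (lam 0) * s ^+ n * (a n)^-1 = nc (hfs_dot H1 (W x) y).
    rewrite dE !ncM ncX !nc_real !ger0_norm // ?invr_ge0; exact: ltW.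
  by apply: (le_trans (hn_CS _ _)); rewrite ler_wpM2r ?hn_ge0.
have lhs0 : 0 <= nc (lam 0) * s ^+ n * (a n)^-1.
  by rewrite !mulr_ge0 ?invr_ge0 ?exprn_ge0 ?nc_ge0 // ltW.
have : (nc (lam 0) * s ^+ n * (a n)^-1) ^+ 2 <= (M * hn x * hn y) ^+ 2.
  by apply: lerXn2r; rewrite ?nnegrE // (le_trans lhs0).
rewrite !exprMn xn yn => h.
apply: (@le_trans _ _ (M ^+ 2 / nc (lam 0) ^+ 2)); last by rewrite lerDl.
rewrite ler_pdivlMr // -(ler_pM2r (_ : 0 < (b n)^-1 / a n)); last first.
  by rewrite mulr_gt0 ?invr_gt0.
have -> : M ^+ 2 * ((b n)^-1 / a n) = M ^+ 2 / b n / a n by rewrite mulrA.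
apply: le_trans h; rewrite le_eqVlt; apply/orP; left; apply/eqP.
by field; rewrite !gt_eqF.
Qed.

End Coefficients.

Theorem theorem7p1 (R : realType) (d1 d2 : nat) (hd1 : (0 < d1)%N)
  (hd2 : (0 < d2)%N) (a b : nat -> R)
  (H1 : hilbert_function_space R (@natural_domain R d1 a))
  (H2 : hilbert_function_space R (@natural_domain R d2 b))
  (hH1 : weighted_hardy H1) (hH2 : weighted_hardy H2)
  (hG1 : ~ entire a) (hrel : strongly_related H1 H2) :
  exists C c gamma : R, [/\ 0 < C, 0 < c, 0 < gamma &
    forall n : nat, c <= b n / a n * gamma ^+ n <= C].
Proof.
case: d1 d2 hd1 hd2 H1 H2 hH1 hH2 hrel => [|d1] [|d2] // _ _ H1 H2 hH1 hH2 hrel.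
have [phi [theta iso]] := wiso_of_strongly_related hH1 hH2 hG1 hrel.
have [tau0 [sigma0 [iso0 fix0]]] := wiso_fix0 hH1 hH2 iso.
have [s [tau [sigma [[[lam [W hW]] [mu [S hS]] _ _] s0 gt gs]]]] :=
  wiso_axis hH1 hH2 iso0 fix0.
have si : 0 < s^-1 by rewrite invr_gt0.
have [B B0 hB] := axis_ratio_bounded hH1 hH2 hW gt s0.
have [B' B'0 hB'] := axis_ratio_bounded hH2 hH1 hS gs si.
have [_ ap _] := wh_generating hH1; have [_ bp _] := wh_generating hH2.
exists B, B'^-1, (s ^+ 2); split; rewrite ?invr_gt0 ?exprn_gt0 // => n.
rewrite hB andbT.
have p : 0 < b n / a n * (s ^+ 2) ^+ n by rewrite mulr_gt0 ?divr_gt0 ?exprn_gt0.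
rewrite invf_ple ?posrE //; apply: le_trans (hB' n).
by rewrite invfM invf_div !exprVn.
Qed.
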